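(* Let $r\ge 1$ be a fixed integer. For every $n=1,2,\ldots$ let $(X_{n,t})_{t=1}^{\infty}$ be a strictly stationary sequence of real random variables satisfying the absolute regularity condition with coefficients $\beta_n(t)$, i.e. $\beta_n(t)\downarrow 0$ as $t\to\infty$ for each $n$. For every $n$ let $\{f_{n;j_1,\ldots,j_r}: 1\le j_1,\ldots,j_r\le n\}$ be a family of measurable functions $\mathbb{R}^r\to\mathbb{R}$ with $|f_{n;j_1,\ldots,j_r}|<F_n<\infty$, where the number $F_n$ does not depend on $n$ from some value of $n$ on. Put $$V_n=\sum_{j_1,\ldots,j_r=1}^{n} f_{n;j_1,\ldots,j_r}(X_{n,j_1},\ldots,X_{n,j_r}),\qquad V_n^*=\frac{V_n-\mathbf{E}V_n}{\sqrt{\mathbf{D}V_n}}.$$ Suppose there are constants $C>0$, $\varkappa>0$ and a positive function $h$ (not depending on $n$) with $h(t)\to\infty$ as $t\to\infty$ such that, as $n\to\infty$ varies, $$\beta_n(t)\le t^{-h(t)}\quad (t=1,2,\ldots),\qquad \mathbf{D}V_n\ge C\,n^{2(r-1)+\varkappa}.$$ Then, as $n\to\infty$, the moments and the distribution function of $V_n^*$ converge to the moments and the distribution function of the standard normal law; that is, for every integer $k\ge 1$, $\mathbf{E}(V_n^* )^k\to\mathbf{E}N^k$ with $N\sim\mathcal N(0,1)$, and $\mathbf{P}(V_n^*\le x)\to\mathbf{P}(N\le x)$ for every $x\in\mathbb{R}$.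
   Context: $\mathbf{E}$ and $\mathbf{D}$ denote expectation and variance. The distribution of the sequence $(X_{n,t})_{t\ge1}$ and the functions $f_{n;j_1,\ldots,j_r}$ may depend on $n$ (triangular array scheme). The inequalities for $\beta_n(t)$ and $\mathbf{D}V_n$ are required for all $n$; only large $n$ matter. Strict stationarity: for all $k\ge1$ and $t_1,\ldots,t_k,\tau\ge 1$, the vectors $(X_{n,t_1+\tau},\ldots,X_{n,t_k+\tau})$ and $(X_{n,t_1},\ldots,X_{n,t_k})$ have the same distribution. Absolute regularity: the stationary sequence $(X_{n,t})_{t\ge 1}$ is extended (in law) to a two-sided stationary sequence indexed by $t\in\mathbb{Z}$, $\mathcal F_a^b$ denotes the $\sigma$-algebra generated by $X_{n,t}$, $a\le t\le b$, and $$\beta_n(t)=\mathbf{E}\Bigl\{\sup_{A\in\mathcal F_t^{\infty}}\bigl|\mathbf{P}\{A\mid\mathcal F_{-\infty}^{0}\}-\mathbf{P}\{A\}\bigr|\Bigr\},\qquad t=1,2,\ldots,$$ the supremum being understood as an essential supremum. The sequence satisfies the absolute regularity condition if $\beta_n(t)\downarrow0$ as $t\to\infty$. *)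

(* Defs.v *)
From mathcomp Require Export all_boot all_order all_algebra.
From mathcomp Require Export all_classical all_reals all_analysis.
From mathcomp Require Export measurable_realfun.

Set Implicit Arguments.
Unset Strict Implicit.
Unset Printing Implicit Defensive.

Import Order.TTheory GRing.Theory Num.Theory.
Import numFieldNormedType.Exports.

Local Open Scope classical_set_scope.
Local Open Scope ring_scope.

(* The processes X (under P) and Y (under Q), possibly living on different
   probability spaces, have the same finite-dimensional distributions at the
   times belonging to D. *)
Definition eq_fdd (R : realType) (I : Type)
    (d : measure_display) (T : measurableType d) (P : probability T R)
    (d' : measure_display) (T' : measurableType d') (Q : probability T' R)
    (D : set I) (X : I -> T -> R) (Y : I -> T' -> R) : Prop :=
  forall (k : nat) (t : k.-tuple I), (0 < k)%N -> (forall i, D (tnth t i)) ->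
  forall A : set (k.-tuple R), measurable A ->
    P [set w | A [tuple X (tnth t i) w | i < k]] =
    Q [set w | A [tuple Y (tnth t i) w | i < k]].

(* A one-sided sequence is indexed by t = 1, 2, ...; the value X 0 is ignored
   throughout. *)
Definition stationary (R : realType) (d : measure_display)
    (T : measurableType d) (P : probability T R) (X : nat -> T -> R) : Prop :=
  forall tau : nat, (1 <= tau)%N ->
    eq_fdd P P [set t | (1 <= t)%N] (fun t => X (t + tau)%N) X.

Definition stationary2 (R : realType) (d : measure_display)
    (T : measurableType d) (P : probability T R) (Y : int -> T -> R) : Prop :=
  forall tau : int, eq_fdd P P setT (fun t => Y (t + tau)) Y.

(* The sigma-algebra generated by the Y_t with t in D. *)
Definition sigma_gen (R : realType) (I : Type) (d : measure_display)
    (T : measurableType d) (Y : I -> T -> R) (D : set I) : set (set T) :=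
  <<s \bigcup_(t in D) preimage_set_system setT (Y t) measurable >>.

(* g is a version of the conditional probability P(A | G). *)
Definition is_cond_prob (R : realType) (d : measure_display)
    (T : measurableType d) (P : probability T R) (G : set (set T))
    (A : set T) (g : T -> R) : Prop :=
  [/\ forall B : set R, measurable B -> G (g @^-1` B),
      P.-integrable setT (EFin \o g) &
      forall B, G B -> (\int[P]_(w in B) (g w)%:E = P (A `&` B))%E].

(* s is (a version of) the essential supremum of the family of functions
   (F i), i in D: the P-a.e. least measurable P-a.e. upper bound. The library's
   ess_sup is the essential supremum of one function, which is a number. *)
Definition is_ess_sup_family (R : realType) (I : Type) (d : measure_display)
    (T : measurableType d) (P : probability T R)
    (D : set I) (F : I -> T -> \bar R) (s : T -> \bar R) : Prop :=
  [/\ measurable_fun setT s,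
      forall i, D i -> {ae P, forall w, (F i w <= s w)%E} &
      forall u : T -> \bar R, measurable_fun setT u ->
        (forall i, D i -> {ae P, forall w, (F i w <= u w)%E}) ->
        {ae P, forall w, (s w <= u w)%E}].

(* b = E { ess sup_(A in F_t^oo) | P(A | F_-oo^0) - P(A) | }. Conditional
   probabilities and essential suprema being defined up to null sets, b does
   not depend on the versions c and s. *)
Definition is_beta2 (R : realType) (d : measure_display)
    (T : measurableType d) (P : probability T R) (Y : int -> T -> R)
    (t : nat) (b : R) : Prop :=
  let past := sigma_gen Y [set i : int | i <= 0] in
  let future := sigma_gen Y [set i : int | t%:Z <= i] in
  exists (c : set T -> T -> R) (s : T -> \bar R),
    [/\ forall A, future A -> is_cond_prob P past A (c A),
        is_ess_sup_family P future
          (fun A w => `|(c A w)%:E - P A|%E) s &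
        (\int[P]_w s w = b%:E)%E].

(* beta t, for t = 1, 2, ..., are the absolute regularity coefficients of the
   one-sided sequence X, computed on a two-sided stationary sequence Y that
   extends X in law. *)
Definition is_beta (R : realType) (d : measure_display)
    (T : measurableType d) (P : probability T R) (X : nat -> T -> R)
    (beta : nat -> R) : Prop :=
  exists (d' : measure_display) (T' : measurableType d')
         (Q : probability T' R) (Y : int -> {RV Q >-> R}),
    [/\ stationary2 Q Y,
        eq_fdd Q P [set t | (1 <= t)%N] (fun t : nat => Y t%:Z) X &
        forall t, (1 <= t)%N -> is_beta2 Q Y t (beta t)].

(* beta(t) decreases to 0 over t = 1, 2, ... *)
Definition decreases_to0 (R : realType) (beta : nat -> R) : Prop :=
  (forall s t, (1 <= s)%N -> (s <= t)%N -> beta t <= beta s) /\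
  beta t @[t --> \oo] --> (0 : R).

(* V_n; an index i : 'I_n stands for the time i.+1 in {1, ..., n}. *)
Definition Vsum (R : realType) (T : Type) (r n : nat) (X : nat -> T -> R)
    (f : r.-tuple 'I_n -> r.-tuple R -> R) (w : T) : R :=
  \sum_(j : r.-tuple 'I_n) f j [tuple X (tnth j i).+1 w | i < r].

Definition standardize (R : realType) (d : measure_display)
    (T : measurableType d) (P : probability T R) (V : T -> R) (w : T) : R :=
  (V w - fine 'E_P[V]) / Num.sqrt (fine 'V_P[V]).

(* Main.v *)
(* Only the joint law of X_1, ..., X_n matters, and the centred V is a sum of
   functions of r coordinates each. Removing from V the summands with an index
   within distance t of a given set of coordinates, and decoupling the rest by
   absolute regularity, gives by iteration, for a function Z of few coordinates,
     E[Z V^k] = sum_(j < K) c_j k (k - 1) ... (k - j + 1) E[V^(k - j)] + error,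
   where the c_j do not depend on k. With Z = V, after normalization and with t
   of order n^(1/p), the moments m_k of V* satisfy up to o(1)
     m_(k+1) = sum_(1 <= j < K) a_j k (k - 1) ... (k - j + 1) m_(k - j).
   In the limit this recursion says that the moment generating function is the
   exponential of a polynomial; by Marcinkiewicz's theorem the polynomial is
   quadratic, so the limit moments are Gaussian. Convergence of the moments
   gives that of the expectations of trigonometric polynomials, and indicators
   of half-lines are squeezed between Bernstein polynomials of 1 + sin. *)

Require Import Defs.
From HB Require Import structures.
From mathcomp Require Import ring lra zify.

Set Implicit Arguments.
Unset Strict Implicit.
Unset Printing Implicit Defensive.

Import Order.TTheory GRing.Theory Num.Theory.
Import numFieldNormedType.Exports.

Local Open Scope classical_set_scope.
Local Open Scope ring_scope.

(** * Bounded measurable functions *)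

Section bounded_measurable.
Context {R : realType} {d : measure_display} {T : measurableType d}.
Implicit Types (f g : T -> R) (P : probability T R).

(** The obstacle is that no bound on the coefficients a_j, uniform in n, is at hand. The moments are
    therefore divided by powers of [M n], one plus the sum of the roots |a_j|^(1/(j+1)) over 2 <= j
    < K. The rescaled coefficients are then at most 1 for j >= 2, the recursion itself bounds the
    rescaled moments, and limits exist along every ultrafilter. Marcinkiewicz's theorem makes the
    limits of the rescaled coefficients vanish for j >= 2; as the rescaled roots and the inverse of
    [M n] add up to 1, [M n] tends to 1. Positivity enters through the Hankel forms of the moments,
    so no limit law has to be constructed. The orders match as follows. With p >= 4/kappa and t = m
    close to n^(1/p), the standard deviation is at least of order n^(r-1) m^2, while the summands
    near one coordinate have total size of order m n^(r-1): each order of the expansion gains a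
    factor 1/m. The prefactor n^r / sqrt(D V) is at most of order m^p, so K = p + 1 orders suffice.
    The mixing error carries m^(p(k+2)), which the superpolynomial decay of beta beats for each
    fixed k. *)

Definition bmf f := measurable_fun setT f /\ exists M, forall x, `|f x| <= M.

Lemma bmf_cst (c : R) : bmf (fun=> c).
Proof. by split; [exact: measurable_cst|exists `|c|]. Qed.

Lemma bmfD f g : bmf f -> bmf g -> bmf (fun x => f x + g x).
Proof.
move=> [mf [M fM]] [mg [N gN]]; split; first exact: measurable_funD.
by exists (M + N) => x; rewrite (le_trans (ler_normD _ _))// lerD.
Qed.

Lemma bmfM f g : bmf f -> bmf g -> bmf (fun x => f x * g x).
Proof.
move=> [mf [M fM]] [mg [N gN]]; split; first exact: measurable_funM.
by exists (M * N) => x; rewrite normrM ler_pM.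
Qed.

Lemma bmfN f : bmf f -> bmf (fun x => - f x).
Proof.
move=> bf; have := bmfM (bmf_cst (-1)) bf.
by congr bmf; apply/funext => x; rewrite mulN1r.
Qed.

Lemma bmfB f g : bmf f -> bmf g -> bmf (fun x => f x - g x).
Proof. by move=> bf bg; apply: bmfD => //; exact: bmfN. Qed.

Lemma bmfX f k : bmf f -> bmf (fun x => f x ^+ k).
Proof.
move=> bf; elim: k => [|k IH]; first exact: bmf_cst.
have := bmfM bf IH; congr bmf; apply/funext => x; by rewrite exprS.
Qed.

Lemma bmf_sum (I : Type) (s : seq I) (Q : pred I) (F : I -> T -> R) :
  (forall i, Q i -> bmf (F i)) -> bmf (fun x => \sum_(i <- s | Q i) F i x).
Proof.
move=> bF; elim: s => [|i s IH].
  rewrite (_ : (fun _ => _) = fun=> 0); first exact: bmf_cst.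
  by apply/funext => x; rewrite big_nil.
case Qi : (Q i).
  have := bmfD (bF i Qi) IH; congr bmf; apply/funext => x.
  by rewrite big_cons Qi.
by move: IH; congr bmf; apply/funext => x; rewrite big_cons Qi.
Qed.

Lemma bmf_norm f : bmf f -> bmf (fun x => `|f x|).
Proof.
move=> [mf [M fM]]; split; first exact: measurableT_comp.
by exists M => x; rewrite normr_id.
Qed.

Lemma bmf_indic (A : set T) : measurable A -> bmf (\1_A : T -> R).
Proof.
move=> mA; split; first exact: measurable_indic.
by exists 1 => x; rewrite indicE; case: (x \in A); rewrite ?normr1 ?normr0.
Qed.

Lemma bmf_integrable P f : bmf f -> P.-integrable setT (EFin \o f).
Proof.
move=> [mf [M fM]]; apply: measurable_bounded_integrable => //.
  by rewrite ltey_eq fin_num_measure.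
exists M; split; first by rewrite num_real.
by move=> N MN x _ /=; apply: le_trans (fM x) (ltW MN).
Qed.

(** Real-valued expectation, meant for bounded functions: integrability is then automatic and the
    rules below carry only [bmf] side conditions. *)
Definition Ev P f : R := \int[P]_x f x.

Lemma Ev_cst P (c : R) : Ev P (fun=> c) = c.
Proof.
rewrite /Ev (Rintegral_cst P measurableT).
transitivity (c * fine (P setT)) => //; by rewrite probability_setT mulr1.
Qed.

Lemma EvD P f g : bmf f -> bmf g -> Ev P (fun x => f x + g x) = Ev P f + Ev P g.
Proof. by move=> bf bg; rewrite /Ev RintegralD//; exact: bmf_integrable. Qed.

Lemma EvZ P (c : R) f : bmf f -> Ev P (fun x => c * f x) = c * Ev P f.
Proof. by move=> bf; rewrite /Ev RintegralZl//; exact: bmf_integrable. Qed.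

Lemma EvN P f : bmf f -> Ev P (fun x => - f x) = - Ev P f.
Proof.
move=> bf; rewrite -mulN1r -EvZ//; congr Ev; apply/funext => x.
by rewrite mulN1r.
Qed.

Lemma EvB P f g : bmf f -> bmf g -> Ev P (fun x => f x - g x) = Ev P f - Ev P g.
Proof. by move=> bf bg; rewrite EvD ?EvN//; exact: bmfN. Qed.

Lemma Ev_sum P (I : Type) (s : seq I) (Q : pred I) (F : I -> T -> R) :
  (forall i, Q i -> bmf (F i)) ->
  Ev P (fun x => \sum_(i <- s | Q i) F i x) = \sum_(i <- s | Q i) Ev P (F i).
Proof.
move=> bF; elim: s => [|i s IH].
  rewrite big_nil -[RHS](Ev_cst P); congr Ev; apply/funext => x.
  by rewrite big_nil.
rewrite big_cons -IH; case: ifP => Qi.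
  rewrite -EvD; [|exact: bF|exact: bmf_sum].
  by congr Ev; apply/funext => x; rewrite big_cons Qi.
by congr Ev; apply/funext => x; rewrite big_cons Qi.
Qed.

Lemma le_Ev P f g : bmf f -> bmf g -> (forall x, f x <= g x) -> Ev P f <= Ev P g.
Proof.
by move=> bf bg fg; rewrite /Ev le_Rintegral//; exact: bmf_integrable.
Qed.

Lemma Ev_ge0 P f : (forall x, 0 <= f x) -> 0 <= Ev P f.
Proof. by move=> f0; exact: Rintegral_ge0. Qed.

Lemma le_norm_Ev P f : bmf f -> `|Ev P f| <= Ev P (fun x => `|f x|).
Proof. by move=> bf; rewrite /Ev le_normr_Rintegral//; exact: bmf_integrable. Qed.

Lemma Ev_le_cst P f (M : R) : bmf f -> (forall x, f x <= M) -> Ev P f <= M.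
Proof. by move=> bf fM; rewrite -(Ev_cst P M) le_Ev//; exact: bmf_cst. Qed.

Lemma norm_Ev_le P f (M : R) : bmf f -> (forall x, `|f x| <= M) -> `|Ev P f| <= M.
Proof.
move=> bf fM; rewrite (le_trans (le_norm_Ev P bf))// Ev_le_cst//.
exact: bmf_norm.
Qed.

Lemma Ev_indic P (A : set T) : measurable A -> Ev P (\1_A : T -> R) = fine (P A).
Proof.
by move=> mA; rewrite /Ev /Rintegral; congr fine; rewrite integral_indic// setIT.
Qed.

Lemma EFin_Ev P f : bmf f -> (Ev P f)%:E = (\int[P]_x (f x)%:E)%E.
Proof.
by move=> bf; rewrite /Ev /Rintegral fineK//; apply/integrable_fin_num => //;
  exact: bmf_integrable.
Qed.

End bounded_measurable.

Lemma bmf_comp {R : realType} {d d' : measure_display} {T : measurableType d}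
  {T' : measurableType d'} (f : T' -> R) (u : T -> T') :
  bmf f -> measurable_fun setT u -> bmf (f \o u).
Proof.
move=> [mf [M fM]] mu; split; first exact: measurableT_comp.
by exists M => x; exact: fM.
Qed.

(** The sum counts the integers from 1 to [n] that do not exceed [y], so it is the integer part of
    [y]. *)
Lemma count_thresholds {R : realType} (n : nat) (y : R) :
  0 <= y -> y < n.+1%:R ->
  let c := \sum_(i < n) (i.+1%:R <= y)%R%:R in c <= y <= c + 1.
Proof.
move=> y0 yn /=; apply/andP; split.
  elim: n {yn} => [|n IH]; first by rewrite big_ord0.
  rewrite big_ord_recr/=; case: (lerP n.+1%:R y) => ny; last by rewrite addr0.
  rewrite (le_trans _ ny)// -natr1 lerD2r.
  rewrite (le_trans (ler_sum _ (G := fun=> 1) _))//.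
    by move=> i _; rewrite lern1 leq_b1.
  by rewrite sumr_const card_ord.
have full m : m%:R <= y -> \sum_(i < m) (i.+1%:R <= y)%R%:R = m%:R :> R.
  move=> my; rewrite (eq_bigr (fun=> 1)) ?sumr_const ?card_ord// => i _.
  by rewrite (le_trans _ my)// ler_nat.
elim: n yn => [|n IH] yn; first by rewrite big_ord0 add0r ltW.
case: (lerP n.+1%:R y) => ny; first by rewrite full// natr1 ltW.
by rewrite big_ord_recr/= (leNgt n.+1%:R) ny addr0 IH.
Qed.

(** A function with values in [0, 1] is within 1/n of the average of the indicators of [n]
    superlevel sets, and the two expectations of each indicator differ by at most [b]. The factor 2
    M comes from mapping [-M, M] affinely onto [0, 1]. *)
Lemma Ev_discretize {R : realType} {d : measure_display} {T : measurableType d}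
  (P Q : probability T R) (b : R) :
  (forall C, measurable C -> `|fine (P C) - fine (Q C)| <= b) ->
  forall (f : T -> R) (M : R), bmf f -> (forall x, `|f x| <= M) ->
  `|Ev P f - Ev Q f| <= 2 * M * b.
Proof.
move=> PQ.
have b0 : 0 <= b by apply: le_trans (PQ set0 measurable0).
have unit_case (f : T -> R) : bmf f -> (forall x, 0 <= f x <= 1) ->
    `|Ev P f - Ev Q f| <= b.
  move=> bf f01; apply/ler_addgt0Pr => e e0.
  have [N Ne] : exists N : nat, N.+1%:R^-1 < e.
    exists (Num.truncn e^-1); rewrite invf_plt ?posrE// ?invr_gt0//.
    exact: truncnS_gt.
  set n := N.+1.
  have n0 : (0 : R) < n%:R by rewrite ltr0n.
  pose S (i : nat) := [set x : T | i.+1%:R <= n%:R * f x].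
  have mS i : measurable (S i).
    have := (measurable_funM (measurable_cst (n%:R : R)) bf.1)
       measurableT _ (measurable_itv `[i.+1%:R, +oo[).
    rewrite setTI; congr measurable; apply/seteqP; split => x;
      by rewrite /S /= in_itv/= andbT.
  pose g x : R := \sum_(i < n) n%:R^-1 * \1_(S i) x.
  have bg : bmf g.
    apply: bmf_sum => i _; apply: bmfM; first exact: bmf_cst.
    exact: bmf_indic.
  have gf x : g x <= f x <= g x + n%:R^-1.
    have /andP[f0 f1] := f01 x.
    have nf0 : 0 <= n%:R * f x by rewrite mulr_ge0.
    have nfn : n%:R * f x < n.+1%:R.
      by rewrite (@le_lt_trans _ _ n%:R) ?ltr_nat// ler_piMr// ltW.
    have := count_thresholds nf0 nfn.
    have -> : g x = n%:R^-1 * \sum_(i < n) (i.+1%:R <= n%:R * f x)%R%:R.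
      rewrite /g mulr_sumr; apply: eq_bigr => i _; congr (_ * _).
      rewrite indicE; congr (nat_of_bool _)%:R.
      by apply/idP/idP; rewrite inE.
    move=> /andP[c1 c2]; rewrite ler_pdivrMl// c1/=.
    by rewrite -[X in _ + X]mulr1 -mulrDr ler_pdivlMl.
  have EgE (W : probability T R) :
      Ev W g = \sum_(i < n) n%:R^-1 * fine (W (S i)).
    rewrite Ev_sum; last by move=> i _; apply: bmfM; [exact: bmf_cst|exact: bmf_indic].
    by apply: eq_bigr => i _; rewrite EvZ ?Ev_indic//; exact: bmf_indic.
  have Eg : `|Ev P g - Ev Q g| <= b.
    rewrite !EgE -sumrB; apply: le_trans (ler_norm_sum _ _ _) _.
    rewrite (le_trans (ler_sum _ (G := fun=> n%:R^-1 * b) _))//.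
      move=> i _; rewrite -mulrBr normrM ger0_norm ?invr_ge0 ?(ltW n0)//.
      by rewrite ler_pM2l ?invr_gt0//; exact: PQ.
    by rewrite -big_distrl/= sumr_const card_ord -[X in X * b]mulr_natl mulfV ?mul1r// gt_eqF.
  have sand (W : probability T R) : Ev W g <= Ev W f <= Ev W g + n%:R^-1.
    apply/andP; split; first by apply: le_Ev => // x; have /andP[] := gf x.
    rewrite -[n%:R^-1](Ev_cst W) -EvD//; last exact: bmf_cst.
    apply: le_Ev => //; first by apply: bmfD => //; exact: bmf_cst.
    by move=> x; have /andP[] := gf x.
  have /andP[P1 P2] := sand P; have /andP[Q1 Q2] := sand Q.
  move: Eg; rewrite !ler_norml => /andP[E1 E2]; move: Ne; rewrite -/n => Ne.
  by apply/andP; split; lra.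
move=> f M bf fM.
have M0 : 0 <= M by apply: le_trans (fM point).
(* The affine map divides by [2 * M], so [M = 0] is set apart. *)
have [M_0|Mn0] := eqVneq M 0.
  have f0 : f = fun=> 0.
    apply/funext => x; apply/eqP; rewrite -normr_le0.
    by rewrite (le_trans (fM x))// M_0.
  by rewrite f0 !Ev_cst subrr normr0 M_0 mulr0 mul0r.
have Mp : 0 < M by rewrite lt_neqAle eq_sym Mn0.
have M2 : 0 < 2 * M by rewrite mulr_gt0.
pose g x := (2 * M)^-1 * (f x + M).
have bg : bmf g by apply: bmfM; [exact: bmf_cst|apply: bmfD => //; exact: bmf_cst].
have := unit_case g bg.
have gE (W : probability T R) : Ev W g = (2 * M)^-1 * (Ev W f + M).
  rewrite EvZ; last by apply: bmfD => //; exact: bmf_cst.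
  by rewrite EvD ?Ev_cst//; exact: bmf_cst.
rewrite !gE -mulrBr normrM ger0_norm ?invr_ge0 ?(ltW M2)//.
rewrite (_ : _ + M - _ = Ev P f - Ev Q f); last by ring.
move=> H.
rewrite -ler_pdivrMl//; apply: H => x; rewrite /g.
have := fM x; rewrite ler_norml => /andP[f1 f2].
rewrite mulr_ge0 ?invr_ge0 ?(ltW M2)//=; last by rewrite -lerBlDr sub0r.
by rewrite ler_pdivrMl// mulr1; lra.
Qed.

(** * Approximation by finite unions of rectangles *)

Section rectangle_approximation.
Context {R : realType} {d1 d2 : measure_display}.
Context {E1 : measurableType d1} {E2 : measurableType d2}.
Implicit Types (C : set (E1 * E2)) (Pa Pb : probability (E1 * E2)%type R).

(* A finite disjoint union of rectangles, encoded by the partition of E1 into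
   the fibres of p and the second sides B i. *)
Definition step_set (I : finType) (p : E1 -> I) (B : I -> set E2) :=
  [set z : E1 * E2 | B (p z.1) z.2].

Definition step_data (I : finType) (p : E1 -> I) (B : I -> set E2) :=
  (forall i, measurable (p @^-1` [set i])) /\ (forall i, measurable (B i)).

Lemma step_setE (I : finType) (p : E1 -> I) (B : I -> set E2) :
  step_set p B = \big[setU/set0]_(i : I) ((p @^-1` [set i]) `*` B i).
Proof.
rewrite -bigcup_seq; apply/seteqP; split => [z Bz|z [i _ [/= <-]]//].
by exists (p z.1) => //=; rewrite mem_index_enum.
Qed.

Lemma measurable_step_set (I : finType) (p : E1 -> I) (B : I -> set E2) :
  step_data p B -> measurable (step_set p B).
Proof.
move=> [mp mB]; rewrite step_setE; apply: bigsetU_measurable => i _.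
exact: measurableX.
Qed.

Lemma measure_step_set (I : finType) (p : E1 -> I) (B : I -> set E2) Pa :
  step_data p B ->
  fine (Pa (step_set p B)) =
  \sum_(i : I) fine (Pa ((p @^-1` [set i]) `*` B i)).
Proof.
move=> dB; have [mp mB] := dB.
rewrite -Ev_indic; last exact: measurable_step_set.
rewrite (eq_bigr (fun i => Ev Pa \1_((p @^-1` [set i]) `*` B i))); last first.
  by move=> i _; rewrite Ev_indic//; exact: measurableX.
rewrite -Ev_sum; last by move=> i _; apply: bmf_indic; exact: measurableX.
congr Ev; apply/funext => -[x y].
rewrite (bigD1 (p x))//= big1 ?addr0 => [|i ip].
  rewrite !indicE; congr (nat_of_bool _)%:R; apply/idP/idP; rewrite !inE//=.
  by case.
by rewrite indicE memNset// => -[/= px _]; rewrite px eqxx in ip.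
Qed.

Definition close_sets Pa Pb (e : R) C D :=
  (Pa ((C `\` D) `|` (D `\` C)) <= e%:E /\ Pb ((C `\` D) `|` (D `\` C)) <= e%:E)%E.

(** One step set must serve both measures, since they are compared on it. Measurability of [C] is
    included so that the closure properties can be proved within the class. *)
Definition step_approx Pa Pb C := measurable C /\
  forall e : R, 0 < e -> exists (I : finType) (p : E1 -> I) (B : I -> set E2),
    step_data p B /\ close_sets Pa Pb e C (step_set p B).

Lemma step_approxC Pa Pb C : step_approx Pa Pb C -> step_approx Pa Pb (~` C).
Proof.
move=> [mC aC]; split; first exact: measurableC.
move=> e e0; have [I [p [B [[mp mB] [c1 c2]]]]] := aC e e0.
exists I, p, (fun i => ~` B i); split.
  by split => // i; exact: measurableC.
rewrite /close_sets.
suff -> : ~` C `\` step_set p (fun i => ~` B i) `|`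
          step_set p (fun i => ~` B i) `\` ~` C =
   (C `\` step_set p B) `|` (step_set p B `\` C) by [].
rewrite (_ : step_set p _ = ~` step_set p B)//.
by rewrite !setDE !setCK setUC [X in _ `|` X]setIC setIC.
Qed.

Lemma step_approxU Pa Pb C D :
  step_approx Pa Pb C -> step_approx Pa Pb D -> step_approx Pa Pb (C `|` D).
Proof.
move=> [mC aC] [mD aD]; split; first exact: measurableU.
move=> e e0; have e2 : 0 < e / 2 by rewrite divr_gt0.
have [I [p [B [dB [c1 c2]]]]] := aC _ e2.
have [J [q [A [dA [b1 b2]]]]] := aD _ e2.
(* The common refinement of the two partitions. *)
exists (I * J)%type, (fun x => (p x, q x)), (fun ij => B ij.1 `|` A ij.2).
split.
  split => [[i j]|[i j]] /=; last by apply: measurableU; [exact: dB.2|exact: dA.2].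
  rewrite (_ : _ @^-1` _ = (p @^-1` [set i]) `&` (q @^-1` [set j])).
    by apply: measurableI; [exact: dB.1|exact: dA.1].
  by apply/seteqP; split => x /= [-> ->].
have mB := measurable_step_set dB; have mA := measurable_step_set dA.
have sub : (C `|` D) `\` (step_set p B `|` step_set q A) `|`
   (step_set p B `|` step_set q A) `\` (C `|` D) `<=`
   ((C `\` step_set p B) `|` (step_set p B `\` C)) `|`
   ((D `\` step_set q A) `|` (step_set q A `\` D)).
  move=> x /=; tauto.
have key (rr : probability (E1 * E2)%type R) :
  (rr ((C `\` step_set p B) `|` (step_set p B `\` C)) <= (e / 2)%:E)%E ->
  (rr ((D `\` step_set q A) `|` (step_set q A `\` D)) <= (e / 2)%:E)%E ->
  (rr ((C `|` D) `\` (step_set p B `|` step_set q A) `|`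
   (step_set p B `|` step_set q A) `\` (C `|` D)) <= e%:E)%E.
  move=> h1 h2; apply: le_trans (le_measure rr _ _ sub) _.
  - by rewrite inE; apply: measurableU; apply: measurableD; apply: measurableU.
  - by rewrite inE; apply: measurableU; apply: measurableU; apply: measurableD.
  - apply: le_trans (measureU2 _ _ _) _.
    + by apply: measurableU; apply: measurableD.
    + by apply: measurableU; apply: measurableD.
    + by rewrite [e in leRHS]splitr EFinD leeD.
by split; apply: key.
Qed.

Lemma step_approx_rect Pa Pb (A : set E1) (B : set E2) :
  measurable A -> measurable B -> step_approx Pa Pb (A `*` B).
Proof.
move=> mA mB; split; first exact: measurableX.
move=> e e0; exists bool, (fun x => x \in A), (fun b => if b then B else set0).
split.
  split => [[]|[]]//=.
    by rewrite (_ : _ @^-1` _ = A)//; apply/seteqP; split => x /= => [/set_mem|/mem_set].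
  rewrite (_ : _ @^-1` _ = ~` A); first exact: measurableC.
  apply/seteqP; split => x /= xA; last exact: memNset.
  by move=> Ax; move: xA; rewrite mem_set.
rewrite /close_sets (_ : step_set _ _ = A `*` B).
  by rewrite setDv setU0 !measure0; split; rewrite lee_fin ltW.
apply/seteqP; split => -[x y] /=; rewrite /step_set/=.
  by case: ifPn => //; rewrite inE.
by move=> [Ax By]; rewrite ifT ?inE.
Qed.

Lemma step_approx0 Pa Pb : step_approx Pa Pb set0.
Proof.
by have := step_approx_rect Pa Pb measurableT measurable0; rewrite setX0.
Qed.

(** By continuity from above, a finite subunion misses a set of measure at most [e / 2] under either
    measure; the subunion is then approximated within [e / 2]. *)
Lemma step_approx_bigcup Pa Pb (C : (set (E1 * E2))^nat) :
  (forall k, step_approx Pa Pb (C k)) -> step_approx Pa Pb (\bigcup_k C k).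
Proof.
move=> aC; have mC k : measurable (C k) by case: (aC k).
split; first exact: bigcup_measurable.
move=> e e0; have e2 : 0 < e / 2 by rewrite divr_gt0.
pose U N := \big[setU/set0]_(k < N) C k.
have aU N : step_approx Pa Pb (U N).
  rewrite /U; elim: N => [|N IH].
    rewrite big_ord0; exact: step_approx0.
  by rewrite big_ord_recr/=; exact: step_approxU.
have tail (rr : probability (E1 * E2)%type R) :
  \forall N \near \oo, (rr ((\bigcup_k C k) `\` U N) <= (e / 2)%:E)%E.
  have UC N : U N `<=` \bigcup_k C k.
    by rewrite /U -bigcup_mkord; move=> x [k _ Cx]; exists k.
  have mU N : measurable (U N) by case: (aU N).
  have mbC : measurable (\bigcup_k C k) by exact: bigcup_measurable.
  have cap0 : \bigcap_N (\bigcup_k C k `\` U N) = set0.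
    rewrite -subset0 => x capx; have [[k _ Ckx] _] := capx 0%N I.
    have [_] := capx k.+1 I; apply.
    by rewrite /U -bigcup_mkord; exists k => //=.
  have /fine_cvgP[_] : (rr \o (fun N => \bigcup_k C k `\` U N)) N @[N --> \oo]
      --> (0 : R)%:E.
    rewrite -[X in _ --> X](measure0 rr) -cap0.
    apply: nonincreasing_cvg_mu.
    - by rewrite ltey_eq fin_num_measure//; exact: measurableD.
    - by move=> N; exact: measurableD.
    - by rewrite cap0.
    - move=> N M NM; apply/subsetPset => x [Cx nU]; split => // Ux; apply: nU.
      move: Ux; rewrite /U -!bigcup_mkord => -[k /= kN Ck]; exists k => //=.
      exact: leq_trans NM.
  move=> /cvgr0_norm_le /(_ _ e2); apply: filterS => N /= h.
  rewrite -[leLHS]fineK ?fin_num_measure//; last exact: measurableD.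
  by rewrite lee_fin (le_trans _ h)// ler_norm.
near \oo => N.
have [I [p [B [dB [c1 c2]]]]] := (aU N).2 _ e2.
have mB := measurable_step_set dB.
have mU : measurable (U N) by case: (aU N).
have mbC : measurable (\bigcup_k C k) by exact: bigcup_measurable.
exists I, p, B; split => //.
have sub : ((\bigcup_k C k) `\` step_set p B) `|` (step_set p B `\` (\bigcup_k C k))
  `<=` ((\bigcup_k C k) `\` U N) `|` ((U N `\` step_set p B) `|` (step_set p B `\` U N)).
  have UC : U N `<=` \bigcup_k C k.
    by rewrite /U -bigcup_mkord; move=> x [k _ Cx]; exists k.
  move=> x; have := UC x; have := EM (U N x); rewrite /=; tauto.
have key (rr : probability (E1 * E2)%type R) :
  (rr ((\bigcup_k C k) `\` U N) <= (e / 2)%:E)%E ->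
  (rr ((U N `\` step_set p B) `|` (step_set p B `\` U N)) <= (e / 2)%:E)%E ->
  (rr (((\bigcup_k C k) `\` step_set p B) `|` (step_set p B `\` (\bigcup_k C k)))
    <= e%:E)%E.
  move=> h1 h2; apply: le_trans (le_measure rr _ _ sub) _.
  - by rewrite inE; apply: measurableU; apply: measurableD.
  - rewrite inE; apply: measurableU; first exact: measurableD.
    by apply: measurableU; apply: measurableD.
  - apply: le_trans (measureU2 _ _ _) _.
    + exact: measurableD.
    + by apply: measurableU; apply: measurableD.
    + by rewrite [e in leRHS]splitr EFinD leeD.
split; apply: key => //.
  by near: N; exact: tail.
by near: N; exact: tail.
Unshelve. all: by end_near.
Qed.

(** The approximable sets form a sigma-algebra containing the rectangles. *)
Lemma step_approx_measurable Pa Pb C : measurable C -> step_approx Pa Pb C.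
Proof.
rewrite measurable_prod_measurableType => mC.
apply: (mC (step_approx Pa Pb)); split.
  split.
  - exact: step_approx0.
  - by move=> A aA; rewrite setTD; exact: step_approxC.
  - by move=> F aF; exact: step_approx_bigcup.
by move=> _ [A mA [B mB <-]]; exact: step_approx_rect.
Qed.

(** Step sets are what absolute regularity controls: the second side may depend on the cell of the
    first coordinate, as the supremum inside the expectation allows. *)
Lemma tv_le_step Pa Pb (b : R) :
  (forall (I : finType) (p : E1 -> I) (B : I -> set E2), step_data p B ->
    `|fine (Pa (step_set p B)) - fine (Pb (step_set p B))| <= b) ->
  forall C, measurable C -> `|fine (Pa C) - fine (Pb C)| <= b.
Proof.
move=> hstep C mC; apply/ler_addgt0Pr => e e0.
have e2 : 0 < e / 2 by rewrite divr_gt0.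
have [I [p [B [dB [c1 c2]]]]] := (step_approx_measurable Pa Pb mC).2 _ e2.
have mB := measurable_step_set dB.
have key (rr : probability (E1 * E2)%type R) :
   (rr ((C `\` step_set p B) `|` (step_set p B `\` C)) <= (e / 2)%:E)%E ->
   `|fine (rr C) - fine (rr (step_set p B))| <= e / 2.
  have mCB : measurable (C `\` step_set p B) by exact: measurableD.
  have mBC : measurable (step_set p B `\` C) by exact: measurableD.
  set D := _ `|` _ => h; have mD : measurable D by exact: measurableU.
  have bound X Y : measurable X -> measurable Y -> X `<=` Y `|` D ->
      fine (rr X) <= fine (rr Y) + e / 2.
    move=> mX mY XY; rewrite -lee_fin EFinD !fineK ?fin_num_measure//.
    apply: le_trans (le_measure rr _ _ XY) _; rewrite ?inE//.
      exact: measurableU.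
    by apply: le_trans (measureU2 _ mY mD) _; exact: leeD2l.
  have /(_ mC mB) h1 := bound C (step_set p B).
  have /(_ mB mC) h2 := bound (step_set p B) C.
  rewrite ler_norml; apply/andP; split.
    rewrite lerBrDl lerBlDr h2// => x Bx.
    by have [Cx|nCx] := EM (C x); [left|right; right].
  rewrite lerBlDr addrC h1// => x Bx.
  by have [Cx|nCx] := EM (step_set p B x); [left|right; left].
have := hstep I p B dB.
have := key Pa c1; have := key Pb c2.
rewrite !ler_norml => /andP[? ?] /andP[? ?] /andP[? ?].
by apply/andP; split; lra.
Qed.

End rectangle_approximation.

Definition law {R : realType} {d d'} {T : measurableType d} {E : measurableType d'}
  (Q : probability T R) (U : T -> E) (mU : measurable_fun setT U) : probability E R :=
  distribution Q (HB.pack_for {mfun T >-> E} U (isMeasurableFun.Build _ _ _ _ U mU)).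

Lemma Ev_law {R : realType} {d d'} {T : measurableType d} {E : measurableType d'}
  (Q : probability T R) (U : T -> E) (mU : measurable_fun setT U) (f : E -> R) :
  bmf f -> Ev (law Q mU) f = Ev Q (f \o U).
Proof.
move=> bf; rewrite /Ev /Rintegral; congr fine.
rewrite /law integral_distribution//=.
  by apply/measurable_EFinP; case: bf.
have /bmf_integrable : bmf (f \o U) by exact: bmf_comp.
by apply.
Qed.

Section product_Ev.
Context {R : realType} {d d'} {T : measurableType d} {E : measurableType d'}.
Variables (P : probability T R) (Q : probability E R) (f : T * E -> R).
Hypothesis bf : bmf f.

Lemma bmf_section1 x : bmf (fun y => f (x, y)).
Proof.
move: bf => [mf [M fM]]; split; last by exists M.
exact: measurable_fun_pair2.
Qed.

Lemma bmf_fubini1 : bmf (fun x => Ev Q (fun y => f (x, y))).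
Proof.
split; last first.
  move: bf => [mf [M fM]]; exists M => x.
  by apply: norm_Ev_le => // ; exact: bmf_section1.
apply/measurable_EFinP.
rewrite (_ : EFin \o _ = (fun x => \int[Q]_y (EFin \o f) (x, y))%E); last first.
  by apply/funext => x /=; rewrite EFin_Ev//; exact: bmf_section1.
exact: (measurable_fubini_F (bmf_integrable (P \x Q)%E bf)).
Qed.

Lemma Ev_prod : Ev (P \x Q)%E f = Ev P (fun x => Ev Q (fun y => f (x, y))).
Proof.
rewrite {1}/Ev /Rintegral -(integral12_prod_meas1 (bmf_integrable (P \x Q)%E bf)).
rewrite {1}/Ev {1}/Rintegral; congr fine; apply: eq_integral => x _.
by rewrite EFin_Ev//; exact: bmf_section1.
Qed.

End product_Ev.

(** * Absolute regularity as a total variation bound *)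

Section beta_total_variation.
Context {R : realType} {d : measure_display} {T : measurableType d}.
Variables (Q : probability T R) (past future : set (set T)).
Variables (c : set T -> T -> R) (s : T -> \bar R) (b : R).
Hypothesis past_measurable : past `<=` measurable.
Hypothesis future_measurable : future `<=` measurable.
Hypothesis futureT : future setT.
Hypothesis cP : forall A, future A -> is_cond_prob Q past A (c A).
Hypothesis sP :
  is_ess_sup_family Q future (fun A w => `|(c A w)%:E - Q A|%E) s.
Hypothesis sb : (\int[Q]_w s w = b%:E)%E.

(** The essential supremum is nonnegative only almost everywhere (the full set belongs to [future]);
    its positive part has the same integral and is nonnegative everywhere. *)
Let s' := fun w => maxe (s w) 0%E.

Let ms' : measurable_fun setT s'.
Proof. by case: sP => ms _ _; apply: measurable_maxe. Qed.

Let s'0 w : (0 <= s' w)%E. Proof. by rewrite le_max lexx orbT. Qed.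

Let s'b : (\int[Q]_w s' w = b%:E)%E.
Proof.
case: sP => ms sub _; rewrite -sb; apply: ae_eq_integral => //.
apply: filterS (sub _ futureT) => w /= h _.
by rewrite /s'; apply/max_idPl; apply: le_trans h; exact: abse_ge0.
Qed.

(** By definition of the conditional probability, the difference is the integral over [A] of [c B]
    minus [Q B], which [s'] dominates almost everywhere. *)
Lemma beta_rectangle A B : past A -> future B ->
  (`|fine (Q (A `&` B)) - fine (Q A) * fine (Q B)|%:E <= \int[Q]_(w in A) s' w)%E.
Proof.
move=> pA fB; have [_ ic cE] := cP fB.
have mA := past_measurable pA; have mB := future_measurable fB.
have icA : Q.-integrable A (EFin \o c B) by exact: integrableS ic.
have ikA : Q.-integrable A (EFin \o cst (fine (Q B))).
  apply: (integrableS measurableT) => //; apply: bmf_integrable.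
  exact: bmf_cst.
rewrite -abse_EFin.
have -> : (fine (Q (A `&` B)) - fine (Q A) * fine (Q B))%:E =
    (\int[Q]_(w in A) ((c B w)%:E - (fine (Q B))%:E))%E.
  rewrite (integralB_EFin mA icA ikA) cE// EFinB EFinM; congr (_ - _)%E.
    rewrite setIC fineK// fin_num_measure//; exact: measurableI.
  have := integral_cst Q mA (fine (Q B))%:E; rewrite /cst /= => ->.
  by rewrite [in RHS]muleC (fineK (fin_num_measure _ _ mA)).
apply: le_trans (le_abse_integral Q mA _) _.
  by apply: emeasurable_funB; [case/integrableP: icA|case/integrableP: ikA].
apply: ae_ge0_le_integral => //.
- apply: measurableT_comp => //.
  by apply: emeasurable_funB; [case/integrableP: icA|case/integrableP: ikA].
- exact: measurable_funTS.
- case: sP => _ sub _; apply: filterS (sub _ fB) => w /= h _.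
  rewrite -(fineK (fin_num_measure Q B mB)) in h.
  by apply: le_trans h _; rewrite le_max lexx.
Qed.

(** The [B i] may vary with [i]: every term is bounded by the integral of the same [s'] over [A i],
    and over disjoint sets these integrals add up to at most [b]. *)
Lemma beta_step (I : finType) (A B : I -> set T) :
  (forall i, past (A i)) -> (forall i, future (B i)) -> trivIset setT A ->
  `|\sum_i (fine (Q (A i `&` B i)) - fine (Q (A i)) * fine (Q (B i)))| <= b.
Proof.
move=> pA fB tA; rewrite -lee_fin.
apply: le_trans (_ : (\sum_i `|fine (Q (A i `&` B i)) -
    fine (Q (A i)) * fine (Q (B i))|%:E <= _)%E).
  by rewrite sumEFin lee_fin; exact: ler_norm_sum.
apply: le_trans (_ : (\sum_i \int[Q]_(w in A i) s' w <= _)%E).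
  by apply: lee_sum => i _; exact: beta_rectangle.
rewrite -ge0_integral_bigsetU//; last first.
- exact: measurable_funTS.
- by apply: sub_trivIset tA.
- exact: index_enum_uniq.
- by move=> i; apply: past_measurable.
rewrite -s'b; apply: ge0_subset_integral => //.
by apply: bigsetU_measurable => i _; apply: past_measurable.
Qed.

Context {d1 d2 : measure_display} {E1 : measurableType d1} {E2 : measurableType d2}.
Variables (U : T -> E1) (W : T -> E2).
Hypothesis pU : forall A, measurable A -> past (U @^-1` A).
Hypothesis fW : forall A, measurable A -> future (W @^-1` A).

Let mU : measurable_fun setT U.
Proof. by move=> _ A mA; rewrite setTI; apply: past_measurable; exact: pU. Qed.

Let mW : measurable_fun setT W.
Proof. by move=> _ A mA; rewrite setTI; apply: future_measurable; exact: fW. Qed.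

(** The joint law of [U] and [W] is compared with the product of the marginals: [beta_step] bounds
    the difference on step sets, hence on all measurable sets and on bounded functions. *)
Lemma beta_decouple (H : E1 * E2 -> R) (M : R) : bmf H -> (forall z, `|H z| <= M) ->
  `|Ev Q (fun w => H (U w, W w)) - Ev Q (fun w => Ev Q (fun w' => H (U w, W w')))|
    <= 2 * M * b.
Proof.
move=> bH HM; have mUW := measurable_fun_pair mU mW.
rewrite (_ : Ev Q (fun w => H (U w, W w)) = Ev (law Q mUW) H); last by rewrite Ev_law.
rewrite (_ : Ev Q _ = Ev (law Q mU \x law Q mW)%E H); last first.
  rewrite Ev_prod// Ev_law; last exact: (bmf_fubini1 (law Q mU) (law Q mW) bH).
  congr Ev; apply/funext => w /=; rewrite Ev_law//; exact: bmf_section1.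
apply: Ev_discretize => // C mC; apply: tv_le_step => // I p B [mp mB].
rewrite !measure_step_set// -sumrB.
rewrite (eq_bigr (fun i => fine (Q (U @^-1` (p @^-1` [set i]) `&` W @^-1` B i)) -
   fine (Q (U @^-1` (p @^-1` [set i]))) * fine (Q (W @^-1` B i)))).
  apply: beta_step.
  - by move=> i; apply: pU.
  - by move=> i; apply: fW.
  - by apply/trivIsetP => i j _ _ ij; rewrite -subset0 => w [/= -> /eqP]; rewrite (negbTE ij).
move=> i _; congr (_ - _).
have := @product_measure1E _ _ _ _ _ (law Q mU) (law Q mW) _ _ (mp i) (mB i).
move=> e; apply: (etrans (congr1 fine e)).
by rewrite fineM// fin_num_measure.
Qed.

End beta_total_variation.

(** * Decoupling *)

Section decoupling.
Context {R : realType} {n : nat}.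
Implicit Types (x y : n.-tuple R) (A : pred 'I_n) (f : n.-tuple R -> R).
Variable mu : probability (n.-tuple R) R.

Definition depends_on A f := forall x y, (forall i, A i -> tnth x i = tnth y i) -> f x = f y.

(* Index i stands for time i + 1: the first coordinates i < c are a past, and
   those with c + t <= i + 1 a future at distance t. *)
Definition mixes (t : nat) (b : R) :=
  forall (c : nat) (H : n.-tuple R * n.-tuple R -> R) (M : R),
    bmf H -> (forall z, `|H z| <= M) ->
    (forall y, depends_on (fun i => (i < c)%N) (fun x => H (x, y))) ->
    (forall x, depends_on (fun i => (c + t <= i.+1)%N) (fun y => H (x, y))) ->
    `|Ev mu (fun x => H (x, x)) - Ev mu (fun x => Ev mu (fun y => H (x, y)))|
      <= 2 * M * b.

(** Evaluating at [splice u x y] with independent [x] and [y] makes the coordinates before [u]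
    independent of the later ones. *)
Definition splice (u : nat) x y : n.-tuple R :=
  [tuple if (i < u)%N then tnth x i else tnth y i | i < n].

Lemma splice_id u x : splice u x x = x.
Proof. by apply: eq_from_tnth => i; rewrite tnth_mktuple if_same. Qed.

Lemma measurable_splice u :
  measurable_fun setT (fun z : n.-tuple R * n.-tuple R => splice u z.1 z.2).
Proof.
apply/measurable_fun_tnthP => i.
have m1 : measurable_fun setT (fun z : n.-tuple R * n.-tuple R => tnth z.1 i).
  exact: (measurableT_comp (measurable_tnth i) measurable_fst).
have m2 : measurable_fun setT (fun z : n.-tuple R * n.-tuple R => tnth z.2 i).
  exact: (measurableT_comp (measurable_tnth i) measurable_snd).
have [iu|iu] := boolP (i < u)%N.
  move: m1; congr measurable_fun; apply/funext => z /=.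
  by rewrite tnth_mktuple iu.
move: m2; congr measurable_fun; apply/funext => z /=.
by rewrite tnth_mktuple (negbTE iu).
Qed.

(** The two index sets may interleave, so a single cut is not enough. All indices lie among the last
    [k]; say [A] starts first, and cut at the first index [a2] of [A']. Replacing the part of [Z]
    before [a2] by an independent copy costs [2 * M * N * b] on each side of the comparison; for a
    frozen past the rest is an instance with fewer trailing coordinates. This gives [4 * M * N * b]
    per step and at most [k] steps. *)
Lemma mixes_decouple_aux t b k A A' (Z f : n.-tuple R -> R) (M N : R) :
  (0 < t)%N -> mixes t b -> 0 <= b ->
  bmf Z -> bmf f -> (forall x, `|Z x| <= M) -> (forall x, `|f x| <= N) ->
  depends_on A Z -> depends_on A' f ->
  (forall i j, A i -> A' j -> (i + t <= j)%N || (j + t <= i)%N) ->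
  (forall i, A i || A' i -> (n - k <= i)%N) -> (k <= n)%N ->
  `|Ev mu (fun x => Z x * f x) - Ev mu Z * Ev mu f| <= 4 * M * N * k%:R * b.
Proof.
move=> t0 mix b0; elim/ltn_ind: k => k IH in A A' Z f M N *.
move=> bZ bf ZM fN dZ df sep Ak kn.
pose x0 : n.-tuple R := [tuple 0 | i < n].
have M0 : 0 <= M by apply: le_trans (ZM x0).
have N0 : 0 <= N by apply: le_trans (fN x0).
have rhs0 : 0 <= 4 * M * N * k%:R * b by rewrite !mulr_ge0.
have [[a Aa]|noA] := pselect (exists a, A a); last first.
  have Zc x : Z x = Z x0 by apply: dZ => i Ai; case: noA; exists i.
  have -> : Z = fun=> Z x0 by apply/funext => x.
  by rewrite EvZ// Ev_cst subrr normr0.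
have [[a' Aa']|noA'] := pselect (exists a, A' a); last first.
  have fc x : f x = f x0.
    by apply: df => i Ai; case: noA'; exists i.
  have -> : f = fun=> f x0 by apply/funext => x.
  rewrite (_ : (fun x => Z x * _) = (fun x => f x0 * Z x)); last first.
    by apply/funext => x; rewrite mulrC.
  by rewrite EvZ// Ev_cst mulrC subrr normr0.
have [a1 Aa1 a1min] : exists2 i, A i & forall j, A j -> (i <= j)%N.
  by case: (arg_minnP (fun i : 'I_n => i : nat) Aa) => i; exists i.
have [a2 Aa2 a2min] : exists2 i, A' i & forall j, A' j -> (i <= j)%N.
  by case: (arg_minnP (fun i : 'I_n => i : nat) Aa') => i; exists i.
wlog a12 : A A' Z f M N bZ bf ZM fN dZ df sep Ak M0 N0 rhs0 a Aa a' Aa' a1 Aa1 a1min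
    a2 Aa2 a2min / (a1 < a2)%N.
  move=> hw; case: (ltnP a1 a2) => a12; first exact: (hw A A' Z f M N bZ bf ZM fN dZ df sep Ak M0 N0 rhs0 a Aa a' Aa' a1 Aa1 a1min a2 Aa2 a2min a12).
  have a21 : (a2 < a1)%N by move: (sep _ _ Aa1 Aa2) a12 t0; clear; lia.
  have := hw A' A f Z N M bf bZ fN ZM df dZ _ _ N0 M0 _ a' Aa' a Aa a2 Aa2 a2min a1 Aa1 a1min a21.
  rewrite [Ev mu f * _]mulrC (_ : 4 * N * M = 4 * M * N); last by ring.
  rewrite (_ : (fun x => f x * Z x) = (fun x => Z x * f x)); last first.
    by apply/funext => x; rewrite mulrC.
  apply=> //; first by move=> i j Ai Aj; rewrite orbC sep.
  by move=> i; rewrite orbC; exact: Ak.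
have sep12 : (a1 + t <= a2)%N by move: (sep _ _ Aa1 Aa2) a12 t0; clear; lia.
have a2n := ltn_ord a2.
have a1k : (n - k <= a1)%N by apply: Ak; rewrite Aa1.
(* With this cut the past indices satisfy [i + t <= a2] and the future ones [a2 <= i]; by [sep12]
   the subtraction is not truncated. *)
pose c := (a2.+1 - t)%N.
pose H (z : n.-tuple R * n.-tuple R) := Z (splice a2 z.1 z.2).
have bH : bmf H by apply: (bmf_comp bZ); exact: measurable_splice.
have HM z : `|H z| <= M by exact: ZM.
have Hx y : depends_on (fun i => (i < c)%N) (fun x => H (x, y)).
  move=> x x' xx'; apply: dZ => i Ai; rewrite !tnth_mktuple /=.
  case: ifPn => // ia2; apply: xx'.
  by move: (sep _ _ Ai Aa2) ia2 t0; rewrite /c; clear; lia.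
have Hy x : depends_on (fun i => (c + t <= i.+1)%N) (fun y => H (x, y)).
  move=> y y' yy'; apply: dZ => i Ai; rewrite !tnth_mktuple /=.
  by case: ifPn => // ia2; apply: yy'; move: ia2 sep12; rewrite /c; clear; lia.
have bf2 : bmf (fun z : n.-tuple R * n.-tuple R => f z.2).
  by apply: (bmf_comp bf); exact: measurable_snd.
have fy : depends_on (fun i => (c + t <= i.+1)%N) f.
  move=> y y' yy'; apply: df => i Ai; apply: yy'.
  by move: (a2min i Ai) sep12; rewrite /c; clear; lia.
have := mix c H M bH HM Hx Hy.
have mixHf : `|Ev mu (fun x => H (x, x) * f x) -
    Ev mu (fun x => Ev mu (fun y => H (x, y) * f y))| <= 2 * (M * N) * b.
  apply: (mix c (fun z => H z * f z.2) (M * N) (bmfM bH bf2)).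
  - by move=> z; rewrite normrM ler_pM.
  - by move=> y x x' xx' /=; rewrite (Hx _ _ _ xx').
  - by move=> x y y' yy' /=; rewrite (Hy _ _ _ yy') (fy _ _ yy').
have bHs x : bmf (fun y => H (x, y)) by exact: bmf_section1.
have bHF : bmf (fun x => Ev mu (fun y => H (x, y))) by exact: (bmf_fubini1 mu mu bH).
have bHfF : bmf (fun x => Ev mu (fun y => H (x, y) * f y)).
  exact: (bmf_fubini1 mu mu (bmfM bH bf2)).
have step2 : `|Ev mu (fun x => Ev mu (fun y => H (x, y) * f y)) -
     Ev mu (fun x => Ev mu (fun y => H (x, y))) * Ev mu f| <= 4 * M * N * k.-1%:R * b.
  rewrite [X in _ - X]mulrC -EvZ// -EvB//; last by apply: bmfM => //; exact: bmf_cst.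
  apply: norm_Ev_le => [|x].
    by apply: bmfB => //; apply: bmfM => //; exact: bmf_cst.
  rewrite [X in _ - X]mulrC.
  (* For fixed [x], the function [H (x, y)] of [y] only sees the indices of [A] from [a2] on. *)
  apply: le_trans (IH (n - a2)%N _ (fun i => A i && (a2 <= i)%N) A' _ f M N _ _ _ _ _ _ _ _ _) _ => //.
  - by move: a1k sep12 t0 a2n; clear; lia.
  - move=> y y' yy'; apply: dZ => i Ai; rewrite !tnth_mktuple /=.
    by case: ifPn => // ia2; apply: yy'; rewrite Ai/= leqNgt.
  - by move=> i j /andP[Ai _]; exact: sep.
  - by rewrite (subKn (ltnW a2n)) => i /orP[/andP[_]|/a2min].
  - by move: a1k sep12 t0 a2n; clear; lia.
  - rewrite ler_wpM2r// ler_wpM2l ?mulr_ge0// ler_nat.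
    by move: a1k sep12 t0 a2n; clear; lia.
rewrite (_ : Ev mu (fun x => H (x, x)) = Ev mu Z); last first.
  by congr Ev; apply/funext => x; rewrite /H splice_id.
move=> s1; move: mixHf.
rewrite (_ : Ev mu (fun x => H (x, x) * f x) = Ev mu (fun x => Z x * f x)); last first.
  by congr Ev; apply/funext => x; rewrite /H splice_id.
move=> s3.
have s3' : `|Ev mu Z * Ev mu f - Ev mu (fun x => Ev mu (fun y => H (x, y))) * Ev mu f|
     <= 2 * M * b * N.
  by rewrite -mulrBl normrM ler_pM//; exact: norm_Ev_le.
have kE : k%:R = k.-1%:R + 1 :> R by rewrite natr1 prednK//; move: a1k a2n sep12; clear; lia.
move: s3 s3' step2; rewrite !ler_norml kE.
set p1 := Ev mu _; set p2 := Ev mu Z * _; set p3 := Ev mu _; set p4 := _ * Ev mu f.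
rewrite (_ : 4 * M * N * (k.-1%:R + 1) * b = 4 * M * N * k.-1%:R * b + 2 * (2 * (M * N) * b)); last by ring.
rewrite (_ : 2 * M * b * N = 2 * (M * N) * b); last by ring.
by move=> /andP[? ?] /andP[? ?] /andP[? ?]; apply/andP; split; lra.
Qed.

Lemma mixes_decouple t b A A' (Z f : n.-tuple R -> R) (M N : R) :
  (0 < t)%N -> mixes t b -> 0 <= b ->
  bmf Z -> bmf f -> (forall x, `|Z x| <= M) -> (forall x, `|f x| <= N) ->
  depends_on A Z -> depends_on A' f ->
  (forall i j, A i -> A' j -> (i + t <= j)%N || (j + t <= i)%N) ->
  `|Ev mu (fun x => Z x * f x) - Ev mu Z * Ev mu f| <= 4 * M * N * n%:R * b.
Proof.
move=> t0 mix b0 bZ bf ZM fN dZ df sep.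
by apply: (mixes_decouple_aux t0 mix b0 bZ bf ZM fN dZ df sep) => // i _; rewrite subnn.
Qed.

End decoupling.

(** The case [b = 0] of [Ev_discretize]. *)
Lemma eq_Ev_law {R : realType} {d d' d''} {T : measurableType d} {T' : measurableType d'}
  {E : measurableType d''} (P : probability T R) (Q : probability T' R)
  (U : T -> E) (V : T' -> E) (mU : measurable_fun setT U) (mV : measurable_fun setT V) :
  (forall A, measurable A -> P (U @^-1` A) = Q (V @^-1` A)) ->
  forall f : E -> R, bmf f -> Ev P (f \o U) = Ev Q (f \o V).
Proof.
move=> PQ f bf; rewrite -(Ev_law P mU bf) -(Ev_law Q mV bf).
have [_ [M fM]] := bf.
apply/eqP; rewrite -subr_eq0 -normr_le0.
have := @Ev_discretize _ _ _ (law P mU) (law Q mV) 0 _ f M bf fM.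
rewrite mulr0; apply => A mA.
by rewrite [_ A](PQ A mA) subrr normr0.
Qed.

Lemma measurable_mktuple {R : realType} {d} {T : measurableType d} n (Z : 'I_n -> T -> R) :
  (forall i, measurable_fun setT (Z i)) ->
  measurable_fun setT (fun w => [tuple Z i w | i < n]).
Proof.
move=> mZ; apply/measurable_fun_tnthP => i; move: (mZ i).
by congr measurable_fun; apply/funext => w /=; rewrite tnth_mktuple.
Qed.

Section sigma_gen.
Context {R : realType} {I : Type} {d : measure_display} {T : measurableType d}.
Variables (Y : I -> T -> R) (D : set I).

Lemma sigma_gen_measurable : (forall t, D t -> measurable_fun setT (Y t)) ->
  sigma_gen Y D `<=` measurable.
Proof.
move=> mY; apply: smallest_sub; first exact: sigma_algebra_measurable.
by move=> A [t Dt [B mB <-]]; exact: mY.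
Qed.

(** Constant coordinates are allowed because a sample restricted to the past or to the future is
    padded with zeros. *)
Lemma sigma_gen_tuple n (Z : 'I_n -> T -> R) :
  (forall i, (exists2 t, D t & Z i = Y t) \/ (exists c, Z i = fun=> c)) ->
  forall A, measurable A -> sigma_gen Y D ((fun w => [tuple Z i w | i < n]) @^-1` A).
Proof.
move=> hZ A mA; have sa : sigma_algebra setT (sigma_gen Y D).
  exact: smallest_sigma_algebra.
have := mA (fun B => sigma_gen Y D ((fun w => [tuple Z i w | i < n]) @^-1` B)).
apply; split.
  case: sa => s0 sC sU; split.
  - by rewrite preimage_set0.
  - by move=> B /sC; rewrite !setTD preimage_setC.
  - by move=> F sF; rewrite preimage_bigcup; exact: sU.
move=> B; rewrite -bigcup_seq/= => -[i _ [C mC <-]]; rewrite setTI.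
rewrite (_ : _ @^-1` _ = Z i @^-1` C); last first.
  by apply/seteqP; split => w /=; rewrite tnth_mktuple.
case: (hZ i) => [[t Dt ->]|[c ->]].
  by apply: sub_gen_smallest; exists t => //; exists C; rewrite // setTI.
have [s0 sC _] := sa; rewrite preimage_cst; case: ifP => // _.
by rewrite -(setD0 setT); exact: sC.
Qed.

Lemma sigma_genT : sigma_gen Y D setT.
Proof.
have [s0 sC _] : sigma_algebra setT (sigma_gen Y D) by exact: smallest_sigma_algebra.
by rewrite -(setD0 setT); exact: sC.
Qed.

End sigma_gen.

Lemma is_beta_mixes {R : realType} {d} {T : measurableType d} (P : probability T R)
  (X : nat -> {RV P >-> R}) (beta : nat -> R) (n : nat)
  (mX : measurable_fun setT (fun w => [tuple X i.+1 w | i < n])) :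
  (0 < n)%N -> is_beta P X beta -> forall t, (0 < t)%N -> mixes (law P mX) t (beta t).
Proof.
move=> n0 [d' [T' [Q [Y [statY YX betaY]]]]] t t0 c H M bH HM Hx Hy.
(* By stationarity the sample is read at times shifted by [- c]: index [i] sits at time [i + 1 - c],
   so [i < c] means time at most 0 and [c + t <= i + 1] means time at least [t]. *)
pose Yc w := [tuple Y ((i : nat)%:Z + 1 - c%:Z) w | i < n].
have mYc : measurable_fun setT Yc.
  by apply: (measurable_mktuple (Z := fun i : 'I_n => Y ((i : nat)%:Z + 1 - c%:Z))).
have lawE A : measurable A -> P ((fun w => [tuple X i.+1 w | i < n]) @^-1` A) =
    Q (Yc @^-1` A).
  move=> mA.
  have := YX n [tuple i.+1 | i < n] n0 _ A mA.
  have := statY (- c%:Z) n [tuple (i : nat)%:Z + 1 | i < n] n0 _ A mA.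
  rewrite (_ : [set w | A [tuple Y (tnth [tuple (i : nat)%:Z + 1 | i < n] i - c%:Z) w | i < n]]
    = Yc @^-1` A); last first.
    apply/seteqP; split => w /=; congr A; apply: eq_from_tnth => i;
    by rewrite !tnth_mktuple.
  move=> -> // e2.
  transitivity (P [set w | A [tuple X (tnth [tuple i.+1 | i < n] i) w | i < n]]).
    congr (P _); apply/seteqP; split => w /=; congr A; apply: eq_from_tnth => i;
    by rewrite !tnth_mktuple.
  rewrite -e2; last by move=> i /=; rewrite tnth_mktuple.
  congr (Q _); apply/seteqP; split => w /=; congr A; apply: eq_from_tnth => i;
  by rewrite !tnth_mktuple -addn1.
have EE (f : n.-tuple R -> R) : bmf f -> Ev (law P mX) f = Ev Q (f \o Yc).
  by move=> bf; rewrite Ev_law//; apply: eq_Ev_law.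
(* [U] and [W] keep only the past and only the future coordinates, with 0 elsewhere; by [Hx] and
   [Hy] the padding does not change [H]. *)
pose U w := [tuple (if (i < c)%N then Y ((i : nat)%:Z + 1 - c%:Z) w else 0) | i < n].
pose W w := [tuple (if (c + t <= i.+1)%N then Y ((i : nat)%:Z + 1 - c%:Z) w else 0) | i < n].
have [cnd [s [cndP sP sb]]] := betaY t t0.
have mY D : sigma_gen Y D `<=` measurable by apply: sigma_gen_measurable.
have bHxx : bmf (fun x => H (x, x)).
  by apply: (bmf_comp bH); apply: measurable_fun_pair.
rewrite EE// EE; last exact: (bmf_fubini1 (law P mX) (law P mX) bH).
have := beta_decouple (mY _) (mY _) (@sigma_genT _ _ _ _ _ _) cndP sP sb
  (U := U) (W := W) _ _ bH HM.
rewrite (_ : (fun w => H (U w, W w)) = (fun x => H (x, x)) \o Yc); last first.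
  apply/funext => w /=; rewrite (Hx _ _ (Yc w)).
    apply: Hy => i ic; rewrite !tnth_mktuple ic//.
  by move=> i ic; rewrite !tnth_mktuple ic.
rewrite (_ : (fun w => Ev Q (fun w' => H (U w, W w'))) =
   (fun x => Ev (law P mX) (fun y => H (x, y))) \o Yc); last first.
  apply/funext => w /=; rewrite EE; last exact: bmf_section1.
  congr Ev; apply/funext => w' /=; rewrite (Hx _ _ (Yc w)).
    by apply: Hy => i ic; rewrite !tnth_mktuple ic.
  by move=> i ic; rewrite !tnth_mktuple ic.
apply.
- apply: (sigma_gen_tuple (Z := fun i w => if (i < c)%N then _ else _)) => i.
  have [ic|ic] := boolP (i < c)%N; [left|right].
    by exists ((i : nat)%:Z + 1 - c%:Z) => //=; lia.
  by exists 0.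
- apply: (sigma_gen_tuple (Z := fun i w => if (c + t <= i.+1)%N then _ else _)) => i.
  have [ic|ic] := boolP (c + t <= i.+1)%N; [left|right].
    by exists ((i : nat)%:Z + 1 - c%:Z) => //=; lia.
  by exists 0.
Qed.

(** * Expansion of the moments *)

Section local_functions.
Context {R : realType} {n : nat}.
Implicit Types (Z : n.-tuple R -> R) (A : {set 'I_n}) (w : R).

(* Sums of functions of at most a coordinates, with total sup norm at most w. *)
Inductive localf (a : nat) : R -> (n.-tuple R -> R) -> Prop :=
| localf_one A Z w : (#|A| <= a)%N -> bmf Z -> (forall x, `|Z x| <= w) ->
    depends_on (fun i => i \in A) Z -> localf a w Z
| localf_add w1 Z1 w2 Z2 : localf a w1 Z1 -> localf a w2 Z2 ->
    localf a (w1 + w2) (fun x => Z1 x + Z2 x).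

Let x0 : n.-tuple R := [tuple 0 | i < n].

Lemma localf_bound a w Z : localf a w Z -> bmf Z /\ forall x, `|Z x| <= w.
Proof.
elim=> {w Z} [A Z w _ bZ Zw _ //|w1 Z1 w2 Z2 _ [b1 Z1w] _ [b2 Z2w]].
split; first exact: bmfD.
by move=> x; rewrite (le_trans (ler_normD _ _))// lerD.
Qed.

Lemma localf_ge0 a w Z : localf a w Z -> 0 <= w.
Proof. by move=> /localf_bound[_ /(_ x0)]; exact: le_trans. Qed.

Lemma localf_cst a (c : R) w : `|c| <= w -> localf a w (fun=> c).
Proof.
move=> cw; apply: (localf_one (A := finset.set0)) => //; first by rewrite cards0.
exact: bmf_cst.
Qed.

Lemma localf_weaken a a' w w' Z : (a <= a')%N -> w <= w' -> localf a w Z -> localf a' w' Z.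
Proof.
move=> aa' ww' lZ.
suff lZ' : localf a' w Z.
  (* The slack [w' - w] is carried by the zero function. *)
  have l0 : localf a' (w' - w) (fun=> 0).
    by apply: localf_cst; rewrite normr0 subr_ge0.
  have := localf_add lZ' l0; rewrite addrC subrK.
  by congr localf; apply/funext => x; rewrite addr0.
elim: lZ => {Z w ww'} [A Z w Aa bZ Zw dZ|w1 Z1 w2 Z2 _ l1 _ l2].
  by apply: (localf_one (A := A)) => //; exact: leq_trans aa'.
exact: localf_add.
Qed.

Lemma localf_mul a b w v Z Y : localf a w Z -> localf b v Y ->
  localf (a + b) (w * v) (fun x => Z x * Y x).
Proof.
move=> lZ lY; elim: lZ => {Z w} [A Z w Aa bZ Zw dZ|w1 Z1 w2 Z2 l1 IH1 l2 IH2]; last first.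
  rewrite mulrDl (_ : (fun x => _) = fun x => Z1 x * Y x + Z2 x * Y x).
    exact: localf_add.
  by apply/funext => x; rewrite mulrDl.
elim: lY => {Y v} [B Y v Bb bY Yv dY|w1 Z1 w2 Z2 l1 IH1 l2 IH2]; last first.
  rewrite mulrDr (_ : (fun x => _) = fun x => Z x * Z1 x + Z x * Z2 x).
    exact: localf_add.
  by apply/funext => x; rewrite mulrDr.
apply: (localf_one (A := A :|: B)).
- by rewrite (leq_trans (leq_card_setU _ _).1)// leq_add.
- exact: bmfM.
- by move=> x; rewrite normrM ler_pM.
- move=> x y xy; congr (_ * _).
    by apply: dZ => i Ai; apply: xy; rewrite inE Ai.
  by apply: dY => i Bi; apply: xy; rewrite inE Bi orbT.
Qed.

Lemma localf_exp a w Z k : localf a w Z -> localf (a * k) (w ^+ k) (fun x => Z x ^+ k).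
Proof.
move=> lZ; elim: k => [|k IH].
  by rewrite muln0 expr0; apply: localf_cst; rewrite normr1.
rewrite mulnS exprS (_ : (fun x => _) = fun x => Z x * Z x ^+ k); last first.
  by apply/funext => x; rewrite exprS.
exact: localf_mul.
Qed.

Lemma localf_sum (I : finType) (P : pred I) a w (F : I -> n.-tuple R -> R) :
  0 <= w -> (forall i, P i -> localf a w (F i)) ->
  localf a (#|P|%:R * w) (fun x => \sum_(i | P i) F i x).
Proof.
move=> w0 lF; rewrite -sum1_card natr_sum mulr_suml.
elim: (index_enum I) => [|i s IH].
  rewrite big_nil (_ : (fun x => _) = fun=> 0).
    by apply: localf_cst; rewrite normr0.
  by apply/funext => x; rewrite big_nil.
rewrite big_cons; rewrite -[i \in P]/(P i); case: ifPn => Pi; last first.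
  rewrite (_ : (fun x => _) = fun x => \sum_(i <- s | P i) F i x)//.
  by apply/funext => x; rewrite big_cons (negbTE Pi).
rewrite (_ : (fun x => _) = fun x => F i x + \sum_(i <- s | P i) F i x).
  by rewrite [1%:R * w]mul1r in IH *; exact: localf_add (lF i Pi) IH.
by apply/funext => x; rewrite big_cons Pi.
Qed.

End local_functions.

(** * Finite sums, remainders and counting *)

Section triangular_sums.
Context {R : realType}.

Lemma triangle_sum K (F : nat -> nat -> R) :
  \sum_(i < K) \sum_(j < K - i) F i j = \sum_(l < K) \sum_(i < l.+1) F i (l - i)%N.
Proof.
elim: K => [|K IH]; first by rewrite !big_ord0.
rewrite [RHS]big_ord_recr/= -IH [X in _ = _ + X]big_ord_recr/= addrA -big_split/=.
rewrite big_ord_recr/= subSn// subnn big_ord_recr/= big_ord0 add0r; congr (_ + _).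
by apply: eq_bigr => i _; rewrite subSn 1?ltnW// big_ord_recr.
Qed.

Lemma sum_vanish k m (F : nat -> R) : (forall i, (k <= i)%N -> F i = 0) ->
  (forall i, (m <= i)%N -> F i = 0) -> \sum_(i < k) F i = \sum_(i < m) F i.
Proof.
wlog km : k m / (k <= m)%N.
  move=> hw kF mF; case: (leqP k m) => [|/ltnW] km; first exact: hw.
  by symmetry; apply: hw.
move=> kF _; rewrite (big_ord_widen _ F km) big_mkcond/=; apply: eq_bigr => i _.
by case: ltnP => // ki; rewrite kF.
Qed.

(** Remainder from order [K] on: each order replaces a factor V by one of size [delta], and [A i]
    stands for the absolute moment of order [i]. *)
Definition tailsum (delta : R) (A : nat -> R) K k :=
  \sum_(K <= j < k.+1) delta ^+ j * A (k - j)%N.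

Lemma tailsum_ge0 delta A K k : 0 <= delta -> (forall j, 0 <= A j) ->
  0 <= tailsum delta A K k.
Proof. by move=> d0 A0; apply: sumr_ge0 => j _; rewrite mulr_ge0 ?exprn_ge0. Qed.

(** Multiplying by [delta ^+ i.+1] moves the order from [K - i] to [K - i + i.+1], which is at least
    [K.+1] even when the subtraction is truncated. *)
Lemma tailsum_shift delta A K k i : 0 <= delta -> (forall j, 0 <= A j) -> (i < k)%N ->
  delta ^+ i.+1 * tailsum delta A (K - i) (k - i.+1) <= tailsum delta A K.+1 k.
Proof.
move=> d0 A0 ik; rewrite /tailsum mulr_sumr.
rewrite (eq_bigr (fun j => delta ^+ (j + i.+1) * A (k - (j + i.+1))%N)); last first.
  by move=> j _; rewrite mulrA -exprD addnC subnDA subnAC.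
have -> : (k - i.+1).+1 = (k.+1 - i.+1)%N by lia.
rewrite -(big_addn _ _ _ xpredT (fun l => delta ^+ l * A (k - l)%N)); set p := (K - i + i.+1)%N.
have Kp : (K.+1 <= p)%N by rewrite /p; lia.
have term0 j : 0 <= delta ^+ j * A (k - j)%N by rewrite mulr_ge0 ?exprn_ge0.
case: (leqP p k.+1) => pk; last by rewrite big_geq 1?ltnW// sumr_ge0.
by rewrite [leRHS](big_cat_nat Kp pk)/= lerDr sumr_ge0.
Qed.

End triangular_sums.

Lemma ffactnD n m p : (n ^_ (m + p) = n ^_ m * (n - m) ^_ p)%N.
Proof.
elim: p => [|p IH]; first by rewrite addn0 ffactn0 muln1.
by rewrite addnS !ffactnSr IH subnDA mulnA.
Qed.

Definition far (t n : nat) (i j : 'I_n) := (i + t <= j)%N || (j + t <= i)%N.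

Lemma card_near_index t n (i : 'I_n) : (#|[pred j | ~~ far t i j]| <= 2 * t)%N.
Proof.
case: (posnP t) => [->|t0].
  rewrite eq_card0// => j; rewrite inE /far !addn0; apply/negbTE; rewrite negbK.
  exact: leq_total.
(* The near indices form a window of radius less than [t] around [i]; [inord] needs a visible
   successor, whence the predecessor. *)
pose g (j : 'I_n) : 'I_(2 * t).-1.+1 := inord (j + t - i).
have t2 : (2 * t).-1.+1 = (2 * t)%N by rewrite prednK// muln_gt0.
rewrite -(@card_in_imset _ _ g).
  by rewrite (leq_trans (max_card _))// card_ord t2.
move=> j j'; rewrite !inE /far !negb_or -!ltnNge => /andP[? ?] /andP[? ?].
move=> /(congr1 val); rewrite /= !inordK ?t2; [|lia|lia].
by move=> ?; apply/val_inj => /=; lia.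
Qed.

Lemma card_coordinate_in r n (k : 'I_r) (Q : pred 'I_n) :
  (#|[pred J : r.-tuple 'I_n | Q (tnth J k)]| <= #|Q| * n ^ r.-1)%N.
Proof.
pose G (x : 'I_r) : pred 'I_n := if x == k then Q else predT.
pose F (J : r.-tuple 'I_n) : {ffun 'I_r -> 'I_n} := [ffun x => tnth J x].
have Finj : injective F.
  move=> J J' /ffunP FJ; apply: eq_from_tnth => x.
  by have := FJ x; rewrite !ffunE.
rewrite -(card_imset _ Finj).
apply: (@leq_trans #|(family G : pred {ffun 'I_r -> 'I_n})|).
  apply: subset_leq_card; apply/fintype.subsetP => f /imsetP[J QJ ->].
  by apply/familyP => x; rewrite ffunE /G; case: eqP => // ->.
rewrite card_family foldrE big_map big_enum/= (bigD1 k)//= /G eqxx.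
rewrite (eq_bigr (fun=> n)); last first.
  by move=> i ik; rewrite (negbTE ik) card_ord.
rewrite big_const -Monoid.iteropE /= -[iterop _ _ _ _]/(n ^ _)%N.
by rewrite cardC1 card_ord.
Qed.

Section expansion_setting.
Context {R : realType} (r t n : nat).
Implicit Types (A : {set 'I_n}) (J : r.-tuple 'I_n).

Definition near_tuple A J := [exists i in A, exists k, ~~ far t i (tnth J k)].

Lemma card_near_tuple A : (#|near_tuple A| <= #|A| * (r * (2 * t) * n ^ r.-1))%N.
Proof.
apply: (@leq_trans (\sum_(i in A) \sum_(k < r)
    #|[pred J : r.-tuple 'I_n | ~~ far t i (tnth J k)]|)%N).
  rewrite -sum1_card big_mkcond/=.
  rewrite (eq_bigr (fun i => \sum_J \sum_(k < r) (~~ far t i (tnth J k) : nat))%N); last first.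
    move=> i _; rewrite exchange_big/=; apply: eq_bigr => k _.
    by rewrite -sum1_card big_mkcond.
  rewrite exchange_big/=; apply: leq_sum => J _; case: ifP => // /existsP[i].
  move=> /andP[iA /existsP[k fk]].
  by rewrite (bigD1 i)//= (bigD1 k)//= fk -addnA leq_addr.
rewrite -sum_nat_const; apply: leq_sum => i _.
rewrite -[(r * (2 * t) * _)%N]mulnA -[X in (_ <= X * _)%N](card_ord r) -sum_nat_const.
apply: leq_sum => k _.
apply: leq_trans (card_coordinate_in k [pred j | ~~ far t i j]) _.
by rewrite leq_mul2r card_near_index orbT.
Qed.

Variables (mu : probability (n.-tuple R) R) (b B : R).
Variable zeta : r.-tuple 'I_n -> n.-tuple R -> R.
Hypotheses (t0 : (0 < t)%N) (r0 : (0 < r)%N) (n0 : (0 < n)%N).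
Hypotheses (mix : mixes mu t b) (b0 : 0 <= b).
Hypothesis bzeta : forall J, bmf (zeta J).
Hypothesis zetaB : forall J x, `|zeta J x| <= B.
Hypothesis dzeta : forall J, depends_on (fun i => i \in val J) (zeta J).

Definition totalsum x := \sum_J zeta J x.
Definition nearsum A x := \sum_(J | near_tuple A J) zeta J x.
Definition farsum A x := \sum_(J | ~~ near_tuple A J) zeta J x.

(** Bound on the sum of the kernels having an index within distance [t] of one given coordinate. *)
Definition delta_ : R := B * (r * (2 * t) * n ^ r.-1)%:R.
(** The factor [r * (2 * t)] makes the same number bound both the partial sums of V and [delta_]. *)
Definition supbound : R := B * (r * (2 * t) * n ^ r)%:R.

Lemma B_ge0 : 0 <= B.
Proof.
pose J0 : r.-tuple 'I_n := [tuple Ordinal n0 | i < r].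
by apply: le_trans (zetaB J0 [tuple 0 | i < n]).
Qed.

Lemma delta_ge0 : 0 <= delta_. Proof. by rewrite mulr_ge0 ?B_ge0. Qed.

Lemma delta_le_sup : delta_ <= supbound.
Proof.
rewrite ler_wpM2l ?B_ge0// ler_nat leq_mul2l; apply/orP; right.
by rewrite leq_pexp2l// leq_pred.
Qed.

Lemma sup_ge0 : 0 <= supbound. Proof. exact: le_trans delta_ge0 delta_le_sup. Qed.

Lemma bmf_totalsum : bmf totalsum. Proof. exact: bmf_sum. Qed.

Lemma localf_zeta J : localf r B (zeta J).
Proof.
apply: (localf_one (A := [set i in val J]%SET)).
- by rewrite cardsE (leq_trans (card_size _))// size_tuple.
- exact: bzeta.
- exact: zetaB.
- by move=> x y xy; apply: dzeta => i iJ; apply: xy; rewrite inE.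
Qed.

Lemma localf_nearsum A a : (#|A| <= a)%N -> localf r (a%:R * delta_) (nearsum A).
Proof.
move=> Aa; apply: localf_weaken (localf_sum B_ge0 (fun J _ => localf_zeta J)) => //.
rewrite /delta_ mulrCA [leLHS]mulrC ler_wpM2l ?B_ge0// -natrM ler_nat.
by rewrite (leq_trans (card_near_tuple A))// leq_mul2r Aa orbT.
Qed.

Lemma totalsum_split A x : totalsum x = nearsum A x + farsum A x.
Proof. by rewrite /totalsum (bigID (near_tuple A)). Qed.

Lemma partial_bound (P : pred (r.-tuple 'I_n)) x : `|\sum_(J | P J) zeta J x| <= supbound.
Proof.
apply: le_trans (ler_norm_sum _ _ _) _.
apply: (@le_trans _ _ (\sum_(J : r.-tuple 'I_n) B)).
  rewrite [leRHS](bigID P)/= -[leLHS]addr0 lerD//; first exact: ler_sum.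
  by apply: sumr_ge0 => *; exact: B_ge0.
rewrite sumr_const card_tuple card_ord -[leLHS]mulr_natr ler_wpM2l ?B_ge0//.
by rewrite ler_nat leq_pmull// !muln_gt0 r0 t0.
Qed.

Lemma dep_farsum A : depends_on (fun j => [forall i in A, far t i j]) (farsum A).
Proof.
move=> x y xy; apply: eq_bigr => J /existsPn nJ; apply: dzeta => j /tnthP[k ->].
apply: xy; apply/forallP => i; apply/implyP => iA.
have := nJ i; rewrite iA/= => /existsPn/(_ k); by rewrite negbK.
Qed.

(** [farsum A] only involves indices at distance at least [t] from [A], on either side, which is why
    interleaved index sets had to be decoupled. *)
Lemma far_decouple A Z w k : bmf Z -> (forall x, `|Z x| <= w) ->
  depends_on (fun i => i \in A) Z ->
  `|Ev mu (fun x => Z x * farsum A x ^+ k) - Ev mu Z * Ev mu (fun x => farsum A x ^+ k)|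
  <= 4 * w * supbound ^+ k * n%:R * b.
Proof.
move=> bZ Zw dZ.
have dX : depends_on (fun j => [forall i in A, far t i j]) (fun x => farsum A x ^+ k).
  by move=> x y xy; rewrite (dep_farsum xy).
have bX : bmf (fun x => farsum A x ^+ k) by apply: bmfX; exact: bmf_sum.
apply: (mixes_decouple t0 mix b0 bZ bX Zw _ dZ dX).
  by move=> x; rewrite normrX lerXn2r// ?nnegrE ?sup_ge0//; exact: partial_bound.
by move=> i j iA /forallP/(_ i); rewrite iA.
Qed.

Let V := totalsum.
Let e k := Ev mu (fun x => V x ^+ k).
Let A_ k := Ev mu (fun x => `|V x| ^+ k).
(** Unit of error: the terms of order at least [K] plus the cost of decoupling. *)
Let U K k := tailsum delta_ A_ K k + n%:R * b * supbound ^+ k.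

(* Z V^k is expanded, up to order K, into the derivatives of the monomial
   v^k; the coefficients c do not depend on k. *)
Definition expands K a (C : nat -> R) := forall Z w, localf a w Z ->
  exists c : nat -> R, c 0%N = Ev mu Z /\
  forall k, `|Ev mu (fun x => Z x * V x ^+ k) -
     \sum_(j < K) c j * (k ^_ j)%:R * e (k - j)| <= C k * w * U K k.

Let A_ge0 k : 0 <= A_ k. Proof. by apply: Ev_ge0 => x; rewrite exprn_ge0. Qed.

Let nbS_ge0 k : 0 <= n%:R * b * supbound ^+ k.
Proof. by rewrite !mulr_ge0 ?exprn_ge0 ?sup_ge0. Qed.

(** With no term subtracted, the absolute value of E[Z V^k] is at most [w * A_ k], the summand
    [j = 0] of the remainder. *)
Lemma expands0 a : expands 0 a (fun=> 1).
Proof.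
move=> Z w lZ; exists (fun=> Ev mu Z); split => // k.
have [bZ Zw] := localf_bound lZ.
rewrite big_ord0 subr0 mul1r.
have bV := bmfX k bmf_totalsum; have bVn := bmfX k (bmf_norm bmf_totalsum).
apply: le_trans (le_norm_Ev _ (bmfM bZ bV)) _.
apply: (@le_trans _ _ (w * A_ k)).
  rewrite -EvZ//; apply: le_Ev => [||x].
  - by apply: bmf_norm; exact: bmfM.
  - by apply: bmfM => //; exact: bmf_cst.
  - by rewrite normrM normrX ler_wpM2r ?exprn_ge0.
rewrite ler_wpM2l ?(localf_ge0 lZ)// /U /tailsum big_ltn// expr0 mul1r subn0.
by rewrite -addrA lerDl addr_ge0// tailsum_ge0// delta_ge0.
Qed.

(** 8 is the factor 4 of the decoupling times the 2 from centring Z. In the sum, the binomial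
    coefficient comes from expanding a k-th power, [a%:R ^+ i.+1] from the at most [a] coordinates
    seen by Z, and [Ci] from the expansions at lower order. *)
Definition expand_const a (Ci : nat -> nat -> R) k : R :=
  8 + \sum_(i < k) 'C(k, i.+1)%:R * (2 * a%:R ^+ i.+1 * Ci i (k - i.+1)%N).

(** With Z0 = Z - E[Z] and V = D + F, near and far part, one expands F^k = (V - D)^k and not V^k =
    (D + F)^k. In Z0 V^k = Z0 F^k - sum_(1 <= i <= k) (-1)^i C(k, i) Z0 D^i V^(k - i), the first
    term has expectation close to 0 by decoupling, and the others again pair a local function with a
    power of the full V, so that the induction applies. *)
Lemma expands_one K a (Ci : nat -> nat -> R) :
  (forall i k, 0 <= Ci i k) ->
  (forall i, expands (K - i) (a + r * i.+1) (Ci i)) ->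
  forall A Z w, (#|A| <= a)%N -> bmf Z -> (forall x, `|Z x| <= w) ->
    depends_on (fun i => i \in A) Z ->
  exists c : nat -> R, c 0%N = Ev mu Z /\
  forall k, `|Ev mu (fun x => Z x * V x ^+ k) -
     \sum_(j < K.+1) c j * (k ^_ j)%:R * e (k - j)| <=
     expand_const a Ci k * w * U K.+1 k.
Proof.
move=> Ci0 hC A Z w Aa bZ Zw dZ.
have w0 : 0 <= w by apply: le_trans (Zw [tuple 0 | i < n]).
set D := nearsum A; set F := farsum A.
pose Z0 x := Z x - Ev mu Z.
have bZ0 : bmf Z0 by apply: bmfB => //; exact: bmf_cst.
have Z0w x : `|Z0 x| <= 2 * w.
  rewrite (le_trans (ler_normB _ _))// mulrDl mul1r lerD//.
  exact: norm_Ev_le.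
have dZ0 : depends_on (fun i => i \in A) Z0 by move=> x y xy; rewrite /Z0 (dZ _ _ xy).
have bD : bmf D by exact: bmf_sum.
have bF : bmf F by exact: bmf_sum.
have bV := bmf_totalsum; rewrite -/V in bV.
have EZ0 : Ev mu Z0 = 0 by rewrite EvB ?Ev_cst ?subrr//; exact: bmf_cst.
pose Zi i x := Z0 x * D x ^+ i.+1.
have lZi i : localf (a + r * i.+1) (2 * w * (a%:R * delta_) ^+ i.+1) (Zi i).
  apply: localf_mul; first exact: (localf_one Aa).
  by apply: localf_exp; exact: localf_nearsum.
have bZi i : bmf (Zi i) by have [] := localf_bound (lZi i).
have /choice[c hc] := fun i => hC i _ _ (lZi i).
(* The product of C(k, i + 1) and the falling factorial of k - i - 1 of length j is the falling
   factorial of k of length i + 1 + j over (i + 1)!. Collecting the terms with equal i + 1 + j thus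
   leaves coefficients free of k. *)
pose cc j := if j is l.+1 then
  \sum_(i < l.+1) (-1) ^+ i * (i.+1)`!%:R^-1 * c i (l - i)%N else Ev mu Z.
exists cc; split => // k.
have idV : Ev mu (fun x => Z x * V x ^+ k) = Ev mu Z * e k +
    (Ev mu (fun x => Z0 x * F x ^+ k) + \sum_(i < k) (-1) ^+ i * 'C(k, i.+1)%:R *
       Ev mu (fun x => Zi i x * V x ^+ (k - i.+1))).
  have bt (i : nat) : bmf (fun x => Zi i x * V x ^+ (k - i.+1)).
    by apply: bmfM => //; exact: bmfX.
  have bs : bmf (fun x => \sum_(i < k) (-1) ^+ i * 'C(k, i.+1)%:R * (Zi i x * V x ^+ (k - i.+1))).
    by apply: bmf_sum => i _; apply: bmfM => //; exact: bmf_cst.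
  rewrite (eq_bigr (fun i : 'I_k => Ev mu (fun x => (-1) ^+ i * 'C(k, i.+1)%:R *
       (Zi i x * V x ^+ (k - i.+1))))); last by move=> i _; rewrite EvZ.
  rewrite -Ev_sum; last by move=> i _; apply: bmfM => //; exact: bmf_cst.
  have bZF : bmf (fun x => Z0 x * F x ^+ k) by apply: bmfM => //; exact: bmfX.
  have bVk : bmf (fun x => V x ^+ k) by exact: bmfX.
  rewrite -EvD// -EvZ// -EvD//; [|by apply: bmfM => //; exact: bmf_cst|exact: bmfD].
  congr Ev; apply/funext => x; rewrite -{1}(subrK (Ev mu Z) (Z x)) -/(Z0 x).
  rewrite mulrDl addrC; congr (_ + _).
  have FE : F x = V x - D x by rewrite /V (totalsum_split A) addrC addKr.
  rewrite FE exprBn big_ord_recl/= !expr0 mul1r subn0 mulr1 bin0 mulrDr -addrA.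
  rewrite mulr_sumr -big_split/= big1 ?addr0// => i _.
  rewrite /bump/= add1n exprSr -mulr_natr /Zi; ring.
have idc : \sum_(j < K.+1) cc j * (k ^_ j)%:R * e (k - j) = Ev mu Z * e k +
    \sum_(i < k) (-1) ^+ i * 'C(k, i.+1)%:R *
       \sum_(j < K - i) c i j * ((k - i.+1) ^_ j)%:R * e (k - i.+1 - j).
  rewrite big_ord_recl/= ffactn0 mulr1 subn0; congr (_ + _).
  pose G i j := (-1) ^+ i * (i.+1)`!%:R^-1 * c i j * (k ^_ (i.+1 + j))%:R * e (k - (i.+1 + j)).
  transitivity (\sum_(i < K) \sum_(j < K - i) G i j).
    rewrite triangle_sum; apply: eq_bigr => l _.
    rewrite /bump/= add1n /cc !mulr_suml; apply: eq_bigr => i _.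
    by rewrite /G addSn subnKC -1?ltnS.
  have GE i : \sum_(j < K - i) G i j = (-1) ^+ i * 'C(k, i.+1)%:R *
      \sum_(j < K - i) c i j * ((k - i.+1) ^_ j)%:R * e (k - i.+1 - j).
    rewrite mulr_sumr; apply: eq_bigr => j _.
    rewrite /G ffactnD natrM -(bin_ffact k i.+1) natrM subnDA.
    have f0 : (i.+1)`!%:R != 0 :> R by rewrite pnatr_eq0 -lt0n fact_gt0.
    by field.
  rewrite (eq_bigr _ (fun (i : 'I_K) _ => GE i)).
  (* The ranges [i < K] and [i < k] give the same sum: from [K] on the inner sum is empty, from [k]
     on the binomial coefficient vanishes. *)
  apply: (@sum_vanish _ K k (fun i => (-1) ^+ i * 'C(k, i.+1)%:R *
     \sum_(j < K - i) c i j * ((k - i.+1) ^_ j)%:R * e (k - i.+1 - j))) => i iK.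
    by rewrite (eqP iK) big_ord0 mulr0.
  by rewrite bin_small// mulr0 mul0r.
rewrite idV idc opprD addrACA subrr add0r -addrA -sumrB.
apply: (@le_trans _ _ (4 * (2 * w) * supbound ^+ k * n%:R * b +
   \sum_(i < k) 'C(k, i.+1)%:R *
     (Ci i (k - i.+1)%N * (2 * w * (a%:R * delta_) ^+ i.+1) * U (K - i) (k - i.+1)))).
  apply: le_trans (ler_normD _ _) _; apply: lerD.
    by have := far_decouple k bZ0 Z0w dZ0; rewrite EZ0 mul0r subr0.
  apply: le_trans (ler_norm_sum _ _ _) _; apply: ler_sum => i _.
  rewrite -mulrBr !normrM normrX normrN1 expr1n mul1r normr_nat.
  by rewrite ler_wpM2l//; have [_] := hc i; apply.
(* The power of [delta_] carried by [Zi] brings the tail back to order at least K + 1 and, as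
   [delta_ <= supbound], restores the exponent [k] of [supbound]. *)
have Ubound (i : 'I_k) : delta_ ^+ i.+1 * U (K - i) (k - i.+1) <= U K.+1 k.
  rewrite mulrDr lerD ?tailsum_shift ?delta_ge0//.
  rewrite mulrCA ler_wpM2l ?mulr_ge0//.
  rewrite (_ : supbound ^+ k = supbound ^+ i.+1 * supbound ^+ (k - i.+1)).
    rewrite ler_wpM2r ?exprn_ge0 ?sup_ge0// lerXn2r ?nnegrE ?delta_ge0 ?sup_ge0//.
    exact: delta_le_sup.
  by rewrite -exprD subnKC.
have U0 : 0 <= U K.+1 k by rewrite addr_ge0// tailsum_ge0// delta_ge0.
rewrite /expand_const -[leRHS]mulrA [leRHS]mulrDl; apply: lerD.
  rewrite (_ : 4 * (2 * w) * supbound ^+ k * n%:R * b =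
               8 * w * (n%:R * b * supbound ^+ k)); last by ring.
  rewrite -mulrA; apply: ler_wpM2l => //; apply: ler_wpM2l => //.
  by rewrite lerDr tailsum_ge0// delta_ge0.
rewrite !mulr_suml; apply: ler_sum => i _.
rewrite -!mulrA ler_wpM2l// exprMn.
rewrite (_ : Ci _ _ * _ = 2 * (a%:R ^+ i.+1 * (Ci i (k - i.+1)%N *
  (w * (delta_ ^+ i.+1 * U (K - i) (k - i.+1)))))); last by ring.
by rewrite !ler_wpM2l ?exprn_ge0.
Qed.

(** The error is proportional to [w], and weights add under sums, so the case of a single block
    extends by linearity. *)
Lemma expands_step K a (Ci : nat -> nat -> R) :
  (forall i k, 0 <= Ci i k) ->
  (forall i, expands (K - i) (a + r * i.+1) (Ci i)) ->
  expands K.+1 a (expand_const a Ci).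
Proof.
move=> Ci0 hC Z w; elim => {Z w} [A Z w Aa bZ Zw dZ|w1 Z1 w2 Z2 l1 IH1 l2 IH2].
  exact: expands_one hC A Z w Aa bZ Zw dZ.
have [c1 [c10 h1]] := IH1; have [c2 [c20 h2]] := IH2.
have [b1 _] := localf_bound l1; have [b2 _] := localf_bound l2.
exists (fun j => c1 j + c2 j); split; first by rewrite c10 c20 EvD.
move=> k; have bV := bmfX k bmf_totalsum.
rewrite (_ : Ev mu _ = Ev mu (fun x => Z1 x * V x ^+ k) + Ev mu (fun x => Z2 x * V x ^+ k)); last first.
  rewrite -EvD; [|exact: bmfM|exact: bmfM].
  by congr Ev; apply/funext => x; rewrite mulrDl.
rewrite (eq_bigr (fun j : 'I_K.+1 => c1 j * (k ^_ j)%:R * e (k - j) + c2 j * (k ^_ j)%:R * e (k - j))); last first.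
  by move=> j _; rewrite !mulrDl.
rewrite big_split/= opprD addrACA.
rewrite [leRHS](_ : _ = expand_const a Ci k * w1 * U K.+1 k + expand_const a Ci k * w2 * U K.+1 k); last by ring.
apply: le_trans (ler_normD _ _) _; apply: lerD; [exact: h1|exact: h2].
Qed.

End expansion_setting.

Lemma expand_const_ge0 {R : realType} a (Ci : nat -> nat -> R) k :
  (forall i k, 0 <= Ci i k) -> 0 <= expand_const a Ci k.
Proof.
by move=> Ci0; rewrite addr_ge0// sumr_ge0// => i _; rewrite !mulr_ge0// exprn_ge0.
Qed.

(** The constants are chosen before [t], [n], [mu] and the kernels, as the passage to the limit
    demands. Order K + 1 on [a] coordinates calls the orders [K - i] on [a + r * i.+1] coordinates,
    hence strong induction on [K] with [a] free. *)
Lemma uniform_expansion (R : realType) (r K a : nat) : (0 < r)%N ->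
  exists C : nat -> R, (forall k, 0 <= C k) /\
  forall (t n : nat) (mu : probability (n.-tuple R) R) (b B : R)
    (zeta : r.-tuple 'I_n -> n.-tuple R -> R),
  (0 < t)%N -> (0 < n)%N -> mixes mu t b -> 0 <= b ->
  (forall J, bmf (zeta J)) -> (forall J x, `|zeta J x| <= B) ->
  (forall J, depends_on (fun i => i \in val J) (zeta J)) ->
  expands t mu b B zeta K a C.
Proof.
move=> r0; elim/ltn_ind: K a => -[_|K IH] a.
  by exists (fun=> 1); split => // t n mu b B zeta *; exact: expands0.
have /choice[Ci hCi] := fun i => IH (K - i)%N (leq_subr i K) (a + r * i.+1)%N.
exists (expand_const a Ci); split.
  by move=> k; apply: expand_const_ge0 => i; case: (hCi i).
move=> t n mu b B zeta t0 n0 mix b0 bz zB dz.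
apply: expands_step => //; first by move=> i; case: (hCi i).
by move=> i; case: (hCi i) => _; apply.
Qed.

(** * Marcinkiewicz's theorem *)

Section entire_series.
Context {R : realType}.
Implicit Types (y z : nat -> R) (x rho : R).

(** Infinite radius of convergence, phrased with a geometric gain at every radius so that
    convergence follows by comparison with a geometric series. *)
Definition entire y := forall rho, 0 <= rho ->
  exists C, forall k, `|y k| * rho ^+ k <= C / 2 ^+ k.

Lemma entire_le y z : entire y -> (forall k, `|z k| <= `|y k|) -> entire z.
Proof.
move=> ey zy rho rho0; have [C hC] := ey rho rho0; exists C => k.
by apply: le_trans (hC k); rewrite ler_wpM2r ?exprn_ge0.
Qed.

Lemma entireD y z : entire y -> entire z -> entire (fun k => y k + z k).
Proof.
move=> ey ez rho rho0; have [C hC] := ey rho rho0; have [D hD] := ez rho rho0.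
exists (C + D) => k; rewrite mulrDl; apply: le_trans (lerD (hC k) (hD k)).
by rewrite -mulrDl ler_wpM2r ?exprn_ge0// ler_normD.
Qed.

Lemma entireZ (a : R) y : entire y -> entire (fun k => a * y k).
Proof.
move=> ey rho rho0; have [C hC] := ey rho rho0; exists (`|a| * C) => k.
by rewrite normrM -!mulrA ler_wpM2l.
Qed.

Lemma entire0 : entire (fun=> 0).
Proof. by move=> rho _; exists 0 => k; rewrite normr0 !mul0r. Qed.

Lemma entire_sum (I : Type) (s : seq I) (P : pred I) (F : I -> nat -> R) :
  (forall i, entire (F i)) -> entire (fun k => \sum_(i <- s | P i) F i k).
Proof.
move=> eF; elim: s => [|i s IH].
  by apply: (entire_le entire0) => k; rewrite big_nil.
case Pi : (P i).
  by apply: (entire_le (entireD (eF i) IH)) => k; rewrite big_cons Pi.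
by apply: (entire_le IH) => k; rewrite big_cons Pi.
Qed.

Lemma entire_diffs y : entire y -> entire (pseries_diffs y).
Proof.
(* The radius is enlarged so that [4 ^+ k.+1] absorbs the factor [k.+1] of the derivative; adding 1
   keeps the base at least 1. *)
move=> ey rho rho0; have rho4 : 0 <= 4 * (rho + 1) by rewrite mulr_ge0// addr_ge0.
have [C hC] := ey _ rho4.
exists C => k; rewrite /pseries_diffs normrM normr_nat.
have hk := hC k.+1.
have -> : C / 2 ^+ k = 2 * (C / 2 ^+ k.+1).
  by rewrite exprS invfM mulrCA mulVKf.
apply: le_trans (_ : 2 * (`|y k.+1| * (4 * (rho + 1)) ^+ k.+1) <= _); last first.
  by rewrite ler_wpM2l.
rewrite exprMn [leRHS](_ : _ = `|y k.+1| * ((2 * 4 ^+ k.+1) * (rho + 1) ^+ k.+1)); last by ring.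
rewrite [leLHS](_ : _ = `|y k.+1| * (k.+1%:R * rho ^+ k)); last by ring.
rewrite ler_wpM2l// ler_pM ?exprn_ge0//.
  rewrite (@le_trans _ _ (4 ^+ k.+1))//.
    by rewrite -natrX ler_nat ltnW// ltn_expl.
  by rewrite ler_peMl ?exprn_ge0// ler1n.
rewrite (@le_trans _ _ ((rho + 1) ^+ k))//.
  by rewrite lerXn2r ?nnegrE ?addr_ge0// lerDl.
by rewrite exprS ler_peMl ?exprn_ge0 ?addr_ge0// lerDr.
Qed.

Definition shiftseq j y k : R := if (j <= k)%N then y (k - j)%N else 0.

Lemma entire_cvg y x : entire y -> cvgn (pseries y x).
Proof.
move=> ey; have [C hC] := ey `|x| (normr_ge0 x).
apply: normed_cvg; apply: (@series_le_cvg _ _ (geometric C 2^-1)).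
- by move=> k; exact: normr_ge0.
- move=> k; have := hC 0%N; rewrite /geometric/= => h0.
  rewrite mulr_ge0 ?exprn_ge0 ?invr_ge0//.
  by rewrite expr0 invr1 mulr1 in h0; apply: le_trans h0; rewrite mulr_ge0.
- by move=> k; rewrite /geometric/= normrM normrX exprVn.
- by apply: is_cvg_geometric_series; rewrite ger0_norm ?invr_ge0// invf_lt1// ltr1n.
Qed.

Definition Ser y x : R := limn (pseries y x).

Lemma is_derive_Ser y x : entire y -> is_derive x 1 (Ser y) (Ser (pseries_diffs y) x).
Proof.
move=> ey; apply: (@pseries_snd_diffs _ _ (`|x| + 1)).
- exact: entire_cvg.
- by apply: entire_cvg; exact: entire_diffs.
- by apply: entire_cvg; do 2 apply: entire_diffs.
- by rewrite [ltRHS]ger0_norm ?addr_ge0// ltrDl.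
Qed.

Lemma SerD y z x : entire y -> entire z -> Ser (fun k => y k + z k) x = Ser y x + Ser z x.
Proof.
move=> ey ez; apply/cvg_lim => //.
rewrite (_ : pseries _ x = (fun n => pseries y x n + pseries z x n)); last first.
  by apply/funext => n; rewrite /pseries /series/= -big_split/=;
    apply: eq_bigr => i _; rewrite mulrDl.
by apply: cvgD; exact: entire_cvg.
Qed.

Lemma SerZ (a : R) y x : entire y -> Ser (fun k => a * y k) x = a * Ser y x.
Proof.
move=> ey; apply/cvg_lim => //.
rewrite (_ : pseries _ x = (fun n => a * pseries y x n)); last first.
  by apply/funext => n; rewrite /pseries /series/= mulr_sumr;
    apply: eq_bigr => i _; rewrite mulrA.
by apply: cvgZr; exact: entire_cvg.
Qed.

Lemma Ser0 x : Ser (fun=> 0) x = 0.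
Proof.
apply/cvg_lim => //; rewrite (_ : pseries _ x = (fun=> 0)); first exact: cvg_cst.
by apply/funext => n; rewrite /pseries /series/= big1// => i _; rewrite mul0r.
Qed.

Lemma Ser_sum (I : Type) (s : seq I) (F : I -> nat -> R) x :
  (forall i, entire (F i)) -> Ser (fun k => \sum_(i <- s) F i k) x = \sum_(i <- s) Ser (F i) x.
Proof.
move=> eF; elim: s => [|i s IH].
  by rewrite big_nil -[RHS](Ser0 x); congr Ser; apply/funext => k; rewrite big_nil.
rewrite big_cons -IH -SerD//; last exact: entire_sum.
by congr Ser; apply/funext => k; rewrite big_cons.
Qed.

Lemma entire_shift j y : entire y -> entire (shiftseq j y).
Proof.
move=> ey rho rho0; have [C hC] := ey rho rho0; exists (C * (2 * rho) ^+ j) => k.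
have C0 : 0 <= C.
  have := hC 0%N; rewrite !expr0 invr1 !mulr1; exact: le_trans.
rewrite /shiftseq; case: leqP => jk; last first.
  by rewrite normr0 mul0r !mulr_ge0 ?invr_ge0 ?exprn_ge0 ?mulr_ge0.
rewrite -{2 3}(subnK jk) !exprD exprMn mulrA.
apply: le_trans (_ : C / 2 ^+ (k - j) * rho ^+ j <= _); last first.
  rewrite invfM; have : (2 : R) ^+ j != 0 by rewrite expf_neq0.
  have : (2 : R) ^+ (k - j) != 0 by rewrite expf_neq0.
  by move=> h1 h2; rewrite le_eqVlt; apply/orP; left; apply/eqP; field; rewrite h1 h2.
by rewrite ler_wpM2r ?exprn_ge0.
Qed.

Lemma Ser_shift j y x : entire y -> Ser (shiftseq j y) x = x ^+ j * Ser y x.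
Proof.
move=> ey; apply/cvg_lim => //; rewrite -(cvg_shiftn j).
rewrite (_ : (fun n => _) = (fun n => x ^+ j * pseries y x n)).
  by apply: cvgZr; exact: entire_cvg.
apply/funext => n; rewrite /pseries /series/=.
rewrite addnC (big_cat_nat (leq0n j) (leq_addr n j))/= big_nat_cond big1 ?add0r; last first.
  by move=> i /andP[/andP[_ ij] _]; rewrite /shiftseq leqNgt ij mul0r.
rewrite -{1}[j]add0n big_addn addKn mulr_sumr; apply: eq_bigr => i _.
by rewrite /shiftseq leq_addl addnK exprD; ring.
Qed.

End entire_series.

Lemma leading_coef_ge0 {R : realType} d (c : nat -> R) :
  (forall rho, 0 <= rho -> 0 <= \sum_(j < d.+1) c j * rho ^+ j) -> 0 <= c d.
Proof.
move=> h; rewrite leNgt; apply/negP => cd.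
pose B := \sum_(j < d) `|c j|.
have B0 : 0 <= B by exact: sumr_ge0.
(* Large enough for the top term to beat the others: [c d * rho] falls below [- B]. *)
pose rho := (B + 1) / - c d + 1.
have Bc : 0 < (B + 1) / - c d by rewrite divr_gt0 ?oppr_gt0// ltr_wpDl.
have rho1 : 1 <= rho by rewrite lerDr ltW.
have rho0 : 0 <= rho by apply: le_trans rho1.
have := h _ rho0; apply/negP; rewrite -ltNge big_ord_recr/=.
case: d c h cd @B B0 @rho Bc rho1 rho0 => [|d] c h cd B B0 rho Bc rho1 rho0.
  by rewrite big_ord0 add0r expr0 mulr1.
have le1 : \sum_(j < d.+1) c j * rho ^+ j <= B * rho ^+ d.
  rewrite mulr_suml; apply: ler_sum => j _.
  apply: le_trans (ler_norm _) _; rewrite normrM ler_wpM2l// ger0_norm ?exprn_ge0//.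
  by rewrite ler_weXn2l// -ltnS.
apply: le_lt_trans (lerD le1 (lexx _)) _.
have crho : c d.+1 * rho = - (B + 1) + c d.+1.
  by rewrite /rho; field; rewrite lt_eqF.
rewrite (_ : _ + _ = (B + c d.+1 * rho) * rho ^+ d); last by rewrite exprS; ring.
rewrite crho pmulr_llt0; first by lra.
by rewrite exprn_gt0// (lt_le_trans _ rho1).
Qed.

Lemma Ser_at0 {R : realType} (y : nat -> R) : Ser y 0 = y 0%N.
Proof.
apply/cvg_lim => //; rewrite -(cvg_shiftn 1).
rewrite (_ : (fun n => _) = (fun=> y 0%N)); first exact: cvg_cst.
apply/funext => n; rewrite addn1 /pseries /series/= big_nat_recl//= expr0 mulr1.
by rewrite big1 ?addr0// => i _; rewrite expr0n mulr0.
Qed.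

Section marcinkiewicz.
Context {R : realType}.
Variables (m alpha : nat -> R) (K : nat).
Hypothesis m0 : m 0%N = 1.
Hypothesis hankel : forall N (p : nat -> R),
  0 <= \sum_(i < N) \sum_(j < N) p i * p j * m (i + j)%N.
Hypothesis mS : forall k, m k.+1 = \sum_(1 <= j < K) alpha j * (k ^_ j)%:R * m (k - j)%N.

(** Coefficients of the moment generating function M; the recursion for [m] says that M' is M times
    the polynomial with coefficients [alpha]. *)
Let x k : R := m k / k`!%:R.

Let fact_neq0 k : k`!%:R != 0 :> R.
Proof. by rewrite pnatr_eq0 -lt0n fact_gt0. Qed.

Let xS k : k.+1%:R * x k.+1 = \sum_(1 <= j < K) alpha j * shiftseq j x k.
Proof.
rewrite /x mS factS natrM invfM mulrCA mulVKf ?pnatr_eq0// mulr_suml; apply: eq_bigr => j _.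
rewrite /shiftseq; case: leqP => jk; last by rewrite ffact_small// !(mulr0, mul0r).
have := ffact_fact jk => /(congr1 (fun n => n%:R : R)); rewrite natrM => e.
have := fact_neq0 (k - j)%N => f0.
have -> : (k ^_ j)%:R = k`!%:R / (k - j)`!%:R :> R by rewrite -e mulfK.
have := fact_neq0 k => f1; field; by rewrite f0.
Qed.

(** In the recursion the factor [k.+1] on the left eventually exceeds [s], after which the bound [C]
    propagates; up to that index [C] is large enough by construction. *)
Lemma entire_x : entire x.
Proof.
move=> rho rho0.
pose s := \sum_(1 <= j < K) `|alpha j| * (2 * rho) ^+ j.+1.
have s0 : 0 <= s by apply: sumr_ge0 => j _; rewrite mulr_ge0// exprn_ge0// mulr_ge0.
pose k0 := Num.truncn s.
pose C := \sum_(k < k0.+1) `|x k| * (2 * rho) ^+ k.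
exists C; suff h k : `|x k| * (2 * rho) ^+ k <= C.
  by move=> k; rewrite ler_pdivlMr ?exprn_gt0// -mulrA [_ * 2 ^+ k]mulrC -exprMn.
set rr := 2 * rho; have rr0 : 0 <= rr by rewrite mulr_ge0.
elim/ltn_ind: k => k IH.
have [kk0|k0k] := ltnP k k0.+1.
  rewrite /C (bigD1 (Ordinal kk0))//= lerDl sumr_ge0// => i _.
  by rewrite mulr_ge0// exprn_ge0.
case: k IH k0k => // k IH k0k.
have C0 : 0 <= C by apply: sumr_ge0 => i _; rewrite mulr_ge0// exprn_ge0.
have k1 : 0 < k.+1%:R :> R by rewrite ltr0n.
rewrite -(ler_pM2l k1) mulrA -[X in X * `|_|]normr_nat -normrM xS.
apply: (@le_trans _ _ (s * C)); last first.
  rewrite ler_wpM2r// (le_trans (ltW (truncnS_gt s)))// ler_nat.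
  by rewrite -/k0.
rewrite /s !mulr_suml.
apply: (@le_trans _ _ (\sum_(1 <= j < K) `|alpha j * shiftseq j x k| * rr ^+ k.+1)).
  rewrite -mulr_suml ler_wpM2r ?exprn_ge0//; exact: ler_norm_sum.
apply: ler_sum => j _; rewrite normrM -!mulrA ler_wpM2l//.
rewrite /shiftseq; case: leqP => jk; last first.
  by rewrite normr0 mul0r mulr_ge0 ?exprn_ge0.
have -> : k.+1 = (j.+1 + (k - j))%N by lia.
rewrite exprD mulrCA ler_wpM2l ?exprn_ge0//; apply: IH; lia.
Qed.

Section ray.
Variable theta : R.

(** [Ser u] and [Ser v] are the real and imaginary parts of M at rho e^(i theta). *)
Let u k := x k * cos (k%:R * theta).
Let v k := x k * sin (k%:R * theta).

Lemma entire_u : entire u.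
Proof.
by apply: (entire_le entire_x) => k; rewrite normrM ler_piMr// ler_norml cos_geN1 cos_le1.
Qed.

Lemma entire_v : entire v.
Proof.
by apply: (entire_le entire_x) => k; rewrite normrM ler_piMr// ler_norml sin_geN1 sin_le1.
Qed.

Lemma diffs_u : pseries_diffs u = fun k => \sum_(1 <= j < K)
  (alpha j * cos (j.+1%:R * theta) * shiftseq j u k +
   - (alpha j * sin (j.+1%:R * theta)) * shiftseq j v k).
Proof.
apply/funext => k; rewrite /pseries_diffs /u mulrA xS mulr_suml; apply: eq_bigr => j _.
rewrite /shiftseq; case: leqP => jk; last by rewrite !mulr0 mul0r addr0.
have -> : k.+1%:R * theta = j.+1%:R * theta + (k - j)%:R * theta.
  by rewrite -mulrDl -natrD addSn subnKC.
by rewrite cosD /v; ring.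
Qed.

Lemma diffs_v : pseries_diffs v = fun k => \sum_(1 <= j < K)
  (alpha j * sin (j.+1%:R * theta) * shiftseq j u k +
   alpha j * cos (j.+1%:R * theta) * shiftseq j v k).
Proof.
apply/funext => k; rewrite /pseries_diffs /v mulrA xS mulr_suml; apply: eq_bigr => j _.
rewrite /shiftseq; case: leqP => jk; last by rewrite !mulr0 mul0r addr0.
have -> : k.+1%:R * theta = j.+1%:R * theta + (k - j)%:R * theta.
  by rewrite -mulrDl -natrD addSn subnKC.
by rewrite sinD /u; ring.
Qed.

Definition normsq rho := Ser u rho ^+ 2 + Ser v rho ^+ 2.

Let c j := cos (j%:R * theta).

(** The real part, at rho e^(i theta), of the polynomial Q with Q(0) = 0 and M' = Q' M. *)
Definition expo_poly : {poly R} := \sum_(1 <= j < K) (alpha j / j.+1%:R * c j.+1) *: 'X^(j.+1).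

Lemma deriv_expo rho : expo_poly^`().[rho] = \sum_(1 <= j < K) alpha j * c j.+1 * rho ^+ j.
Proof.
rewrite /expo_poly raddf_sum horner_sum; apply: eq_bigr => j _.
rewrite /= derivZ derivXn hornerZ hornerMn hornerXn /= -mulr_natr.
have j0 : j.+1%:R != 0 :> R by rewrite pnatr_eq0.
by field.
Qed.

Lemma Ser_diffs (a b : nat -> R) rho :
  Ser (fun k => \sum_(1 <= j < K) (a j * shiftseq j u k + b j * shiftseq j v k)) rho =
  (\sum_(1 <= j < K) a j * rho ^+ j) * Ser u rho + (\sum_(1 <= j < K) b j * rho ^+ j) * Ser v rho.
Proof.
have eu := entire_u; have ev := entire_v.
rewrite Ser_sum; last first.
  by move=> j; apply: entireD; apply: entireZ; exact: entire_shift.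
rewrite !mulr_suml -big_split/=; apply: eq_bigr => j _.
rewrite SerD; [|by apply: entireZ; exact: entire_shift|by apply: entireZ; exact: entire_shift].
rewrite !SerZ; [|exact: entire_shift|exact: entire_shift].
by rewrite !Ser_shift// !mulrA.
Qed.

(** Along the ray, |M|^2 exp(-2 Re Q) has derivative zero and equals 1 at the origin. *)
Lemma normsqE rho : normsq rho = expR (2 * expo_poly.[rho]).
Proof.
pose su : R -> R := Ser u; pose sv : R -> R := Ser v.
pose H : R -> R := (su * su + sv * sv) * (expR \o horner (- 2%:R *: expo_poly)).
have dH (y : R) : is_derive y 1 H 0.
  have du := is_derive_Ser y entire_u; have dv := is_derive_Ser y entire_v.
  rewrite diffs_u Ser_diffs in du; rewrite diffs_v Ser_diffs in dv.
  have dp := is_derive_poly (- 2%:R *: expo_poly) y.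
  have de := is_derive1_comp (is_derive_expR _) dp.
  apply: is_derive_eq; rewrite /= !fctE /= derivZ hornerZ deriv_expo.
  rewrite [\sum_(1 <= j < K) - _ * _](eq_bigr (fun j => - (alpha j * sin (j.+1%:R * theta) * y ^+ j))); last first.
    by move=> j _; rewrite mulNr.
  rewrite sumrN /c -/(su y) -/(sv y).
  set g := \sum_(1 <= j < K) _; set s := \sum_(1 <= j < K) _.
  by rewrite /GRing.scale/=; ring.
have HE y : H y = normsq y * expR (- (2 * expo_poly.[y])).
  by rewrite /H /normsq !fctE /= hornerZ mulNr !expr2.
have := is_derive_0_is_cst rho 0 dH; rewrite !HE.
have p0 : expo_poly.[0] = 0.
  rewrite /expo_poly horner_sum big1// => j _.
  by rewrite hornerZ hornerXn expr0n/= mulr0.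
have n0 : normsq 0 = 1.
  rewrite /normsq !Ser_at0 /u /v mul0r cos0 sin0 mulr0 expr0n addr0 mulr1.
  by rewrite /x m0 fact0 divr1 expr1n.
rewrite p0 n0 mulr0 oppr0 expR0 mulr1 => e.
by rewrite expRN in e; exact: divr1_eq e.
Qed.

End ray.

(** Real part of e^(i phi) (e^(i theta) + e^(-i theta))^k; the phase [phi] is free so that the
    induction on [k] closes. *)
Lemma sum_binom_cos k theta phi :
  \sum_(i < k.+1) 'C(k, i)%:R * cos ((2 * i%:R - k%:R) * theta + phi) =
  2 ^+ k * (cos theta ^+ k * cos phi) :> R.
Proof.
elim: k phi => [|k IH] phi.
  by rewrite big_ord1 bin0 mulr0 subr0 mul0r add0r expr0 !mul1r.
have -> : 2 ^+ k.+1 * (cos theta ^+ k.+1 * cos phi) =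
    2 ^+ k * (cos theta ^+ k * cos (phi - theta)) + 2 ^+ k * (cos theta ^+ k * cos (phi + theta)).
  by rewrite cosB cosD !exprS; ring.
rewrite -!IH big_ord_recl/= bin0.
rewrite (eq_bigr (fun i : 'I_k.+1 =>
   'C(k, i.+1)%:R * cos ((2 * i.+1%:R - k.+1%:R) * theta + phi) +
   'C(k, i)%:R * cos ((2 * i%:R - k%:R) * theta + (phi + theta)))); last first.
  move=> i _; rewrite /bump/= add1n binS natrD mulrDl; congr (_ + _ * cos _).
  by rewrite -!natr1; ring.
rewrite big_split/= addrA; congr (_ + _).
rewrite [in RHS]big_ord_recl/= bin0 big_ord_recr/= bin_small// mul0r addr0.
congr (_ * cos _ + _); first by rewrite -natr1; ring.
by apply: eq_bigr => i _; congr (_ * cos _); rewrite /bump/= add1n -[k.+1%:R]natr1; ring.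
Qed.

Lemma sum_binom k : \sum_(i < k.+1) 'C(k, i)%:R = 2 ^+ k :> R.
Proof.
have := sum_binom_cos k 0 0; rewrite cos0 expr1n mulr1 mulr1 => <-.
by apply: eq_bigr => i _; rewrite mulr0 addr0 cos0 mulr1.
Qed.

Lemma sum_half N M : \sum_(N <= l < N + M) (2^-1) ^+ l =
  2 * (2^-1) ^+ N - 2 * (2^-1) ^+ (N + M) :> R.
Proof.
elim: M => [|M IH]; first by rewrite addn0 big_geq// subrr.
by rewrite addnS big_nat_recr ?leq_addr//= IH exprS; field.
Qed.

(** The square partial sums contain the triangle i + j < N, whose diagonals are the terms of the
    series, and parts of the diagonals N <= l < 2 N, which a geometric tail dominates. *)
Lemma double_series_cvg (rho : R) (tt : nat -> nat -> R) (y : nat -> R) :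
  (forall i j, `|tt i j| <= 1) ->
  (forall k, \sum_(i < k.+1) 'C(k, i)%:R * tt i (k - i)%N = 2 ^+ k * y k) ->
  (\sum_(i < N) \sum_(j < N) (rho / 2) ^+ (i + j) / (i`!%:R * j`!%:R) * tt i j * m (i + j)%N)
    @[N --> \oo] --> Ser (fun k => x k * y k) rho.
Proof.
move=> t1 ty.
pose f i j := (rho / 2) ^+ (i + j) / (i`!%:R * j`!%:R) * tt i j * m (i + j)%N.
have fE k i : (i <= k)%N -> f i (k - i)%N = (rho ^+ k * x k / 2 ^+ k) * ('C(k, i)%:R * tt i (k - i)%N).
  move=> ik; rewrite /f /x subnKC// expr_div_n.
  have := bin_fact ik => /(congr1 (fun n => n%:R : R)); rewrite !natrM => <-.
  have h1 := fact_neq0 i; have h2 := fact_neq0 (k - i)%N.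
  have h3 : (2 : R) ^+ k != 0 by rewrite expf_neq0.
  have h4 : 'C(k, i)%:R != 0 :> R by rewrite pnatr_eq0 -lt0n bin_gt0.
  by field; rewrite h1 h2 h3 h4.
have diag k : \sum_(i < k.+1) f i (k - i)%N = x k * y k * rho ^+ k.
  rewrite (eq_bigr (fun i : 'I_k.+1 => (rho ^+ k * x k / 2 ^+ k) * ('C(k, i)%:R * tt i (k - i)%N))).
    rewrite -mulr_sumr ty; have h3 : (2 : R) ^+ k != 0 by rewrite expf_neq0.
    by field.
  by move=> i _; rewrite fE// -ltnS.
have diagle k (b : nat -> bool) : `|\sum_(i < k.+1) (if b i then f i (k - i)%N else 0)| <= `|x k| * `|rho| ^+ k.
  apply: le_trans (ler_norm_sum _ _ _) _.
  apply: (@le_trans _ _ (\sum_(i < k.+1) `|rho ^+ k * x k / 2 ^+ k| * 'C(k, i)%:R)).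
    apply: ler_sum => i _; case: (b i); last by rewrite normr0 mulr_ge0.
    rewrite fE -1?ltnS// normrM ler_wpM2l// normrM normr_nat ler_piMr//.
  rewrite -mulr_sumr sum_binom normrM normfV [`|2 ^+ k|]ger0_norm ?exprn_ge0//.
  by rewrite mulfVK ?expf_neq0// normrM normrX mulrC.
have [C hC] := entire_x (normr_ge0 rho).
have DE N : \sum_(i < N) \sum_(j < N) f i j = pseries (fun k => x k * y k) rho N +
    \sum_(N <= l < N + N) \sum_(i < l.+1) (if (i < N)%N && (l - i < N)%N then f i (l - i)%N else 0).
  pose f' i j := if (i < N)%N && (j < N)%N then f i j else 0.
  have -> : \sum_(i < N) \sum_(j < N) f i j = \sum_(i < N + N) \sum_(j < N + N - i) f' i j.
    rewrite (@sum_vanish _ (N + N) N (fun i => \sum_(j < N + N - i) f' i j)); last 2 first.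
    - by move=> i iN; rewrite (_ : N + N - i = 0)%N ?big_ord0//; lia.
    - by move=> i iN; rewrite big1// => j _; rewrite /f' ltnNge iN.
    apply: eq_bigr => i _.
    rewrite (@sum_vanish _ (N + N - i) N (f' i)).
    - by apply: eq_bigr => j _; rewrite /f' !ltn_ord.
    - by move=> j jN; rewrite /f' [(j < N)%N]ltnNge (_ : (N <= j)%N) ?andbF//; have := ltn_ord i; lia.
    - by move=> j jN; rewrite /f' [(j < N)%N]ltnNge jN andbF.
  rewrite triangle_sum -(big_mkord xpredT (fun l => \sum_(i < l.+1) f' i (l - i)%N)).
  rewrite (big_cat_nat (leq0n N) (leq_addr N N))/=; congr (_ + _).
  rewrite /pseries /series/=; apply: eq_big_nat => l lN; rewrite -diag.
  by apply: eq_bigr => i _; rewrite /f' !ifT//; have := ltn_ord i; lia.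
rewrite -[X in _ --> X]addr0; under eq_fun do rewrite DE.
apply: cvgD.
  apply: entire_cvg; apply: (entire_le entire_x) => k; rewrite normrM ler_piMr//.
  rewrite -(ler_pM2l (_ : 0 < 2 ^+ k)) ?exprn_gt0// mulr1.
  rewrite -{1}[2 ^+ k]ger0_norm ?exprn_ge0// -normrM -ty.
  apply: le_trans (ler_norm_sum _ _ _) _; rewrite -sum_binom.
  by apply: ler_sum => i _; rewrite normrM normr_nat ler_piMr.
apply/norm_cvg0P.
apply: (@squeeze_cvgr _ _ _ _ (fun=> 0) (fun N => 2 * C * (2^-1) ^+ N)).
- near=> N; rewrite normr_ge0/=; apply: le_trans (ler_norm_sum _ _ _) _.
  apply: (@le_trans _ _ (\sum_(N <= l < N + N) C / 2 ^+ l)).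
    by apply: ler_sum => l _; exact: le_trans (diagle l (fun i => (i < N)%N && (l - i < N)%N)) (hC l).
  rewrite -mulr_sumr -mulrA mulrCA ler_wpM2l//.
    have := hC 0%N; rewrite expr0 invr1 !mulr1; exact: le_trans.
  under eq_bigr do rewrite -exprVn.
  by rewrite sum_half gerBl mulr_ge0// exprn_ge0// invr_ge0.
- exact: cvg_cst.
- rewrite -[X in _ --> X](mulr0 (2 * C)); apply: cvgZr; apply: cvg_expr.
  by rewrite ger0_norm ?invr_ge0// invf_lt1// ltr1n.
Unshelve. all: by end_near.
Qed.

(** Plays the role of E[p(X) q(X)] for polynomials p, q of degree less than [N]. *)
Let bil N (p q : nat -> R) := \sum_(i < N) \sum_(j < N) p i * q j * m (i + j)%N.

Lemma bilC N p q : bil N p q = bil N q p.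
Proof.
rewrite /bil exchange_big/=; apply: eq_bigr => i _; apply: eq_bigr => j _.
by rewrite addnC [p _ * _]mulrC.
Qed.

Lemma bil_cauchy_schwarz N p q : bil N p q ^+ 2 <= bil N p p * bil N q q.
Proof.
have pos s t : 0 <= s ^+ 2 * bil N p p + 2 * s * t * bil N p q + t ^+ 2 * bil N q q.
  have := hankel N (fun i => s * p i + t * q i); congr (_ <= _).
  rewrite -[2 * s * t]mulrA mulr2n.
  rewrite (_ : _ + _ = s ^+ 2 * bil N p p + s * t * bil N p q + s * t * bil N q p + t ^+ 2 * bil N q q); last first.
    by rewrite (bilC N q p); ring.
  rewrite /bil !mulr_sumr -!big_split/=; apply: eq_bigr => i _.
  rewrite !mulr_sumr -!big_split/=; apply: eq_bigr => j _; ring.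
have P0 := hankel N p; have Q0 := hankel N q.
rewrite -/(bil N p p) in P0; rewrite -/(bil N q q) in Q0.
move: (bil N p p) (bil N q q) (bil N p q) pos P0 Q0 => P Q S pos P0 Q0.
rewrite leNgt; apply/negP => h.
(* If S^2 > P Q, then [pos] fails at (-S, P) when P > 0, at (Q, -S) when Q > 0, and at (1, -S) when
   both vanish. *)
have [P1|] := ltP 0 P.
  have := pos (- S) P.
  have : P * (P * Q - S ^+ 2) < 0 by rewrite pmulr_rlt0// subr_lt0.
  rewrite !expr2; nra.
have [Q1|] := ltP 0 Q.
  have := pos Q (- S).
  have : Q * (P * Q - S ^+ 2) < 0 by rewrite pmulr_rlt0// subr_lt0.
  rewrite !expr2; nra.
move=> Q1 P1; have PE : P = 0 by apply/eqP; rewrite eq_le P1 P0.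
have QE : Q = 0 by apply/eqP; rewrite eq_le Q1 Q0.
move: h (pos 1 (- S)); rewrite PE QE !expr2; nra.
Qed.

(* |M(z)| <= M(Re z) for the moment generating function M, z = rho e^(i theta). *)
Lemma normsq_le theta rho : normsq theta rho <= Ser x (rho * cos theta) ^+ 2.
Proof.
(* [p] and [q] are the Taylor coefficients of the real and imaginary parts of e^(z X / 2). With a =
   E[p^2], b = E[q^2] and c = E[p q], in the limit Re M(z) = a - b, Im M(z) = 2 c and M(Re z) = a +
   b, so the claim reduces to c^2 <= a b. *)
pose p i := (rho / 2) ^+ i / i`!%:R * cos (i%:R * theta).
pose q i := (rho / 2) ^+ i / i`!%:R * sin (i%:R * theta).
have expand (F : nat -> nat -> R) (N : nat) (b : nat -> nat -> R) :
   (forall i j, b i j = (rho / 2) ^+ i / i`!%:R * ((rho / 2) ^+ j / j`!%:R) * F i j) ->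
   \sum_(i < N) \sum_(j < N) (rho / 2) ^+ (i + j) / (i`!%:R * j`!%:R) * F i j * m (i + j)%N
   = \sum_(i < N) \sum_(j < N) b i j * m (i + j)%N.
  move=> hb; apply: eq_bigr => i _; apply: eq_bigr => j _; rewrite hb exprD.
  by have h1 := fact_neq0 i; have h2 := fact_neq0 j; field; rewrite h1 h2.
have c1 : (bil N p p - bil N q q) @[N --> \oo] -->
    Ser (fun k => x k * cos (k%:R * theta)) rho.
  rewrite (_ : (fun N => _) = (fun N => \sum_(i < N) \sum_(j < N)
    (rho / 2) ^+ (i + j) / (i`!%:R * j`!%:R) * cos ((i + j)%:R * theta) * m (i + j)%N)).
    apply: (@double_series_cvg _ (fun i j => cos ((i + j)%:R * theta)) (fun k => cos (k%:R * theta))).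
      by move=> i j; rewrite ler_norml cos_geN1 cos_le1.
    move=> k; rewrite -sum_binom mulr_suml; apply: eq_bigr => i _.
    by rewrite subnKC// -ltnS.
  apply/funext => N.
  rewrite (expand (fun i j => cos ((i + j)%:R * theta)) _ (fun i j => p i * p j - q i * q j)).
    rewrite /bil -sumrB; apply: eq_bigr => i _; rewrite -sumrB.
    by apply: eq_bigr => j _; rewrite mulrBl.
  by move=> i j; rewrite natrD mulrDl cosD /p /q; ring.
have c2 : (bil N p q + bil N q p) @[N --> \oo] -->
    Ser (fun k => x k * sin (k%:R * theta)) rho.
  rewrite (_ : (fun N => _) = (fun N => \sum_(i < N) \sum_(j < N)
    (rho / 2) ^+ (i + j) / (i`!%:R * j`!%:R) * sin ((i + j)%:R * theta) * m (i + j)%N)).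
    apply: (@double_series_cvg _ (fun i j => sin ((i + j)%:R * theta)) (fun k => sin (k%:R * theta))).
      by move=> i j; rewrite ler_norml sin_geN1 sin_le1.
    move=> k; rewrite -sum_binom mulr_suml; apply: eq_bigr => i _.
    by rewrite subnKC// -ltnS.
  apply/funext => N.
  rewrite (expand (fun i j => sin ((i + j)%:R * theta)) _ (fun i j => p i * q j + q i * p j)).
    rewrite /bil -big_split/=; apply: eq_bigr => i _; rewrite -big_split/=.
    by apply: eq_bigr => j _; rewrite mulrDl.
  by move=> i j; rewrite natrD mulrDl sinD /p /q; ring.
have c3 : (bil N p p + bil N q q) @[N --> \oo] -->
    Ser (fun k => x k * cos theta ^+ k) rho.
  rewrite (_ : (fun N => _) = (fun N => \sum_(i < N) \sum_(j < N)
    (rho / 2) ^+ (i + j) / (i`!%:R * j`!%:R) * cos ((i%:R - j%:R) * theta) * m (i + j)%N)).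
    apply: (@double_series_cvg _ (fun i j => cos ((i%:R - j%:R) * theta)) (fun k => cos theta ^+ k)).
      by move=> i j; rewrite ler_norml cos_geN1 cos_le1.
    move=> k; have := sum_binom_cos k theta 0; rewrite cos0 mulr1 => <-.
    apply: eq_bigr => i _; rewrite addr0 natrB -1?ltnS//.
    by congr (_ * cos (_ * _)); ring.
  apply/funext => N.
  rewrite (expand (fun i j => cos ((i%:R - j%:R) * theta)) _ (fun i j => p i * p j + q i * q j)).
    rewrite /bil -big_split/=; apply: eq_bigr => i _; rewrite -big_split/=.
    by apply: eq_bigr => j _; rewrite mulrDl.
  by move=> i j; rewrite mulrBl cosB /p /q; ring.
have -> : Ser x (rho * cos theta) = Ser (fun k => x k * cos theta ^+ k) rho.
  rewrite /Ser; congr (limn _); apply/funext => n; rewrite /pseries /series/=.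
  by apply: eq_bigr => i _; rewrite exprMn; ring.
have l1 : ((bil N p p - bil N q q) * (bil N p p - bil N q q) +
   (bil N p q + bil N q p) * (bil N p q + bil N q p)) @[N --> \oo] --> normsq theta rho.
  by rewrite /normsq !expr2; apply: cvgD; apply: cvgM.
have l2 : ((bil N p p + bil N q q) * (bil N p p + bil N q q)) @[N --> \oo] -->
    Ser (fun k => x k * cos theta ^+ k) rho ^+ 2.
  by rewrite expr2; apply: cvgM.
apply: (ler_cvg_to l1 l2); near=> N => /=.
have := bil_cauchy_schwarz N p q; rewrite (bilC N q p) !expr2; nra.
Unshelve. all: by end_near.
Qed.

(** The logarithm of [normsq_le]; at angle 0 the polynomial is Q itself. *)
Lemma expo_le theta rho : (expo_poly theta).[rho] <= (expo_poly 0).[rho * cos theta].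
Proof.
have := normsq_le theta rho.
have -> : Ser x (rho * cos theta) ^+ 2 = normsq 0 (rho * cos theta).
  rewrite /normsq (_ : (fun k => x k * sin _) = fun=> 0); last first.
    by apply/funext => k; rewrite mulr0 sin0 mulr0.
  rewrite Ser0 expr0n addr0; congr (Ser _ _ ^+ 2); apply/funext => k.
  by rewrite mulr0 cos0 mulr1.
by rewrite !normsqE ler_expR ler_pM2l.
Qed.

(** Up to the factor d + 1, this is the leading coefficient in rho of Q(Re z) - Re Q(z), which is
    nonnegative for all rho >= 0. *)
Lemma lead_alpha_ge0 d theta : (0 < d)%N -> (d < K)%N ->
  (forall j, (d < j)%N -> (j < K)%N -> alpha j = 0) ->
  0 <= alpha d * (cos theta ^+ d.+1 - cos (d.+1%:R * theta)).
Proof.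
move=> d0 dK alpha0.
(* The term of index [j] in Q has degree j + 1 and [j] starts at 1, so [c] is 0 at 0 and at 1. *)
pose c j := if j is l.+1 then
  if (0 < l)%N then alpha l / l.+1%:R * (cos theta ^+ l.+1 - cos (l.+1%:R * theta)) else 0
  else 0.
suff : 0 <= c d.+1.
  by rewrite /c d0 mulrAC pmulr_lge0 ?invr_gt0 ?ltr0n.
apply: leading_coef_ge0 => rho rho0.
have := expo_le theta rho; rewrite -subr_ge0; congr (_ <= _).
rewrite /expo_poly !horner_sum -sumrB -(big_mkord xpredT (fun i => c i * rho ^+ i)).
rewrite [RHS]big_ltn// mul0r add0r [RHS]big_ltn// mul0r add0r [RHS]big_add1/=.
rewrite (big_cat_nat (n := d.+1))//=.
rewrite [X in _ + X]big_nat_cond [X in _ + X]big1 ?addr0; last first.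
  move=> j /andP[/andP[dj jK] _]; rewrite alpha0// !mul0r !scale0r !horner0 subrr//.
apply: eq_big_nat => j /andP[j0 jd].
rewrite !hornerZ !hornerXn /c j0 mulr0 cos0 mulr1 exprMn; ring.
Qed.

Lemma cos_lt1 (t : R) : 0 < t -> t < pi -> `|cos t| < 1.
Proof.
move=> t0 tpi; have e := cos2Dsin2 t.
have s0 : 0 < sin t by apply: sin_gt0_pi; rewrite t0.
rewrite -(@ltr_pXn2r _ 2)// ?nnegrE// real_normK ?num_real// expr1n.
by rewrite -e ltrDl exprn_gt0.
Qed.

(** Descending induction on the index. For index i, the two angles chosen make cos((i + 1) theta)
    equal to 1 and to -1 while |cos theta| < 1, which forces both signs. At i = 1 the first angle
    would be pi, where the difference vanishes: the quadratic term survives. *)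
Theorem marcinkiewicz_vanish j : (2 <= j)%N -> (j < K)%N -> alpha j = 0.
Proof.
suff h e : forall i, (K <= i + e)%N -> (2 <= i)%N -> (i < K)%N -> alpha i = 0.
  by move=> j2 jK; apply: (h K j) => //; exact: leq_addl.
elim: e => [i Ki _ iK|e IH i Kie i2 iK]; first by move: Ki; rewrite addn0 leqNgt iK.
have top k : (i < k)%N -> (k < K)%N -> alpha k = 0.
  by move=> ik kK; apply: IH => //; lia.
have d0 : (0 < i)%N by lia.
have lead := fun th => lead_alpha_ge0 th d0 iK top.
have i10 : (0 : R) < i.+1%:R by rewrite ltr0n.
have i1n : i.+1%:R != 0 :> R by rewrite gt_eqF.
have i3 : (3 : R) <= i.+1%:R by rewrite ler_nat.
have pi0 := pi_gt0 R.
apply/eqP; rewrite eq_le; apply/andP; split.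
- have := lead (pi *+ 2 / i.+1%:R).
  rewrite [_ * (_ / _)]mulrC divfK// cos2pi.
  have cl : `|cos (pi *+ 2 / i.+1%:R)| < 1 :> R.
    apply: cos_lt1; first by rewrite divr_gt0// mulrn_wgt0.
    by rewrite ltr_pdivrMr// -mulr_natl; nra.
  have : cos (pi *+ 2 / i.+1%:R) ^+ i.+1 < 1 :> R.
    by apply: le_lt_trans (ler_norm _) _; rewrite normrX exprn_ilt1.
  nra.
- have := lead (pi / i.+1%:R).
  rewrite [_ * (_ / _)]mulrC divfK// cospi.
  have cl : `|cos (pi / i.+1%:R)| < 1 :> R.
    apply: cos_lt1; first by rewrite divr_gt0.
    by rewrite ltr_pdivrMr//; nra.
  have : - 1 < cos (pi / i.+1%:R) ^+ i.+1 :> R.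
    rewrite ltrNl; apply: le_lt_trans (ler_norm _) _.
    by rewrite normrN normrX exprn_ilt1.
  nra.
Qed.

End marcinkiewicz.

(** * Limits of approximately recursive moments *)

Lemma ultra_fmap (T U : Type) (f : T -> U) (G : set_system T) :
  UltraFilter G -> UltraFilter (f @ G).
Proof.
move=> uG; apply: Build_UltraFilter => H pH FH; apply/seteqP; split => // A HA.
have [//|GnA] := in_ultra_setVsetC (f @^-1` A) uG.
have : H (~` A) by apply: FH.
by move=> HnA; have := filter_ex (filterI HA HnA) => -[x []].
Qed.

Lemma ultra_bounded_cvg {R : realType} (G : set_system nat) (u : nat -> R) (B : R) :
  UltraFilter G -> (\forall n \near G, `|u n| <= B) -> exists l : R, u n @[n --> G] --> l.
Proof.
move=> uG uB; have := @segment_compact R (- B) B; rewrite compact_ultra.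
move=> /(_ (u @ G) (ultra_fmap _ uG)) [|l [_ ul]]; last by exists l.
by apply: filterS uB => n; rewrite ler_norml /= in_itv.
Qed.

(** Ultrafilters replace the extraction of subsequences: if [u] leaves a neighbourhood of [l]
    infinitely often, the trace of [\oo] on those indices extends to an ultrafilter along which [u]
    stays outside. *)
Lemma cvg_along_ultra {R : realType} (u : nat -> R) (l : R) :
  (forall G : set_system nat, UltraFilter G -> \oo `<=` G -> u n @[n --> G] --> l) ->
  u n @[n --> \oo] --> l.
Proof.
move=> h; apply: contrapT => nul.
have [A [Al nA]] : exists A, nbhs l A /\ ~ \oo (u @^-1` A).
  apply: contrapT => hA; apply: nul => A Al; apply: contrapT => nA; apply: hA.
  by exists A.
pose F := within (u @^-1` (~` A)) \oo.
have pF : ProperFilter F.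
  apply: Build_ProperFilter_ex => S FS; apply: contrapT => nS; apply: nA.
  rewrite /F /within /= in FS; apply: filterS FS => n FS; apply: contrapT => nAn.
  by apply: nS; exists n; exact: FS.
have [G [uG FG]] := ultraFilterLemma pF.
have oG : \oo `<=` G.
  by move=> S oS; apply: FG; apply: filterS oS => n Sn _.
have GA : G (u @^-1` A) by exact: (h G uG oG A Al).
have GnA : G (u @^-1` (~` A)) by apply: FG; exact: withinT.
by have [x [/= Ax]] := filter_ex (filterI GA GnA); apply.
Qed.

Lemma cvg_bigsum {R : realType} (T : Type) (G : set_system T) (FG : Filter G)
  (I : eqType) (s : seq I) (f : I -> T -> R) (l : I -> R) :
  (forall i, i \in s -> f i x @[x --> G] --> l i) ->
  (\sum_(i <- s) f i x) @[x --> G] --> \sum_(i <- s) l i.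
Proof.
elim: s => [_|i s IH h].
  rewrite big_nil; under eq_fun do rewrite big_nil; exact: cvg_cst.
rewrite big_cons; under eq_fun do rewrite big_cons.
apply: cvgD; first by apply: h; rewrite mem_head.
by apply: IH => j js; apply: h; rewrite inE js orbT.
Qed.

Fixpoint gauss_moment {R : realType} (k : nat) : R :=
  match k with
  | 0%N => 1
  | 1%N => 0
  | (k'.+1 as l).+1 => l%:R * gauss_moment k'
  end.

Lemma powR_inv_exp {R : realType} (x : R) j : 0 <= x -> (x `^ (j.+1%:R^-1)) ^+ j.+1 = x.
Proof.
by move=> x0; rewrite -powR_mulrn ?powR_ge0// -powRrM mulVf ?pnatr_eq0 ?powRr1//.
Qed.

Section moment_limit.
Context {R : realType}.
Variables (mom a : nat -> nat -> R) (eps : nat -> R) (K : nat).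
Hypothesis K2 : (2 <= K)%N.
Hypotheses (mom0 : forall n, mom n 0%N = 1) (mom1 : forall n, mom n 1%N = 0).
Hypothesis mom2 : forall n, mom n 2%N = 1.
Hypothesis hankel : forall n N (p : nat -> R),
  0 <= \sum_(i < N) \sum_(j < N) p i * p j * mom n (i + j)%N.
Hypotheses (eps0 : forall n, 0 <= eps n) (epsc : eps n @[n --> \oo] --> (0 : R)).
Hypothesis recur : forall k, exists C, \forall n \near \oo,
  `|mom n k.+1 - \sum_(1 <= j < K) a n j * (k ^_ j)%:R * mom n (k - j)%N|
    <= C * eps n * (1 + mom n (2 * uphalf k)%N).

(** When V is divided by M, [a n j] is divided by [M n ^+ j.+1], so the roots of order [j.+1] are
    homogeneous of degree 1. The sum starts at 2 because the unit variance already fixes the limit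
    of [a n 1]. *)
Let M n := 1 + \sum_(2 <= j < K) `|a n j| `^ (j.+1%:R^-1).
Let u n k := mom n k / M n ^+ k.
Let a' n j := a n j / M n ^+ j.+1.

Let M1 n : 1 <= M n.
Proof. by rewrite lerDl; apply: sumr_ge0 => j _; exact: powR_ge0. Qed.

Let M0 n : 0 < M n. Proof. exact: lt_le_trans (M1 n). Qed.

Let Mk0 n k : 0 < M n ^+ k. Proof. by rewrite exprn_gt0. Qed.

Lemma powR_normalized n j : `|a' n j| `^ (j.+1%:R^-1) = `|a n j| `^ (j.+1%:R^-1) / M n.
Proof.
rewrite /a' normrM normfV [`|M n ^+ _|]ger0_norm ?(ltW (Mk0 _ _))//.
rewrite powRM ?invr_ge0 ?(ltW (Mk0 _ _))//; congr (_ * _).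
rewrite -powR_mulrn ?(ltW (M0 _))// -powRN -powRrM mulNr mulfV ?pnatr_eq0//.
by rewrite powR_inv1 ?(ltW (M0 _)).
Qed.

Lemma normalized_le1 n j : (2 <= j)%N -> (j < K)%N -> `|a' n j| <= 1.
Proof.
move=> j2 jK; rewrite /a' normrM normfV [`|M n ^+ _|]ger0_norm ?(ltW (Mk0 _ _))//.
rewrite ler_pdivrMr// mul1r -[leLHS](powR_inv_exp j)//.
rewrite lerXn2r ?nnegrE ?powR_ge0 ?(ltW (M0 _))//.
rewrite /M (bigD1_seq j) ?mem_index_iota ?j2 ?iota_uniq//=.
rewrite addrCA lerDl addr_ge0// sumr_ge0// => i _; exact: powR_ge0.
Qed.

Lemma hankel_u n N (p : nat -> R) :
  0 <= \sum_(i < N) \sum_(j < N) p i * p j * u n (i + j)%N.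
Proof.
have := hankel n N (fun i => p i / M n ^+ i); congr (_ <= _).
apply: eq_bigr => i _; apply: eq_bigr => j _; rewrite /u exprD invfM; ring.
Qed.

Lemma even_ge0 n k : 0 <= u n (k + k)%N.
Proof.
have := hankel_u n k.+1 (fun i => (i == k)%:R); congr (_ <= _).
rewrite big_ord_recr/= big1 ?add0r.
  rewrite big_ord_recr/= big1 ?add0r ?eqxx ?mul1r// => i _.
  by rewrite ltn_eqF// mulr0 mul0r.
by move=> i _; rewrite big1// => j _; rewrite ltn_eqF// !mul0r.
Qed.

(** Hankel positivity for the polynomials x^k + s x^(k+1) with s = 1 and s = -1. *)
Lemma odd_le n k : `|u n (k + k.+1)%N| <= u n (k + k)%N + u n (k.+1 + k.+1)%N.
Proof.
have pos (s : R) : 0 <= u n (k + k)%N + 2 * s * u n (k + k.+1)%N + s ^+ 2 * u n (k.+1 + k.+1)%N.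
  pose p i : R := (i == k)%:R + s * (i == k.+1)%:R.
  have p0 i : (i < k)%N -> p i = 0.
    by move=> ik; rewrite /p ltn_eqF// ltn_eqF ?mulr0 ?addr0// ltnW.
  have pk : p k = 1 by rewrite /p eqxx ltn_eqF// mulr0 addr0.
  have pk1 : p k.+1 = s by rewrite /p eqxx gtn_eqF// mulr1 add0r.
  have E (F : nat -> R) : (forall i, (i < k)%N -> F i = 0) -> \sum_(i < k.+2) F i = F k + F k.+1.
    by move=> F0; rewrite !big_ord_recr/= big1 ?add0r// => i _; exact: F0.
  have := hankel_u n k.+2 p; congr (_ <= _).
  rewrite (E (fun i => \sum_(j < k.+2) p i * p j * u n (i + j)%N)); last first.
    by move=> i ik; rewrite big1// => j _; rewrite p0// !mul0r.
  rewrite (E (fun j => p k * p j * u n (k + j)%N)); last first.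
    by move=> i ik; rewrite (p0 i ik) mulr0 mul0r.
  rewrite (E (fun j => p k.+1 * p j * u n (k.+1 + j)%N)); last first.
    by move=> i ik; rewrite (p0 i ik) mulr0 mul0r.
  by rewrite pk pk1 (addSnnS k k); ring.
have := pos 1; have := pos (- 1).
have := even_ge0 n k; have := even_ge0 n k.+1.
rewrite ler_norml !expr2 => ? ? ? ?; apply/andP; split; lra.
Qed.

Lemma recur_u q : exists C, 0 <= C /\ \forall n \near \oo,
  `|u n q.+1 - \sum_(1 <= j < K) a' n j * (q ^_ j)%:R * u n (q - j)%N|
    <= C * eps n * (1 + u n (uphalf q + uphalf q)%N).
Proof.
have [C hC] := recur q; exists `|C|; split => //.
apply: filterS hC => n hn.
have -> : u n q.+1 - \sum_(1 <= j < K) a' n j * (q ^_ j)%:R * u n (q - j)%N =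
  (mom n q.+1 - \sum_(1 <= j < K) a n j * (q ^_ j)%:R * mom n (q - j)%N) / M n ^+ q.+1.
  rewrite mulrBl mulr_suml; congr (_ - _); apply: eq_bigr => j _.
  have [jq|qj] := leqP j q; last by rewrite ffact_small// !(mulr0, mul0r).
  rewrite /a' /u; have -> : q.+1 = (j.+1 + (q - j))%N by lia.
  rewrite exprD; have h1 := gt_eqF (Mk0 n j.+1); have h2 := gt_eqF (Mk0 n (q - j)).
  by field; rewrite h1 h2.
rewrite normrM normfV [`|M n ^+ _|]ger0_norm ?(ltW (Mk0 _ _))//.
rewrite ler_pdivrMr//; apply: le_trans hn _.
set h := uphalf q; have hq : (h + h <= q.+1)%N by rewrite /h; lia.
have mu : mom n (h + h)%N = u n (h + h)%N * M n ^+ (h + h).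
  by rewrite /u divfK// gt_eqF.
have u0 := even_ge0 n h.
(* As [M n] is at least 1, both exponents may be raised to [q.+1]. *)
have key : 1 + mom n (h + h)%N <= (1 + u n (h + h)%N) * M n ^+ q.+1.
  rewrite mulrDl mul1r; apply: lerD; first exact: exprn_ege1.
  by rewrite mu ler_wpM2l// ler_weXn2l.
rewrite mul2n -addnn.
apply: le_trans (ler_norm _) _; rewrite !normrM -!mulrA ler_wpM2l//.
rewrite [`|eps n|]ger0_norm// ler_wpM2l// ger0_norm// addr_ge0// mu.
by rewrite mulr_ge0// ltW.
Qed.

(** At k = 1 only the term j = 1 of the recursion is nonzero, and the moments of orders 0 and 2 are
    1. *)
Lemma a1_cvg : a n 1%N @[n --> \oo] --> (1 : R).
Proof.
have [C hC] := recur 1.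
apply/cvgrPdist_le => e e0.
have Ce : (C * eps n * 2) @[n --> \oo] --> (C * 0 * 2 : R).
  by apply: cvgM; [apply: cvgZr|exact: cvg_cst].
have := Ce; rewrite mulr0 mul0r => /cvgr0_norm_le/(_ e e0) small.
near=> n.
have : `|mom n 2 - \sum_(1 <= j < K) a n j * (1 ^_ j)%:R * mom n (1 - j)%N|
    <= C * eps n * (1 + mom n (2 * uphalf 1)%N) by near: n.
rewrite big_ltn// ffactn1 mulr1 subnn mom0 mulr1 muln1 mom2 big_nat_cond big1.
  rewrite addr0 => /le_trans; apply.
  by apply: le_trans (ler_norm _) _; near: n.
by move=> j /andP[/andP[j1 _] _]; rewrite ffact_small// mulr0 mul0r.
Unshelve. all: by end_near.
Qed.

Lemma normalized_le2 : \forall n \near \oo, forall j, (0 < j)%N -> (j < K)%N -> `|a' n j| <= 2.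
Proof.
have := a1_cvg => /cvgr_dist_le/(_ 1 ltr01); apply: filterS => n h j j0 jK.
have [j2|j1] := ltnP 1 j; first by rewrite (le_trans (normalized_le1 _ _ _))// ler1n.
have -> : j = 1%N by lia.
rewrite /a' normrM normfV [`|M n ^+ _|]ger0_norm ?(ltW (Mk0 _ _))//.
rewrite ler_pdivrMr// (@le_trans _ _ 2)// ?ler_peMr ?exprn_ege1//.
by rewrite -[a n 1%N](subKr 1) (le_trans (ler_normB _ _))// normr1 -[leRHS]/(1 + 1) lerD2l.
Qed.

(** The recursion for the moment of order 2 k + 2 involves moments of order at most 2 k, already
    bounded, and an error containing that same moment; for large [n] its factor is at most 1/2 and
    it is absorbed. The odd order in between follows from [odd_le]. *)
Lemma u_bounded_even k : exists B, \forall n \near \oo, forall i, (i <= k + k)%N -> `|u n i| <= B.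
Proof.
elim: k => [|k [B hB]].
  exists 1; apply: nearW => n i; rewrite leqn0 => /eqP ->.
  by rewrite /u mom0 expr0 divr1 normr1.
have [C [C0 hC]] := recur_u (k + k.+1).
pose S := \sum_(1 <= j < K) 2 * ((k + k.+1) ^_ j)%:R * `|B|.
have S0 : 0 <= S by apply: sumr_ge0 => j _; rewrite !mulr_ge0.
have Ce : (C * eps n) @[n --> \oo] --> (C * 0 : R) by apply: cvgZr.
have half0 : 0 < (2^-1 : R) by rewrite invr_gt0.
have := Ce; rewrite mulr0 => /cvgr0_norm_le/(_ _ half0) small.
exists (`|B| + (2 * S + 1)).
have h2 := normalized_le2.
near=> n => i ik.
have hBn : forall i, (i <= k + k)%N -> `|u n i| <= B by near: n.
have U2 : u n (k.+1 + k.+1)%N <= 2 * S + 1.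
  have hCn : `|u n (k + k.+1).+1 - \sum_(1 <= j < K) a' n j * ((k + k.+1) ^_ j)%:R *
     u n (k + k.+1 - j)%N| <= C * eps n * (1 + u n (uphalf (k + k.+1) + uphalf (k + k.+1))%N).
    by near: n.
  have uh : uphalf (k + k.+1) = k.+1 by lia.
  rewrite uh -addSn in hCn.
  have sm : C * eps n <= 2^-1 by apply: le_trans (ler_norm _) _; near: n.
  have bound : `|\sum_(1 <= j < K) a' n j * ((k + k.+1) ^_ j)%:R * u n (k + k.+1 - j)%N| <= S.
    apply: le_trans (ler_norm_sum _ _ _) _; rewrite [leLHS]big_nat [leRHS]big_nat.
    apply: ler_sum => j /andP[j0 jK].
    rewrite normrM [`|a' n j * _|]normrM normr_nat.
    apply: ler_pM; rewrite ?mulr_ge0//.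
      rewrite ler_wpM2r//.
      have h2n : forall j, (0 < j)%N -> (j < K)%N -> `|a' n j| <= 2 by near: n.
      exact: (h2n j).
    by apply: le_trans (hBn _ _) (ler_norm B); lia.
  have e0 := even_ge0 n k.+1.
  have : C * eps n * (1 + u n (k.+1 + k.+1)%N) <= 2^-1 * (1 + u n (k.+1 + k.+1)%N).
    by rewrite ler_wpM2r// addr_ge0.
  move: hCn bound; rewrite !ler_norml => /andP[_ h1] /andP[_ h3] h4; lra.
have [ik2|ik2] := leqP i (k + k).
  by rewrite (le_trans (hBn _ ik2))// (le_trans (ler_norm B))// lerDl; lra.
have e0 := even_ge0 n k.+1.
have [->|ine] := eqVneq i (k.+1 + k.+1)%N.
  by rewrite ger0_norm// (le_trans U2)// lerDr.
have -> : i = (k + k.+1)%N by lia.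
apply: le_trans (odd_le n k) _; apply: lerD => //.
apply: le_trans (ler_norm _) _; apply: le_trans (ler_norm B).
exact: hBn.
Unshelve. all: by end_near.
Qed.

Lemma u_bounded k : exists B, \forall n \near \oo, `|u n k| <= B.
Proof.
have [B hB] := u_bounded_even k; exists B; apply: filterS hB => n; apply.
exact: leq_addr.
Qed.

Lemma moment_cvg_ultra (G : set_system nat) : UltraFilter G -> \oo `<=` G ->
  forall k, mom n k @[n --> G] --> (gauss_moment k : R).
Proof.
move=> uG oG; have FG : ProperFilter G by exact: ultra_proper.
have cvg_le0 (D b : nat -> R) (l : R) : (\forall n \near G, `|D n| <= b n) ->
    D n @[n --> G] --> l -> b n @[n --> G] --> (0 : R) -> l = 0.
  move=> Db Dl b0; apply/eqP; rewrite -normr_le0.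
  by apply: (ler_cvg_to (cvg_norm Dl) b0).
have cvg_pow (D : nat -> R) (l : R) k : D n @[n --> G] --> l -> D n ^+ k @[n --> G] --> l ^+ k.
  move=> Dl; elim: k => [|k IH]; first exact: cvg_cst.
  by under eq_fun do rewrite exprS; rewrite exprS; apply: cvgM.
have /choice[m um] : forall k, exists l : R, u n k @[n --> G] --> l.
  by move=> k; have [B hB] := u_bounded k; apply: (ultra_bounded_cvg (B := B)); exact: oG.
(* Extended by 0 outside the range, so that every index has a limit along [G]. *)
pose a'' n j := if (0 < j < K)%N then a' n j else 0.
have /choice[al aal] : forall j, exists l : R, a'' n j @[n --> G] --> l.
  move=> j; apply: (@ultra_bounded_cvg _ G _ 2 uG); apply: oG.
  apply: filterS normalized_le2 => n h; rewrite /a''.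
  by case: ifP => [/andP[]|_]; [exact: h|rewrite normr0].
have [t Mt] : exists t : R, (M n)^-1 @[n --> G] --> t.
  apply: (@ultra_bounded_cvg _ G _ 1 uG); apply: filterE => n.
  by rewrite ger0_norm ?invr_ge0 ?(ltW (M0 _))// invf_le1.
have Geps : eps n @[n --> G] --> (0 : R) by move=> A /epsc; exact: oG.
have m0 : m 0%N = 1.
  have : u n 0%N @[n --> G] --> (1 : R).
    by apply: cvg_near_cst; apply: filterE => n; rewrite /u mom0 expr0 divr1.
  by move=> h; apply: (cvg_unique _ (um 0%N) h).
have mS k : m k.+1 = \sum_(1 <= j < K) al j * (k ^_ j)%:R * m (k - j)%N.
  have [C [C0 hC]] := recur_u k.
  apply/eqP; rewrite -subr_eq0; apply/eqP.
  apply: (cvg_le0 (fun n => u n k.+1 - \sum_(1 <= j < K) a'' n j * (k ^_ j)%:R * u n (k - j)%N)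
    (fun n => C * eps n * (1 + u n (uphalf k + uphalf k)%N))).
  - apply: oG; apply: filterS hC => n; congr (`|_ - _| <= _).
    by apply: eq_big_nat => j /andP[j1 jK]; rewrite /a'' j1 jK.
  - apply: cvgB => //; apply: cvg_bigsum => j _.
    by apply: cvgM => //; apply: cvgM => //; exact: cvg_cst.
  - rewrite -(mul0r (1 + m (uphalf k + uphalf k)%N)) -[X in X * _](mulr0 C).
    by apply: cvgM; [apply: cvgZr|apply: cvgD => //; exact: cvg_cst].
have hm N (p : nat -> R) : 0 <= \sum_(i < N) \sum_(j < N) p i * p j * m (i + j)%N.
  have c0 : (0 : R) @[n --> G] --> (0 : R) by exact: cvg_cst.
  have c1 : (\sum_(i < N) \sum_(j < N) p i * p j * u n (i + j)%N) @[n --> G] -->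
      \sum_(i < N) \sum_(j < N) p i * p j * m (i + j)%N.
    by apply: cvg_bigsum => i _; apply: cvg_bigsum => j _; apply: cvgZr.
  by apply: (ler_cvg_to c0 c1); near=> n; exact: hankel_u.
have al0 := marcinkiewicz_vanish m0 hm mS.
have t1 : t = 1.
  have roots j : (1 < j < K)%N -> `|a'' n j| `^ (j.+1%:R^-1) @[n --> G] --> (0 : R).
    move=> /andP[j2 jK]; apply/cvgrPdist_le => e e0.
    have := aal j; rewrite al0// => /cvgr0_norm_le/(_ (e ^+ j.+1)).
    rewrite exprn_gt0// => /(_ isT); apply: filterS => n h.
    rewrite sub0r normrN ger0_norm ?powR_ge0// -(@ler_pXn2r _ j.+1) ?nnegrE ?powR_ge0 ?(ltW e0)//.
    by rewrite powR_inv_exp.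
  have sum1 : ((M n)^-1 + \sum_(2 <= j < K) `|a'' n j| `^ (j.+1%:R^-1)) @[n --> G] --> (t + 0 : R).
    rewrite (_ : t + 0 = t + \sum_(2 <= j < K) 0); last by rewrite big1.
    apply: cvgD => //; apply: cvg_bigsum => j; by rewrite mem_index_iota => /roots.
  have : (fun n => (M n)^-1 + \sum_(2 <= j < K) `|a'' n j| `^ (j.+1%:R^-1)) = (fun=> 1).
    apply/funext => n.
    rewrite (@eq_big_nat _ _ _ 2 K _ (fun j => `|a n j| `^ (j.+1%:R^-1) / M n)).
      by rewrite -mulr_suml -[X in X + _ = _]mul1r -mulrDl -/(M n) mulfV// gt_eqF//; exact: M0.
    by move=> j /andP[j2 jK]; rewrite /a'' jK andbT (ltnW j2) powR_normalized.
  move=> e; rewrite e addr0 in sum1.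
  have c1 : (fun=> 1 : R) n @[n --> G] --> (1 : R) by exact: cvg_cst.
  exact: (cvg_unique _ sum1 c1).
have al1 : al 1%N = 1.
  have : a n 1%N * (M n)^-1 ^+ 2 @[n --> G] --> (1 * t ^+ 2 : R).
    by apply: cvgM; [move=> A /a1_cvg; exact: oG|exact: cvg_pow].
  rewrite t1 expr1n mulr1 => h.
  have e : (fun n => a n 1%N * (M n)^-1 ^+ 2) = (fun n => a'' n 1%N).
    by apply/funext => n; rewrite /a'' K2 exprVn.
  by rewrite e in h; exact: (cvg_unique _ (aal 1%N) h).
(* With [al 1 = 1] and the later coefficients 0, each moment is determined by the one two orders
   below. *)
have mg k : m k = gauss_moment k /\ m k.+1 = gauss_moment k.+1.
  elim: k => [|k [IH1 IH2]].
    split => //; have : u n 1%N @[n --> G] --> (0 : R).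
      by apply: cvg_near_cst; apply: filterE => n; rewrite /u mom1 mul0r.
    by move=> h; apply: (cvg_unique _ (um 1%N) h).
  split => //; rewrite mS big_ltn// al1 mul1r ffactn1 subSS subn0 IH1.
  rewrite big_nat_cond big1 ?addr0// => j /andP[/andP[j2 jK] _].
  by rewrite al0// !mul0r.
have Mc : M n @[n --> G] --> (1 : R).
  rewrite -[X in _ --> X]invr1 -t1; under eq_fun do rewrite -[M _]invrK.
  by apply: cvgV => //; rewrite t1 oner_eq0.
move=> k.
have h : u n k * M n ^+ k @[n --> G] --> m k * 1 ^+ k.
  by apply: cvgM => //; exact: cvg_pow.
have e : (fun n => u n k * M n ^+ k) = (fun n => mom n k).
  by apply/funext => n; rewrite /u divfK// gt_eqF.
by rewrite e expr1n mulr1 (mg k).1 in h.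
Unshelve. all: by end_near.
Qed.

Lemma moment_cvg k : mom n k @[n --> \oo] --> (gauss_moment k : R).
Proof. by apply: cvg_along_ultra => G uG oG; exact: moment_cvg_ultra. Qed.

End moment_limit.

(** * Gaussian moments *)

Section density.
Import HBNNSimple.
Context {R : realType}.
Local Notation mu := (@lebesgue_measure R).
Variable pdf : R -> R.
Hypotheses (mpdf : measurable_fun setT pdf) (pdf0 : forall x, 0 <= pdf x).
Variable P : {measure set (measurableTypeR R) -> \bar R}.
Hypothesis PE : forall A : set R, measurable A -> P A = (\int[mu]_(x in A) (pdf x)%:E)%E.
Local Open Scope ereal_scope.

Let integral_density_indic (E : set R) : measurable E ->
  \int[P]_x (\1_E x)%:E = \int[mu]_x ((\1_E x)%:E * (pdf x)%:E).
Proof.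
move=> mE; rewrite integral_indic//= setIT PE// integral_mkcond.
apply: eq_integral => x _; rewrite patchE indicE; case: (x \in E).
  by rewrite mul1e.
by rewrite mul0e.
Qed.

Let integral_density_nnsfun (f : {nnsfun (measurableTypeR R) >-> R}) :
  \int[P]_x (f x)%:E = \int[mu]_x ((f x)%:E * (pdf x)%:E).
Proof.
have mr r : measurable_fun setT (fun x => (r * \1_(f @^-1` [set r]) x)%:E).
  exact/measurable_EFinP/measurableT_comp.
have mi r : measurable_fun setT (fun x => (\1_(f @^-1` [set r]) x)%:E : \bar R).
  by apply/measurable_EFinP; exact: measurable_indic.
under [LHS]eq_integral do rewrite fimfunE -fsumEFin//.
rewrite [LHS]ge0_integral_fsum//; last first.
  by move=> n x _; rewrite EFinM nnfun_muleindic_ge0.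
under [RHS]eq_integral.
  move=> x xD; rewrite fimfunE -fsumEFin// muleC ge0_mule_fsumr; last first.
    by move=> r; rewrite EFinM nnfun_muleindic_ge0.
  over.
rewrite [RHS]ge0_integral_fsum//; last 2 first.
  - move=> r; apply: emeasurable_funM; first exact/measurable_EFinP.
    exact: mr.
  - move=> n x _; apply: mule_ge0; first by rewrite lee_fin.
    by rewrite EFinM; exact: nnfun_muleindic_ge0.
apply: eq_fsbigr => r _; rewrite integralZl_indic_nnsfun//= integral_density_indic//; last first.
  exact: (measurable_funPTI f (measurable_set1 r)).
have [r0|r0] := leP 0%R r.
  rewrite -ge0_integralZl//; last 2 first.
  - apply: emeasurable_funM; last exact/measurable_EFinP.
    exact: mi.
  - by move=> x _; rewrite mule_ge0// lee_fin.
  by apply: eq_integral => x _; rewrite EFinM [RHS]muleC muleA.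
have -> : f @^-1` [set r] = set0.
  rewrite -subset0 => x /= fx; have : (0 <= f x)%R by [].
  by rewrite fx leNgt r0.
rewrite [X in r%:E * X](_ : _ = 0) ?mule0; last first.
  by rewrite integral0_eq// => x _; rewrite indic0 mul0e.
by rewrite integral0_eq// => x _; rewrite indic0 mulr0 mule0.
Qed.

(** From simple functions by monotone convergence on both sides. *)
Lemma ge0_integral_density (f : measurableTypeR R -> \bar R) :
  measurable_fun setT f -> (forall x, 0 <= f x) ->
  \int[P]_x f x = \int[mu]_x (f x * (pdf x)%:E).
Proof.
move=> mf f0; pose f_ := nnsfun_approx measurableT mf.
have mfE n : measurable_fun setT (fun x => (f_ n x)%:E).
  exact/measurable_EFinP/measurable_funTS.
have mpE : measurable_fun setT (fun x => (pdf x)%:E) by exact/measurable_EFinP.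
transitivity (lim (\int[P]_x (f_ n x)%:E @[n --> \oo])).
  rewrite -monotone_convergence//=.
  - apply: eq_integral => ? /[!inE] xD; apply/esym/cvg_lim => //=.
    exact: cvg_nnsfun_approx.
  - by move=> n ? _; rewrite lee_fin.
  - move=> ? _ ? ? mn; rewrite lee_fin.
    by have /lefP := nd_nnsfun_approx measurableT mf mn; apply.
under eq_fun do rewrite integral_density_nnsfun.
rewrite -monotone_convergence//=.
- apply: eq_integral => x _; apply/cvg_lim => //=.
  apply: cvgeMr => //; exact: cvg_nnsfun_approx.
- move=> n; apply: emeasurable_funM; [exact: mfE|exact: mpE].
- by move=> n x _; rewrite mule_ge0// lee_fin.
- move=> x _ ? ? mn; apply: lee_wpmul2r; rewrite lee_fin//.
  by have /lefP := nd_nnsfun_approx measurableT mf mn; apply.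
Qed.

Lemma integral_density (f : measurableTypeR R -> R) : measurable_fun setT f ->
  \int[P]_x (f x)%:E = \int[mu]_x (f x * pdf x)%:E.
Proof.
move=> mf; have mE : measurable_fun setT (EFin \o f) by exact/measurable_EFinP.
rewrite integralE [RHS]integralE.
rewrite ge0_integral_density//; last exact: measurable_funepos.
rewrite ge0_integral_density//; last exact: measurable_funeneg.
congr (_ - _); apply: eq_integral => x _.
  by rewrite !funeposE /= -!EFin_max -EFinM maxr_pMl// mul0r.
by rewrite !funenegE /= -!EFin_max -EFinM maxr_pMl// mul0r mulNr.
Qed.

End density.

Section gaussian_moments.
Context {R : realType}.
Local Notation mu := (@lebesgue_measure R).
Local Notation phi := (@normal_pdf R 0 1).
Local Notation gam := (@normal_prob R 0 1).

(** The k-th power of y / k <= exp(y / k). *)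
Lemma pow_le_expR k (y : R) : 0 <= y -> y ^+ k <= k%:R ^+ k * expR y.
Proof.
case: k => [|k] y0; first by rewrite !expr0 mul1r -expR0 ler_expR.
have k0 : (0 : R) < k.+1%:R by rewrite ltr0n.
have h : y / k.+1%:R <= expR (y / k.+1%:R).
  by apply: le_trans (expR_ge1Dx _); rewrite lerDr.
have yk : 0 <= y / k.+1%:R by rewrite divr_ge0// ltW.
have := h; rewrite -(@ler_pXn2r _ k.+1) ?nnegrE ?expR_ge0//.
rewrite -expRM_natl [_ * (y / _)]mulrC divfK ?gt_eqF// expr_div_n ler_pdivrMr ?exprn_gt0//.
by rewrite mulrC.
Qed.

Lemma phiE (x : R) : phi x = normal_peak 1 * expR (- (x ^+ 2 / 2)).
Proof.
rewrite normal_pdfE ?oner_eq0// /normal_fun subr0 expr1n; congr (_ * expR _).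
by rewrite mulNr -mulr_natl mulr1.
Qed.

Lemma phi2E (x : R) : normal_pdf 0 2 x = normal_peak 2 * expR (- (x ^+ 2 / 8)).
Proof.
rewrite normal_pdfE ?pnatr_eq0// /normal_fun subr0; congr (_ * expR _).
by rewrite mulNr -mulr_natl -natrX -natrM.
Qed.

(** The wider normal density dominates because exp(-x^2/2) = exp(-3x^2/8) exp(-x^2/8) and the first
    factor absorbs the power. Integrability and decay at infinity both follow. *)
Lemma pow_phi_bound k : exists C : R, forall x : R, `|x ^+ k * phi x| <= C * normal_pdf 0 2 x.
Proof.
(* From [pow_le_expR] at 3 x^2 / 8, after bounding |x^k| by 1 + x^(2k). *)
pose c : R := 1 + (8 / 3) ^+ k * k%:R ^+ k.
exists (c * normal_peak 1 / normal_peak 2) => x.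
have p1 : 0 <= normal_peak (1 : R) by exact: normal_peak_ge0.
have p2 : 0 < normal_peak (2 : R) by apply: normal_peak_gt0; rewrite pnatr_eq0.
rewrite phiE phi2E.
rewrite [leRHS](_ : _ = normal_peak 1 * (c * expR (- (x ^+ 2 / 8)))); last first.
  by field; rewrite gt_eqF.
rewrite mulrCA normrM ger0_norm// ler_wpM2l// normrM [`|expR _|]ger0_norm ?expR_ge0//.
have -> : - (x ^+ 2 / 2) = - (3 / 8 * x ^+ 2) + - (x ^+ 2 / 8) by field.
rewrite expRD mulrA ler_wpM2r ?expR_ge0// expRN ler_pdivrMr ?expR_gt0//.
have y0 : 0 <= 3 / 8 * x ^+ 2 by rewrite mulr_ge0 ?sqr_ge0.
have e1 : 1 <= expR (3 / 8 * x ^+ 2) by rewrite -[leLHS]expR0 ler_expR.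
have := pow_le_expR k y0; set E := expR _ in e1 * => hk.
have xk : (x ^+ 2) ^+ k <= (8 / 3) ^+ k * k%:R ^+ k * E.
  rewrite -mulrA -ler_pdivrMl ?exprn_gt0//; apply: le_trans hk.
  by rewrite -exprVn -exprMn lerXn2r ?nnegrE// invf_div.
have : `|x ^+ k| <= 1 + (x ^+ 2) ^+ k.
  rewrite exprAC -(real_normK (num_real (x ^+ k))); set a := `|x ^+ k|.
  have : 0 <= (a - 1) ^+ 2 by exact: sqr_ge0.
  have : 0 <= a by exact: normr_ge0.
  rewrite !expr2; nra.
rewrite /c mulrDl mul1r; lra.
Qed.

Lemma measurable_pow_phi k : measurable_fun setT (fun x : R => x ^+ k * phi x).
Proof. by apply: measurable_funM => //; exact: measurable_normal_pdf. Qed.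

Lemma integrable_pow_phi k : mu.-integrable setT (EFin \o (fun x : R => x ^+ k * phi x)).
Proof.
have [C hC] := pow_phi_bound k.
have ig : mu.-integrable setT (EFin \o (fun x => C * normal_pdf 0 2 x)).
  rewrite (_ : EFin \o _ = (fun x => C%:E * (normal_pdf 0 2 x)%:E)%E)//.
  by apply: (integrableZl measurableT); exact: integrable_normal_pdf.
apply: (le_integrable measurableT _ _ ig).
- by apply/measurable_EFinP; exact: measurable_pow_phi.
- move=> x _ /=; rewrite lee_fin; apply: le_trans (hC x) _; exact: ler_norm.
Qed.

Definition pow_phi_int k : R := \int[mu]_x (x ^+ k * phi x).

Lemma is_derive_pow_phi k (x : R) :
  is_derive x 1 (fun x : R => x ^+ k * phi x) (k%:R * (x ^+ k.-1 * phi x) - x ^+ k.+1 * phi x).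
Proof.
pose p : {poly R} := (- 2^-1) *: 'X^2.
have phiF : phi = (fun y : R => normal_peak 1 * expR p.[y]).
  apply/funext => y; rewrite phiE /p hornerZ hornerXn; congr (_ * expR _).
  by field.
have de := is_derive1_comp (is_derive_expR _) (is_derive_poly p x).
have dX := is_derive_poly ('X^k : {poly R}) x.
rewrite derivXn hornerMn hornerXn -mulr_natl in dX.
have dM : is_derive x 1 (horner ('X^k : {poly R}) * (cst (normal_peak 1) * (expR \o horner p)))
   (x ^+ k * (normal_peak 1 * (expR p.[x] * p^`().[x])) +
     normal_peak 1 * expR p.[x] * (k%:R * x ^+ k.-1)).
  apply: is_derive_eq; rewrite /= !fctE /= /GRing.scale /= hornerXn; ring.
have -> : (fun x : R => x ^+ k * phi x) =
    horner ('X^k : {poly R}) * (cst (normal_peak 1) * (expR \o horner p)).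
  by apply/funext => y; rewrite phiF !fctE /= hornerXn.
apply: is_derive_eq dM _; rewrite phiF.
have -> : p^`().[x] = - x.
  by rewrite /p derivZ derivXn hornerZ hornerMn hornerXn expr1 -mulr_natl; field.
by rewrite exprS; ring.
Qed.

Lemma continuous_pow_phi k : continuous (fun x : R => x ^+ k * phi x).
Proof.
by move=> x; apply/differentiable_continuous/derivable1_diffP; have [] := is_derive_pow_phi k x.
Qed.

(** The bound for exponent k + 1 gains a factor 1 / (N + 1); [s] is 1 or -1 for the two ends of the
    line. *)
Lemma pow_phi_cvg0 k (s : R) : `|s| = 1 ->
  ((s * N.+1%:R) ^+ k * phi (s * N.+1%:R)) @[N --> \oo] --> (0 : R).
Proof.
move=> s1; have [C hC] := pow_phi_bound k.+1.
pose B := `|C| * normal_peak 2.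
apply/norm_cvg0P; apply: (@squeeze_cvgr _ _ _ _ (fun=> 0) (fun N : nat => B * N.+1%:R^-1)).
- apply: nearW => N; rewrite normr_ge0 /= ler_pdivlMr ?ltr0n//.
  set x := s * N.+1%:R.
  have <- : `|x| = N.+1%:R by rewrite normrM s1 mul1r normr_nat.
  rewrite mulrC -normrM mulrA -exprS; apply: le_trans (hC x) _.
  apply: le_trans (ler_norm _) _; rewrite normrM ler_wpM2l//.
  rewrite ger0_norm ?normal_pdf_ge0//; apply: normal_pdf_ub.
  by rewrite pnatr_eq0.
- exact: cvg_cst.
- rewrite -[X in _ --> X](mulr0 B); apply: cvgZr.
  exact: cvg_harmonic.
Qed.

(** Integration by parts: x^k phi has derivative k x^(k-1) phi - x^(k+1) phi and vanishes at
    infinity. *)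
Lemma pow_phi_rec k : pow_phi_int k.+1 = k%:R * pow_phi_int k.-1.
Proof.
pose g (x : R) := k%:R * (x ^+ k.-1 * phi x) - x ^+ k.+1 * phi x.
pose G (x : R) := x ^+ k * phi x.
have ikg : mu.-integrable setT (EFin \o (fun x => k%:R * (x ^+ k.-1 * phi x))).
  rewrite (_ : EFin \o _ = (fun x => k%:R%:E * (x ^+ k.-1 * phi x)%:E)%E)//.
  by apply: (integrableZl measurableT); exact: integrable_pow_phi.
have ig : mu.-integrable setT (EFin \o g).
  rewrite (_ : EFin \o g = (fun x => (k%:R * (x ^+ k.-1 * phi x))%:E - (x ^+ k.+1 * phi x)%:E)%E)//.
  by apply: (integrableB measurableT) => //; exact: integrable_pow_phi.
have mg : measurable_fun setT g.
  by case/integrableP : ig => /measurable_EFinP.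
have cg : continuous g.
  move=> x; apply: cvgB; last exact: continuous_pow_phi.
  by apply: cvgZr; exact: continuous_pow_phi.
have dG (x : R) : is_derive x 1 G (g x) by exact: is_derive_pow_phi.
pose I (N : nat) := (`[- N.+1%:R, N.+1%:R] : set R)%classic.
have ftc N : (\int[mu]_(x in I N) (g x)%:E = (G N.+1%:R)%:E - (G (- N.+1%:R))%:E)%E.
  apply: continuous_FTC2.
  - by rewrite (@lt_trans _ _ 0)// ?oppr_lt0 ltr0n.
  - exact: continuous_subspaceT.
  - split.
    + by move=> x _; have [] := dG x.
    + by apply: cvg_at_right_filter; exact: continuous_pow_phi.
    + by apply: cvg_at_left_filter; exact: continuous_pow_phi.
  - by move=> x _; rewrite derive1E; have [_ ->] := dG x.
have lim1 : (\int[mu]_x ((EFin \o g) \_ (I N)) x)%E @[N --> \oo] --> (\int[mu]_x (g x)%:E)%E.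
  have H := @dominated_cvg _ _ R mu setT measurableT (fun N => (EFin \o g) \_ (I N))
    (EFin \o g) (fun x => `|(g x)%:E|)%E.
  apply: H.
  - move=> N; apply/(measurable_restrictT _ _).1; first exact: measurable_itv.
    by apply: measurable_funTS; exact/measurable_EFinP.
  - move=> x _; apply: cvg_near_cst; near=> N; rewrite patchE ifT// inE /I /= in_itv/=.
    rewrite -ler_norml; apply: ltW; apply: lt_trans (truncnS_gt _) _.
    rewrite ltr_nat ltnS; near: N; exact: nbhs_infty_ge.
  - by move=> x _; rewrite abse_fin_num.
  - exact: integrable_abse.
  - by move=> N x _; rewrite patchE; case: ifPn => //; rewrite abse0 abse_ge0.
have lim2 : ((G N.+1%:R)%:E - (G (- N.+1%:R))%:E)%E @[N --> \oo] --> (0 : R)%:E.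
  have -> : (0 : R) = 0 - 0 by rewrite subr0.
  have h1 := @pow_phi_cvg0 k 1 (normr1 _).
  have h2 := @pow_phi_cvg0 k (- 1) (normrN1 _).
  have : (G N.+1%:R - G (- N.+1%:R)) @[N --> \oo] --> (0 - 0 : R).
    apply: cvgB.
      by move: h1; under eq_fun do rewrite mul1r.
    by move: h2; under eq_fun do rewrite mulN1r.
  by move=> h; apply: cvg_EFin; [exact: nearW|exact: h].
have int0 : (\int[mu]_x (g x)%:E)%E = 0%E.
  have e : (fun N => \int[mu]_x ((EFin \o g) \_ (I N)) x)%E =
      (fun N => (G N.+1%:R)%:E - (G (- N.+1%:R))%:E)%E.
    by apply/funext => N; rewrite -integral_mkcond ftc.
  by rewrite e in lim1; exact: (cvg_unique _ lim1 lim2).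
apply/eqP; rewrite eq_sym -subr_eq0; apply/eqP.
rewrite /pow_phi_int -RintegralZl//; last exact: integrable_pow_phi.
rewrite -RintegralB//; last exact: integrable_pow_phi.
by rewrite /Rintegral int0.
Unshelve. all: by end_near.
Qed.

Lemma pow_phi_intE k : pow_phi_int k = gauss_moment k.
Proof.
suff : pow_phi_int k = gauss_moment k /\ pow_phi_int k.+1 = gauss_moment k.+1 by case.
elim: k => [|k [IH1 IH2]]; split=> //.
- rewrite /pow_phi_int /=; under eq_Rintegral do rewrite expr0 mul1r.
  by rewrite /Rintegral integral_normal_pdf.
- by rewrite pow_phi_rec mul0r.
- by rewrite pow_phi_rec /= IH1.
Qed.

Let mphi : measurable_fun setT phi. Proof. exact: measurable_normal_pdf. Qed.
Let phi0 x : 0 <= phi x. Proof. exact: normal_pdf_ge0. Qed.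
Let gamE (A : set R) : measurable A -> gam A = (\int[mu]_(x in A) (phi x)%:E)%E.
Proof. by []. Qed.

Lemma integral_gauss_moment k : (\int[gam]_x (x ^+ k)%:E)%E = (gauss_moment k)%:E.
Proof.
have mk : measurable_fun setT (fun x : R => x ^+ k) by exact: measurable_funX.
rewrite (integral_density mphi phi0 gamE mk).
rewrite -pow_phi_intE /pow_phi_int /Rintegral fineK//.
by apply/integrable_fin_num => //; exact: integrable_pow_phi.
Qed.

Lemma integrable_gauss_pow k : (gam).-integrable setT (fun x => (x ^+ k)%:E).
Proof.
have mk : measurable_fun setT (fun x : R => x ^+ k) by exact: measurable_funX.
apply/integrableP; split; first exact/measurable_EFinP.
rewrite (ge0_integral_density mphi phi0 gamE); last 2 first.
- by apply: measurableT_comp => //; exact/measurable_EFinP.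
- by move=> x; exact: abse_ge0.
have /integrableP[_] := integrable_pow_phi k.
congr (_ < _)%E; apply: eq_integral => x _ /=.
by rewrite -EFinM normrM [`|phi x|]ger0_norm ?normal_pdf_ge0.
Qed.

End gaussian_moments.

(** * From moments to distribution functions *)

Section taylor.
Context {R : realType}.

(** For x > 0 the mean value theorem shows that x^(m+1)/(m+1)! - F is nonnegative; the rest follows
    by replacing F with -F and x with -x. *)
Lemma derive_bound_integrate (f g : R -> R) m :
  (forall x : R, is_derive x 1 f (g x)) -> f 0 = 0 ->
  (forall x, `|g x| <= `|x| ^+ m / m`!%:R) ->
  forall x, `|f x| <= `|x| ^+ m.+1 / m.+1`!%:R.
Proof.
move=> df f0 gm.
have pos (F G : R -> R) : (forall x : R, is_derive x 1 F (G x)) -> F 0 = 0 ->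
    (forall x, `|G x| <= `|x| ^+ m / m`!%:R) -> forall x, 0 < x ->
    F x <= x ^+ m.+1 / m.+1`!%:R.
  move=> dF F0 Gm x x0.
  pose p : {poly R} := m.+1`!%:R^-1 *: 'X^(m.+1).
  have dp (y : R) := is_derive_poly p y.
  have dH (y : R) : is_derive y 1 (horner p - F) (p^`().[y] - G y).
    exact: is_deriveB.
  have pE (y : R) : p^`().[y] = y ^+ m / m`!%:R.
    rewrite /p derivZ derivXn hornerZ hornerMn hornerXn /= factS natrM invfM.
    have h1 : m.+1%:R != 0 :> R by rewrite pnatr_eq0.
    have h2 : m`!%:R != 0 :> R by rewrite pnatr_eq0 -lt0n fact_gt0.
    by rewrite -[y ^+ m *+ _]mulr_natl mulrACA mulVf// mul1r mulrC.
  have cH : {within `[0, x], continuous (horner p - F)}.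
    apply: continuous_subspaceT => y; apply/differentiable_continuous/derivable1_diffP.
    by have [] := dH y.
  have [c] := MVT x0 (fun y _ => dH y) cH.
  rewrite in_itv/= => /andP[c0 cx]; rewrite !fctE /= F0 subr0 subr0.
  rewrite {1 2}/p !hornerZ !hornerXn expr0n mulr0 subr0 => e.
  rewrite -subr_ge0 [_ / _]mulrC e mulr_ge0 ?(ltW x0)// subr_ge0 pE.
  apply: le_trans (ler_norm _) _; apply: le_trans (Gm c) _.
  by rewrite gtr0_norm.
have posn (F G : R -> R) : (forall x : R, is_derive x 1 F (G x)) -> F 0 = 0 ->
    (forall x, `|G x| <= `|x| ^+ m / m`!%:R) -> forall x, 0 < x ->
    `|F x| <= x ^+ m.+1 / m.+1`!%:R.
  move=> dF F0 Gm x x0; rewrite ler_norml (pos F G)// andbT lerNl.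
  apply: (pos (- F) (- G)) => //.
  - by rewrite !fctE F0 oppr0.
  - by move=> y; rewrite !fctE normrN.
move=> x; have [x0|x0|->] := ltgtP x 0; last by rewrite f0 !normr0 expr0n mul0r.
- rewrite -[x in f x]opprK [`|x|]ltr0_norm//.
  have := posn (f \o -%R) (fun y => - g (- y)); apply => /=.
  + move=> y; have := is_derive1_comp (df (- y)) (is_deriveNid y 1).
    by rewrite mulrN1.
  + by rewrite oppr0.
  + by move=> y; rewrite normrN (le_trans (gm _))// normrN.
  + by rewrite oppr_gt0.
- by rewrite [`|x|]gtr0_norm//; exact: (posn f g).
Qed.

(** Both Taylor coefficient sequences are generated together from cos' = -sin and sin' = cos, so
    that differentiation exchanges the truncated polynomials up to sign. *)
Fixpoint trig_coefs (i : nat) : R * R :=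
  if i is j.+1 then (- (trig_coefs j).2 / j.+1%:R, (trig_coefs j).1 / j.+1%:R) else (1, 0).

Definition cos_poly m : {poly R} := \poly_(i < m) (trig_coefs i).1.
Definition sin_poly m : {poly R} := \poly_(i < m) (trig_coefs i).2.

Lemma deriv_cos_poly m : (cos_poly m.+1)^`() = - sin_poly m.
Proof.
apply/polyP => i; rewrite coef_deriv coefN !coef_poly ltnS.
case: ifP => im; last by rewrite mul0rn oppr0.
by rewrite /= -[LHS]mulr_natr divfK// pnatr_eq0.
Qed.

Lemma deriv_sin_poly m : (sin_poly m.+1)^`() = cos_poly m.
Proof.
apply/polyP => i; rewrite coef_deriv !coef_poly ltnS.
case: ifP => im; last by rewrite mul0rn.
by rewrite /= -[LHS]mulr_natr divfK// pnatr_eq0.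
Qed.

Lemma poly_at0 (E : nat -> R) m : (\poly_(i < m.+1) E i).[0] = E 0%N.
Proof. by rewrite horner_coef0 coef_poly. Qed.

Lemma trig_taylor m (x : R) :
  `|cos x - (cos_poly m).[x]| <= `|x| ^+ m / m`!%:R /\
  `|sin x - (sin_poly m).[x]| <= `|x| ^+ m / m`!%:R.
Proof.
elim: m x => [|m IH] x.
  rewrite /cos_poly /sin_poly !poly_def !big_ord0 !horner0 !subr0 fact0 divr1 expr0.
  by rewrite !ler_norml cos_geN1 cos_le1 sin_geN1 sin_le1.
split.
- apply: (@derive_bound_integrate (cos - horner (cos_poly m.+1))
    (fun y => - (sin y - (sin_poly m).[y]))).
  + move=> y; have := is_deriveB (is_derive_cos y) (is_derive_poly (cos_poly m.+1) y).
    by rewrite deriv_cos_poly hornerN opprK [- (_ - _)]opprB [_ - sin y]addrC.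
  + by rewrite !fctE cos0 /cos_poly poly_at0 subrr.
  + by move=> y; rewrite normrN; case: (IH y).
- apply: (@derive_bound_integrate (sin - horner (sin_poly m.+1))
    (fun y => cos y - (cos_poly m).[y])).
  + move=> y; have := is_deriveB (is_derive_sin y) (is_derive_poly (sin_poly m.+1) y).
    by rewrite deriv_sin_poly.
  + by rewrite !fctE sin0 /sin_poly poly_at0 subrr.
  + by move=> y; case: (IH y).
Qed.

End taylor.

(** * Binomial averages and polynomial steps *)

Section bernstein_step.
Context {R : realType}.
Variable p : R.

(** Expectation of [F] under the binomial law with parameters [N] and [p]. *)
Definition binE N (F : nat -> R) : R :=
  \sum_(k < N.+1) 'C(N, k)%:R * p ^+ k * (1 - p) ^+ (N - k) * F k.

Lemma binE_S N F : binE N.+1 F = (1 - p) * binE N F + p * binE N (fun k => F k.+1).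
Proof.
rewrite /binE big_ord_recl/= bin0 subn0 expr0.
rewrite (eq_bigr (fun k : 'I_N.+1 =>
   'C(N, k.+1)%:R * p ^+ k.+1 * (1 - p) ^+ (N - k) * F k.+1 +
   p * ('C(N, k)%:R * p ^+ k * (1 - p) ^+ (N - k) * F k.+1))); last first.
  by move=> k _; rewrite /bump/= add1n binS natrD subSS !exprS; ring.
rewrite big_split/= -mulr_sumr addrA; congr (_ + _).
rewrite [X in _ = _ * X]big_ord_recl/= bin0 subn0 expr0 mulrDr.
rewrite big_ord_recr/= bin_small// !mul0r addr0; congr (_ + _); first by rewrite exprS; ring.
rewrite mulr_sumr; apply: eq_bigr => k _; rewrite /bump/= add1n.
have -> : (N - k = (N - k.+1).+1)%N by have := ltn_ord k; lia.
by rewrite [(1 - p) ^+ _.+1]exprS; ring.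
Qed.

Lemma binE_cst N c : binE N (fun=> c) = c.
Proof.
elim: N => [|N IH]; last by rewrite binE_S !IH; ring.
by rewrite /binE big_ord1 bin0 !expr0 !mul1r.
Qed.

Lemma binE_id N : binE N (fun k => k%:R) = N%:R * p.
Proof.
elim: N => [|N IH]; first by rewrite /binE big_ord1 mulr0 mul0r.
rewrite binE_S IH.
rewrite (_ : binE N (fun k => k.+1%:R) = N%:R * p + 1).
  by rewrite -natr1; ring.
rewrite -IH -[X in _ = _ + X](binE_cst N 1) /binE -big_split/=; apply: eq_bigr => k _.
by rewrite -natr1 mulrDr.
Qed.

Lemma binE_sqr N : binE N (fun k => k%:R ^+ 2) = N%:R * p * (1 - p) + (N%:R * p) ^+ 2.
Proof.
elim: N => [|N IH]; first by rewrite /binE big_ord1 expr0n /= mulr0 !mul0r expr0n addr0.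
rewrite binE_S IH.
rewrite (_ : binE N (fun k => k.+1%:R ^+ 2) =
   binE N (fun k => k%:R ^+ 2) + (2 * binE N (fun k => k%:R) + binE N (fun=> 1))).
  by rewrite IH binE_id binE_cst -natr1; ring.
rewrite /binE mulr_sumr -!big_split/=; apply: eq_bigr => k _.
by rewrite -natr1; ring.
Qed.

Lemma binE_var N : binE N (fun k => (k%:R - N%:R * p) ^+ 2) = N%:R * p * (1 - p).
Proof.
rewrite (_ : binE N _ = binE N (fun k => k%:R ^+ 2) - 2 * (N%:R * p) * binE N (fun k => k%:R)
   + (N%:R * p) ^+ 2 * binE N (fun=> 1)).
  by rewrite binE_sqr binE_id binE_cst; ring.
rewrite /binE !mulr_sumr -sumrB -big_split/=; apply: eq_bigr => k _; ring.
Qed.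

Hypothesis p01 : 0 <= p <= 1.

Lemma le_binE N F G : (forall k, F k <= G k) -> binE N F <= binE N G.
Proof.
move: p01 => /andP[p0 p1] FG; apply: ler_sum => k _.
by rewrite ler_wpM2l// !mulr_ge0 ?exprn_ge0// subr_ge0.
Qed.

(** Chebyshev's inequality, with the variance N p (1 - p) bounded by N. *)
Lemma binE_chebyshev N (S : pred nat) (eta : R) : 0 < eta -> (0 < N)%N ->
  (forall k, S k -> (N%:R * eta) ^+ 2 <= (k%:R - N%:R * p) ^+ 2) ->
  binE N (fun k => (S k)%:R) <= (N%:R * eta ^+ 2)^-1.
Proof.
move=> eta0 N0 hS; have n0 : (0 : R) < N%:R by rewrite ltr0n.
have ne : 0 < (N%:R * eta) ^+ 2 by rewrite exprn_gt0// mulr_gt0.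
have h : (N%:R * eta) ^+ 2 * binE N (fun k => (S k)%:R) <= N%:R * p * (1 - p).
  rewrite -binE_var (_ : _ * _ = binE N (fun k => (N%:R * eta) ^+ 2 * (S k)%:R)).
    apply: le_binE => k; case: (boolP (S k)) => Sk; first by rewrite mulr1 hS.
    by rewrite mulr0 sqr_ge0.
  by rewrite /binE mulr_sumr; apply: eq_bigr => k _; ring.
rewrite -(ler_pM2l ne); apply: le_trans h _.
have e0 : eta != 0 by rewrite gt_eqF.
have nn : N%:R != 0 :> R by rewrite gt_eqF.
rewrite [leRHS](_ : _ = N%:R); last by field; rewrite e0 nn.
move: p01 => /andP[p0 p1]; rewrite -mulrA ler_piMr ?ltW//; nra.
Qed.

End bernstein_step.

(** The Bernstein polynomial of the indicator of the half-line below the midpoint of [t1] and [t2]: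
    in both cases p is at distance at least [eta] from the midpoint, so the weak law of large
    numbers applies. *)
Lemma step_poly {R : realType} (t1 t2 e : R) : t1 < t2 -> 0 < e ->
  exists Q : {poly R}, forall p, 0 <= p <= 1 ->
    [/\ 0 <= Q.[p] <= 1, p <= t1 -> 1 - e <= Q.[p] & t2 <= p -> Q.[p] <= e].
Proof.
move=> t12 e0; pose th := (t1 + t2) / 2; pose eta := (t2 - t1) / 2.
have eta0 : 0 < eta by rewrite divr_gt0// subr_gt0.
have [N [N0 Ne]] : exists N, (0 < N)%N /\ (N%:R * eta ^+ 2)^-1 <= e.
  exists (Num.truncn (e * eta ^+ 2)^-1).+1; split => //.
  have ee : 0 < e * eta ^+ 2 by rewrite mulr_gt0// exprn_gt0.
  have eta2 : 0 < eta ^+ 2 by rewrite exprn_gt0.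
  rewrite invf_ple ?posrE//; last by rewrite mulr_gt0// ltr0n.
  by rewrite -ler_pdivrMr// -invfM; exact/ltW/truncnS_gt.
pose S (k : nat) := k%:R <= N%:R * th.
pose Q : {poly R} := \sum_(k < N.+1) ('C(N, k)%:R * (S k)%:R) *: ('X ^+ k * (1 - 'X) ^+ (N - k)).
have QE p : Q.[p] = binE p N (fun k => (S k)%:R).
  rewrite /Q horner_sum; apply: eq_bigr => k _.
  by rewrite hornerZ hornerM !horner_exp hornerD hornerN hornerX hornerC; ring.
exists Q => p p01; rewrite QE; have n0 : (0 : R) < N%:R by rewrite ltr0n.
have neta0 : 0 <= N%:R * eta by rewrite mulr_ge0// ltW.
split.
- apply/andP; split.
    by rewrite -[leLHS](binE_cst p N 0); apply: le_binE.
  rewrite -[leRHS](binE_cst p N 1); apply: le_binE => // k.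
  by rewrite lern1 leq_b1.
- move=> pt.
  have -> : binE p N (fun k => (S k)%:R) = 1 - binE p N (fun k => (~~ S k)%:R).
    rewrite -[X in _ = X - _](binE_cst p N 1) /binE -sumrB; apply: eq_bigr => k _.
    by case: (S k) => /=; ring.
  rewrite lerD2l lerN2; apply: le_trans Ne; apply: binE_chebyshev => // k.
  rewrite /S -ltNge => kS.
  have h : N%:R * eta <= k%:R - N%:R * p.
    rewrite lerBrDl; apply: le_trans (ltW kS); rewrite -mulrDr ler_pM2l// /th /eta; lra.
  by rewrite lerXn2r ?nnegrE ?(le_trans neta0 h).
- move=> pt; apply: le_trans Ne; apply: binE_chebyshev => // k; rewrite /S => kS.
  have h : N%:R * eta <= N%:R * p - k%:R.
    rewrite lerBrDl -lerBrDr; apply: le_trans kS _; rewrite -mulrBr ler_pM2l// /th /eta; lra.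
  by rewrite -[leRHS]sqrrN opprB lerXn2r ?nnegrE ?(le_trans neta0 h).
Qed.

Lemma gauss_moment_even {R : realType} k :
  gauss_moment (k + k) * (2 ^+ k * k`!%:R) = (k + k)`!%:R :> R.
Proof.
elim: k => [|k IH]; first by rewrite /= fact0 expr0 !mulr1.
rewrite addSn addnS !factS !natrM -IH /= exprS -!natr1 natrD; ring.
Qed.

(** * The method of moments for the normal law *)

Section method_of_moments.
Context {R : realType}.
Local Notation gam := (@normal_prob R 0 1).
Variable nu : nat -> probability (measurableTypeR R) R.
Hypothesis int_nu : forall n k, (nu n).-integrable setT (fun x => (x ^+ k)%:E).
Hypothesis mom_nu : forall k,
  (\int[nu n]_x x ^+ k) @[n --> \oo] --> (gauss_moment k : R).

Let int_gam k : gam.-integrable setT (fun x => (x ^+ k)%:E).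
Proof. exact: integrable_gauss_pow. Qed.

Let Egam k : \int[gam]_x x ^+ k = gauss_moment k.
Proof. by rewrite /Rintegral integral_gauss_moment. Qed.

Lemma Rintegral_poly (P : probability (measurableTypeR R) R) (p : {poly R}) (t : R) :
  (forall k, P.-integrable setT (fun x => (x ^+ k)%:E)) ->
  P.-integrable setT (fun x => (p.[t * x])%:E) /\
  \int[P]_x p.[t * x] = \sum_(i < size p) p`_i * t ^+ i * \int[P]_x x ^+ i.
Proof.
move=> iP.
have term (c : R) i : P.-integrable setT (fun x => (c * x ^+ i)%:E).
  rewrite (_ : (fun _ => _) = (fun x => c%:E * (x ^+ i)%:E)%E)//.
  by apply: (integrableZl measurableT); exact: iP.
have pE x : p.[t * x] = \sum_(i < size p) p`_i * t ^+ i * x ^+ i.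
  by rewrite horner_coef; apply: eq_bigr => i _; rewrite exprMn mulrA.
have gen m : P.-integrable setT (fun x => (\sum_(i < m) p`_i * t ^+ i * x ^+ i)%:E) /\
  \int[P]_x (\sum_(i < m) p`_i * t ^+ i * x ^+ i) = \sum_(i < m) p`_i * t ^+ i * \int[P]_x x ^+ i.
  elim: m => [|m [IH1 IH2]].
    split.
      rewrite (_ : (fun _ => _) = (fun x => 0%:E)).
        exact: (bmf_integrable P (bmf_cst 0)).
      by apply/funext => x; rewrite big_ord0.
    rewrite big_ord0 -[RHS](Ev_cst P 0); apply: eq_Rintegral => x _.
    by rewrite big_ord0.
  have fE : (fun x => (\sum_(i < m.+1) p`_i * t ^+ i * x ^+ i)%:E) =
    (fun x => (\sum_(i < m) p`_i * t ^+ i * x ^+ i)%:E + (p`_m * t ^+ m * x ^+ m)%:E)%E.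
    by apply/funext => x; rewrite big_ord_recr/= EFinD.
  split; first by rewrite fE; apply: integrableD => //; exact: term.
  rewrite big_ord_recr/= -IH2 -RintegralZl//; last exact: iP.
  rewrite -RintegralD//; last exact: term.
  by apply: eq_Rintegral => x _; rewrite big_ord_recr.
have [g1 g2] := gen (size p); split.
  by rewrite (_ : (fun _ => _) = (fun x => (\sum_(i < size p) p`_i * t ^+ i * x ^+ i)%:E))//;
    apply/funext => x; rewrite pE.
by rewrite -g2; apply: eq_Rintegral => x _; rewrite pE.
Qed.

Lemma Ev_taylor (P : probability (measurableTypeR R) R) (f : R -> R) (p : {poly R}) (t : R) k :
  (forall k, P.-integrable setT (fun x => (x ^+ k)%:E)) -> bmf (f : measurableTypeR R -> R) ->
  (forall x, `|f x - p.[t * x]| <= `|t * x| ^+ (k + k) / (k + k)`!%:R) ->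
  `|Ev P f - \int[P]_x p.[t * x]| <= t ^+ (k + k) / (k + k)`!%:R * \int[P]_x x ^+ (k + k).
Proof.
move=> iP bf fp; have [ip _] := Rintegral_poly p t iP.
have if_ : P.-integrable setT (EFin \o f) by exact: bmf_integrable.
have idf : P.-integrable setT (EFin \o (fun x => f x - p.[t * x])).
  by rewrite (_ : EFin \o _ = (fun x => (f x)%:E - (p.[t * x])%:E)%E)//; exact: integrableB.
rewrite /Ev -RintegralB//; apply: le_trans (le_normr_Rintegral measurableT idf) _.
rewrite -RintegralZl//; last exact: iP.
apply: le_Rintegral => //.
- exact: integrable_abse idf.
- rewrite (_ : EFin \o _ = (fun x => (t ^+ (k + k) / (k + k)`!%:R)%:E * (x ^+ (k + k))%:E)%E)//.
  by apply: (integrableZl measurableT); exact: iP.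
- move=> x _; apply: le_trans (fp x) _.
  have -> : `|t * x| ^+ (k + k) = t ^+ (k + k) * x ^+ (k + k).
    rewrite -normrX exprMn ger0_norm// addnn -mul2n !exprM.
    by apply: mulr_ge0; apply: exprn_ge0; exact: sqr_ge0.
  by rewrite mulrAC.
Qed.

Definition good (f : measurableTypeR R -> R) :=
  bmf f /\ Ev (nu n) f @[n --> \oo] --> Ev gam f.

(** The Gaussian moment of order 2 k is (2k)!/(2^k k!), so this is the general term of the series of
    exp(t^2/2). *)
Lemma taylor_bound_cvg (t : R) :
  (t ^+ (k + k) / (k + k)`!%:R * gauss_moment (k + k)) @[k --> \oo] --> (0 : R).
Proof.
have := cvg_series_cvg_0 (@is_cvg_series_exp_coeff R (t ^+ 2 / 2)).
rewrite (_ : exp_coeff _ = (fun k => t ^+ (k + k) / (k + k)`!%:R * gauss_moment (k + k)))//.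
apply/funext => k.
rewrite /exp_coeff /= expr_div_n -gauss_moment_even -exprM mul2n -addnn.
have h1 : (2 : R) ^+ k != 0 by rewrite expf_neq0.
have h2 : k`!%:R != 0 :> R by rewrite pnatr_eq0 -lt0n fact_gt0.
have h3 : gauss_moment (k + k) != 0 :> R.
  have := @gauss_moment_even R k; apply: contra_eq_neq => ->.
  by rewrite mul0r eq_sym pnatr_eq0 -lt0n fact_gt0.
by field; rewrite h1 h2 h3.
Qed.

(** Even orders are used so that the remainder is itself a moment. The order is fixed from the
    Gaussian remainder alone; as moments converge, the remainder under [nu n] is then small for
    large [n]. *)
Lemma good_taylor (f : R -> R) (p : nat -> {poly R}) (t : R) :
  bmf (f : measurableTypeR R -> R) ->
  (forall m x, `|f x - (p m).[t * x]| <= `|t * x| ^+ m / m`!%:R) -> good f.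
Proof.
move=> bf fp; split => //; apply/cvgrPdist_le => e e0.
have e4 : 0 < e / 4 by rewrite divr_gt0.
have /cvgr0_norm_le/(_ _ e4)[k _ /(_ k (leqnn k)) hk] := taylor_bound_cvg t.
set c := t ^+ (k + k) / (k + k)`!%:R in hk.
have c1 : (\int[nu n]_x (p (k + k)%N).[t * x]) @[n --> \oo] -->
    \int[gam]_x (p (k + k)%N).[t * x].
  rewrite (Rintegral_poly (p (k + k)%N) t int_gam).2.
  under eq_fun do rewrite (Rintegral_poly (p (k + k)%N) t (int_nu _)).2.
  apply: cvg_bigsum => i _; rewrite Egam; apply: cvgZr; exact: mom_nu.
have c2 : (c * \int[nu n]_x x ^+ (k + k)) @[n --> \oo] --> c * gauss_moment (k + k).
  by apply: cvgZr; exact: mom_nu.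
have /cvgrPdist_le/(_ _ e4) n1 := c1; have /cvgrPdist_le/(_ _ e4) n2 := c2.
near=> n.
have h1 := Ev_taylor (t := t) (int_nu n) bf (fp (k + k)%N).
have h2 := Ev_taylor (t := t) int_gam bf (fp (k + k)%N).
rewrite Egam -/c in h2; rewrite -/c in h1.
have h3 : `|\int[gam]_x (p (k + k)%N).[t * x] - \int[nu n]_x (p (k + k)%N).[t * x]| <= e / 4.
  by near: n.
have h4 : `|c * gauss_moment (k + k) - c * \int[nu n]_x x ^+ (k + k)| <= e / 4 by near: n.
move: hk h1 h2 h3 h4; rewrite !ler_norml.
move=> /andP[? ?] /andP[? ?] /andP[? ?] /andP[? ?] /andP[? ?]; apply/andP; split; lra.
Unshelve. all: by end_near.
Qed.

Lemma good_cos t : good (fun x => cos (t * x)).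
Proof.
apply: (@good_taylor _ cos_poly t) => [|m x]; last by case: (trig_taylor m (t * x)).
split; last by exists 1 => x; rewrite ler_norml cos_geN1 cos_le1.
have : measurable_fun [set: R] (fun x : R => cos (t * x)); last by [].
apply: continuous_measurable_fun => x; apply: continuous_comp.
  by apply: cvgZr; exact: cvg_id.
exact: continuous_cos.
Qed.

Lemma good_sin t : good (fun x => sin (t * x)).
Proof.
apply: (@good_taylor _ sin_poly t) => [|m x]; last by case: (trig_taylor m (t * x)).
split; last by exists 1 => x; rewrite ler_norml sin_geN1 sin_le1.
have : measurable_fun [set: R] (fun x : R => sin (t * x)); last by [].
apply: continuous_measurable_fun => x; apply: continuous_comp.
  by apply: cvgZr; exact: cvg_id.
exact: continuous_sin.
Qed.

Lemma goodD f g : good f -> good g -> good (fun x => f x + g x).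
Proof.
move=> [bf cf] [bg cg]; split; first exact: bmfD.
rewrite EvD//; under eq_fun do rewrite EvD//; exact: cvgD.
Qed.

Lemma goodZ (c : R) f : good f -> good (fun x => c * f x).
Proof.
move=> [bf cf]; split; first by apply: bmfM => //; exact: bmf_cst.
rewrite EvZ//; under eq_fun do rewrite EvZ//; exact: cvgZr.
Qed.

Lemma good_sum m (f : 'I_m -> R -> R) : (forall i, good (f i)) ->
  good (fun x => \sum_(i < m) f i x).
Proof.
move=> gf; elim: m f gf => [|m IH] f gf.
  rewrite (_ : (fun _ => _) = fun x => 0 * cos (0 * x)); first exact/goodZ/good_cos.
  by apply/funext => x; rewrite big_ord0 mul0r.
rewrite (_ : (fun _ => _) = fun x => (\sum_(i < m) f (widen_ord (leqnSn m) i) x) + f ord_max x).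
  by apply: goodD => //; apply: IH.
by apply/funext => x; rewrite big_ord_recr.
Qed.

(** Product-to-sum formulas lower the exponent at the price of shifting [t] by [c], so both
    statements are proved together for all [t]. *)
Lemma good_sin_exp (c : R) k t : good (fun x => sin (c * x) ^+ k * cos (t * x)) /\
  good (fun x => sin (c * x) ^+ k * sin (t * x)).
Proof.
elim: k t => [|k IH] t.
  split; [move: (good_cos t)|move: (good_sin t)]; congr good; apply/funext => x;
  by rewrite expr0 mul1r.
split.
- rewrite (_ : (fun _ => _) = fun x => 2^-1 * (sin (c * x) ^+ k * sin ((c + t) * x) +
     sin (c * x) ^+ k * sin ((c - t) * x))).
    by apply: goodZ; apply: goodD; [exact: (IH _).2|exact: (IH _).2].
  apply/funext => x; rewrite [(c + t) * x]mulrDl [(c - t) * x]mulrBl.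
  by rewrite sinD sinB exprS; field.
- rewrite (_ : (fun _ => _) = fun x => 2^-1 * (sin (c * x) ^+ k * cos ((c - t) * x) +
     (-1) * (sin (c * x) ^+ k * cos ((c + t) * x)))).
    by apply: goodZ; apply: goodD; [exact: (IH _).1|apply: goodZ; exact: (IH _).1].
  apply/funext => x; rewrite [(c + t) * x]mulrDl [(c - t) * x]mulrBl.
  by rewrite cosB cosD exprS; field.
Qed.

Lemma good_poly_sin (c : R) (q : {poly R}) : good (fun x => q.[sin (c * x)]).
Proof.
rewrite (_ : (fun _ => _) = fun x => \sum_(i < size q) q`_i * (sin (c * x) ^+ i * cos (0 * x))).
  by apply: good_sum => i; apply: goodZ; exact: (good_sin_exp _ _ _).1.
by apply/funext => x; rewrite horner_coef; apply: eq_bigr => i _; rewrite mul0r cos0 mulr1.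
Qed.

(** The map x -> (1 + sin(x / T)) / 2 increases on [-T, T], where it is composed with a polynomial
    step; beyond, where it oscillates, [e * x ^+ 2] is at least 1, and its integral is controlled by
    the second moment. *)
Lemma good_step (y z e : R) : y < z -> 0 < e ->
  exists b, good b /\ forall x, ((x <= y)%R%:R <= b x + e + e * x ^+ 2) /\
    b x <= (x <= z)%R%:R + e + e * x ^+ 2.
Proof.
move=> yz e0.
(* [T] dominates [y] and [z], and being at least 1 and at least [e^-1] it satisfies
   [T ^- 2 <= e]. *)
pose T := 1 + `|y| + `|z| + e^-1.
have T0 : 0 < T by rewrite !ltr_wpDr// ?invr_ge0 ?ltW.
have T1 : 1 <= T by rewrite /T -!addrA lerDl !addr_ge0 ?invr_ge0// ltW.
have Te : T ^- 2 <= e.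
  rewrite invf_ple ?posrE ?exprn_gt0//; apply: (@le_trans _ _ T).
    by rewrite /T lerDr !addr_ge0.
  by rewrite expr2 ler_peMl// ltW.
have pi1 : (1 : R) <= pi / 2 by rewrite ler_pdivlMr// mul1r pi_ge2.
have inI (x : R) : `|x| <= T -> T^-1 * x \in `[- (pi / 2), pi / 2].
  move=> xT; rewrite in_itv/= -ler_norml normrM gtr0_norm ?invr_gt0//.
  by apply: le_trans pi1; rewrite ler_pdivrMl// mulr1.
have yT : `|y| <= T.
  have := normr_ge0 z; have : 0 <= e^-1 by rewrite invr_ge0 ltW.
  by rewrite /T; lra.
have zT : `|z| <= T.
  have := normr_ge0 y; have : 0 <= e^-1 by rewrite invr_ge0 ltW.
  by rewrite /T; lra.
pose s (x : R) := sin (T^-1 * x).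
have smono x x' : `|x| <= T -> `|x'| <= T -> (s x <= s x') = (x <= x').
  move=> hx hx'; rewrite leNgt /s ltr_sin ?inI// ltr_pM2l ?invr_gt0//.
  by rewrite -leNgt.
have syz : (1 + s y) / 2 < (1 + s z) / 2.
  by rewrite ltr_pM2r ?invr_gt0// ltrD2l ltNge smono// -ltNge.
have [Q hQ] := step_poly syz e0.
pose q : {poly R} := Q \Po (2^-1 *: (1 + 'X)).
exists (fun x => q.[sin (T^-1 * x)]); split; first exact: good_poly_sin.
have qE x : q.[sin (T^-1 * x)] = Q.[(1 + s x) / 2].
  by rewrite /q horner_comp hornerZ hornerD hornerX hornerC mulrC.
move=> x; rewrite qE.
have p01 : 0 <= (1 + s x) / 2 <= 1.
  by have := sin_geN1 (T^-1 * x); have := sin_le1 (T^-1 * x); rewrite -/(s x) => ? ?; apply/andP; split; lra.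
have [/andP[Q0 Q1] Ql Qr] := hQ _ p01.
have ex2 : 0 <= e * x ^+ 2 by rewrite mulr_ge0 ?sqr_ge0// ltW.
have [xT|xT] := leP `|x| T; last first.
  have : 1 <= e * x ^+ 2.
    have x2 : T ^+ 2 <= x ^+ 2.
      by rewrite -[x ^+ 2]real_normK ?num_real// ler_pXn2r ?nnegrE ?(ltW xT) ?(ltW T0).
    apply: le_trans (ler_pM _ _ Te x2); rewrite ?invr_ge0 ?sqr_ge0//.
    by rewrite mulVf// expf_neq0// gt_eqF.
  by split; [case: (x <= y)|case: (x <= z)]; rewrite /=; lra.
split.
  have [xy|_] := leP x y; last by rewrite /=; lra.
  have : (1 + s x) / 2 <= (1 + s y) / 2.
    by rewrite ler_pM2r ?invr_gt0// lerD2l smono.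
  by move=> /Ql /=; lra.
have [xz|zx] := leP x z; first by rewrite /=; lra.
have : (1 + s z) / 2 <= (1 + s x) / 2.
  by rewrite ler_pM2r ?invr_gt0// lerD2l smono// ltW.
by move=> /Qr /=; lra.
Qed.

Lemma normal_cdf_lipschitz (x y : R) : x <= y ->
  (gam `]-oo, y] <= gam `]-oo, x] + (normal_peak 1 * (y - x))%:E)%E.
Proof.
move=> xy.
have -> : `]-oo, y]%classic = `]-oo, x]%classic `|` `]x, y]%classic :> set R.
  by rewrite -itv_bndbnd_setU// bnd_simp.
apply: le_trans (measureU2 _ _ _) _; rewrite ?leeD2l//; try exact: measurable_itv.
rewrite /normal_prob.
apply: (@le_trans _ _ (\int[lebesgue_measure]_(w in `]x, y]) (normal_peak (1 : R))%:E)%E).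
  apply: ge0_le_integral => //.
  - by move=> w _; rewrite lee_fin normal_pdf_ge0.
  - apply/measurable_EFinP; apply: measurable_funTS; exact: measurable_normal_pdf.
  - by move=> w _; rewrite lee_fin normal_pdf_ub// oner_neq0.
rewrite integral_cst//= (lebesgue_measure_itv `]x, y]) /= lte_fin; case: ltP => [_|yx].
  by rewrite EFinM EFinB.
have -> : y = x by apply/eqP; rewrite eq_le xy yx.
by rewrite subrr mulr0 mule0.
Qed.

Lemma moments_cvg_cdf (x : R) : nu n `]-oo, x]%classic @[n --> \oo] --> gam `]-oo, x].
Proof.
pose I (z : R) : measurableTypeR R -> R := \1_(`]-oo, z]%classic : set (measurableTypeR R)).
have bI z : bmf (I z) by apply: bmf_indic; exact: measurable_itv.
have IE z w : I z w = (w <= z)%R%:R.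
  by rewrite /I indicE mem_setE in_itv.
have EvE (P : probability (measurableTypeR R) R) z : P `]-oo, z]%classic = (Ev P (I z))%:E.
  rewrite Ev_indic ?fineK//; try exact: measurable_itv.
  by apply: fin_num_measure; exact: measurable_itv.
rewrite EvE; under eq_fun do rewrite EvE.
apply: cvg_EFin; first by apply: nearW.
(* Of the 6, one is the convergence of the expectations of [b], three are the loss under [nu n],
   whose second moment is at most 2, and two the loss under [gam]. *)
have step (y z e : R) : y < z -> 0 < e -> \forall n \near \oo,
    Ev (nu n) (I y) <= Ev gam (I z) + 6 * e /\ Ev gam (I y) <= Ev (nu n) (I z) + 6 * e.
  move=> yz e0; have [b [[bb cb] hb]] := good_step yz e0.
  have lo (P : probability (measurableTypeR R) R) :
      (forall k, P.-integrable setT (fun x => (x ^+ k)%:E)) ->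
      Ev P (I y) <= Ev P b + e + e * \int[P]_w w ^+ 2 /\
      Ev P b <= Ev P (I z) + e + e * \int[P]_w w ^+ 2.
    move=> iP.
    have eq2 (g : measurableTypeR R -> R) : bmf g ->
        P.-integrable setT (EFin \o (fun x => (g x + e) + e * x ^+ 2)) /\
        Ev P g + e + e * \int[P]_w w ^+ 2 = \int[P]_x ((g x + e) + e * x ^+ 2).
      move=> bg; have bge : bmf (fun x => g x + e) by apply: bmfD => //; exact: bmf_cst.
      have ig := bmf_integrable P bge.
      have i2 : P.-integrable setT (EFin \o (fun x => e * x ^+ 2)).
        rewrite (_ : EFin \o _ = (fun x => e%:E * (x ^+ 2)%:E)%E)//.
        by apply: (integrableZl measurableT); exact: iP.
      split.
        by rewrite (_ : EFin \o _ = (fun x => (g x + e)%:E + (e * x ^+ 2)%:E)%E)//; exact: integrableD.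
      have e1 : Ev P (fun x => g x + e) = Ev P g + e.
        by rewrite EvD ?Ev_cst//; exact: bmf_cst.
      rewrite RintegralD// RintegralZl//; last exact: iP.
      by rewrite -e1.
    have [i1 ->] := eq2 _ bb; have [i2 ->] := eq2 _ (bI z).
    split; apply: le_Rintegral => //; try exact: bmf_integrable.
      by move=> w _; have [h1 _] := hb w; rewrite IE.
    by move=> w _; have [_ h2] := hb w; rewrite IE.
  have := @mom_nu 2%N; rewrite /= !mulr1 => /cvgrPdist_le/(_ _ ltr01) m2.
  have /cvgrPdist_le/(_ _ e0) nb := cb.
  move: m2 nb; apply: filterS2 => n m2 nb.
  have [l1 l2] := lo _ (int_nu n); have [l3 l4] := lo _ int_gam.
  have g2 : \int[gam]_w w ^+ 2 = 1 by rewrite Egam /= !mulr1.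
  have M2 : \int[nu n]_w w ^+ 2 <= 2.
    by move: m2; rewrite ler_norml => /andP[? ?]; lra.
  have eM : e * \int[nu n]_w w ^+ 2 <= e * 2 by rewrite ler_pM2l.
  rewrite g2 mulr1 in l3 l4.
  by move: nb; rewrite ler_norml => /andP[? ?]; split; lra.
apply/cvgrPdist_le => e e0.
have pk : 0 < normal_peak (1 : R) by apply: normal_peak_gt0; exact: oner_neq0.
have e12 : 0 < e / 12 by rewrite divr_gt0.
(* A shift by [dl] changes the normal distribution function by at most [e / 2]; the other half is
   [6 * (e / 12)]. *)
pose dl := e / 2 / normal_peak 1.
have dl0 : 0 < dl by rewrite !divr_gt0.
have dlE : normal_peak 1 * dl = e / 2 by rewrite /dl mulrC divfK// gt_eqF.
have xd1 : x < x + dl by rewrite ltrDl.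
have xd2 : x - dl < x by rewrite ltrBlDr.
have s1 := step _ _ _ xd1 e12.
have s2 := step _ _ _ xd2 e12.
have := normal_cdf_lipschitz (ltW xd1); have := normal_cdf_lipschitz (ltW xd2).
rewrite !EvE -!EFinD !lee_fin (_ : x - (x - dl) = dl) 1?(_ : x + dl - x = dl); [|ring|ring].
rewrite dlE => L1 L2.
near=> n.
have [a1 _] : Ev (nu n) (I x) <= Ev gam (I (x + dl)) + 6 * (e / 12) /\
  Ev gam (I x) <= Ev (nu n) (I (x + dl)) + 6 * (e / 12) by near: n.
have [_ a2] : Ev (nu n) (I (x - dl)) <= Ev gam (I x) + 6 * (e / 12) /\
  Ev gam (I (x - dl)) <= Ev (nu n) (I x) + 6 * (e / 12) by near: n.
by rewrite /= ler_norml; apply/andP; split; lra.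
Unshelve. all: by end_near.
Qed.

End method_of_moments.

(** * Triangular arrays *)

(** The definition is tested on the zero function with bound 1. *)
Lemma mixes_ge0 {R : realType} {n} (mu : probability (n.-tuple R) R) t b :
  mixes mu t b -> 0 <= b.
Proof.
move=> mix; have := mix 0%N (fun=> 0) 1 (bmf_cst 0).
have h0 : forall z : n.-tuple R * n.-tuple R, `|0 : R| <= 1 by move=> _; rewrite normr0.
move=> /(_ h0 (fun _ _ _ _ => erefl) (fun _ _ _ _ => erefl)) h.
by have := le_trans (normr_ge0 _) h; rewrite mulr1 pmulr_rge0.
Qed.

Lemma norm_pow_le {R : realType} (w : R) i k : (i <= k)%N ->
  `|w| ^+ i <= 1 + w ^+ (2 * uphalf k).
Proof.
move=> ik; have -> : w ^+ (2 * uphalf k) = `|w| ^+ (2 * uphalf k).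
  by rewrite !exprM real_normK ?num_real.
have [w1|w1] := leP `|w| 1.
  by apply: (@le_trans _ _ 1); [exact: exprn_ile1|rewrite lerDl exprn_ge0].
apply: (@le_trans _ _ (`|w| ^+ (2 * uphalf k))); last by rewrite lerDr.
by apply: ler_weXn2l; [exact: ltW|lia].
Qed.

(** * The normalized recursion and its error *)

Section normalized_recursion.
Context {R : realType}.
Variables (r K : nat).
Hypothesis r0 : (0 < r)%N.

(** The expansion with Z = V, a local function of weight n^r B, divided by s^(k+1). The coefficient
    of order 0 is E[V] = 0, so the sum starts at 1; [a] is chosen before [k]. *)
Lemma moment_recursion : exists C : nat -> R, (forall k, 0 <= C k) /\
  forall (t n : nat) (mu : probability (n.-tuple R) R) (b B s rho : R)
    (zeta : r.-tuple 'I_n -> n.-tuple R -> R),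
  (0 < t)%N -> (0 < n)%N -> mixes mu t b ->
  (forall J, bmf (zeta J)) -> 0 <= B -> (forall J x, `|zeta J x| <= B) ->
  (forall J, depends_on (fun i => i \in val J) (zeta J)) ->
  (forall J, Ev mu (zeta J) = 0) -> 0 < s -> delta_ r t n B / s <= rho -> rho <= 1 ->
  let mom k := Ev mu (fun x => (totalsum zeta x / s) ^+ k) in
  exists a : nat -> R, forall k,
    `|mom k.+1 - \sum_(1 <= j < K) a j * (k ^_ j)%:R * mom (k - j)%N| <=
    C k * ((n ^ r)%:R * B / s * (k.+1%:R * rho ^+ K + n%:R * b * (supbound r t n B / s) ^+ k)) *
    (1 + mom (2 * uphalf k)%N).
Proof.
have [C [C0 hC]] := uniform_expansion R K r r0.
exists C; split => // t n mu b B s rho zeta t0 n0 mix bz B0 zB dz Ez s0 ds rho1 mom.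
have b0 := mixes_ge0 mix.
have rho0 : 0 <= rho by apply: le_trans ds; rewrite divr_ge0 ?mulr_ge0// ltW.
have lV : localf r ((n ^ r)%:R * B) (totalsum zeta).
  have := localf_sum B0 (fun J (_ : xpredT J) => localf_zeta bz zB dz J).
  by rewrite card_tuple card_ord.
have [bV _] := localf_bound lV.
have bW : bmf (fun x => totalsum zeta x / s) by apply: bmfM => //; exact: bmf_cst.
have EV0 : Ev mu (totalsum zeta) = 0.
  by rewrite /totalsum Ev_sum// big1.
have [c [c0 hc]] := hC t n mu b B zeta t0 n0 mix b0 bz zB dz _ _ lV.
rewrite EV0 in c0.
have momE k : mom k = Ev mu (fun x => totalsum zeta x ^+ k) / s ^+ k.
  rewrite /mom mulrC -EvZ; last exact: bmfX.
  by congr Ev; apply/funext => x; rewrite expr_div_n mulrC.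
have absE k : Ev mu (fun x => `|totalsum zeta x| ^+ k) / s ^+ k = Ev mu (fun x => `|totalsum zeta x / s| ^+ k).
  rewrite mulrC -EvZ; last by apply: bmfX; exact: bmf_norm.
  congr Ev; apply/funext => x.
  by rewrite normrM normfV (gtr0_norm s0) expr_div_n mulrC.
exists (fun j => c j / s ^+ j.+1) => k.
have m20 : 0 <= mom (2 * uphalf k)%N.
  by apply: Ev_ge0 => x; rewrite exprM exprn_ge0 ?sqr_ge0.
have absle i : (i <= k)%N -> Ev mu (fun x => `|totalsum zeta x| ^+ i) / s ^+ i <= 1 + mom (2 * uphalf k)%N.
  move=> ik; rewrite absE -(Ev_cst mu 1) -EvD; [|exact: bmf_cst|exact: bmfX].
  apply: le_Ev; first by apply: bmfX; exact: bmf_norm.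
    by apply: bmfD; [exact: bmf_cst|exact: bmfX].
  by move=> x; exact: norm_pow_le.
have sk0 : 0 < s ^+ k.+1 by exact: exprn_gt0.
have -> : mom k.+1 - \sum_(1 <= j < K) c j / s ^+ j.+1 * (k ^_ j)%:R * mom (k - j)%N =
  (Ev mu (fun x => totalsum zeta x * totalsum zeta x ^+ k) -
   \sum_(j < K) c j * (k ^_ j)%:R * Ev mu (fun x => totalsum zeta x ^+ (k - j))) / s ^+ k.+1.
  rewrite mulrBl; congr (_ - _).
    by rewrite momE; congr (_ / _); congr Ev; apply/funext => x; rewrite exprS.
  rewrite -(big_mkord xpredT (fun j => c j * (k ^_ j)%:R * Ev mu (fun x => totalsum zeta x ^+ (k - j)))).
  case: (K) => [|K']; first by rewrite big_geq// big_nil mul0r.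
  rewrite [in RHS]big_ltn// c0 !mul0r add0r mulr_suml; apply: eq_big_nat => j _.
  have [kj|jk] := ltnP k j; first by rewrite ffact_small// !mulr0 !mul0r.
  rewrite momE (_ : k.+1 = (j.+1 + (k - j))%N) ?exprD; last by lia.
  by field; rewrite !expf_neq0// gt_eqF.
rewrite normrM normfV (gtr0_norm sk0) ler_pdivrMr//; apply: le_trans (hc k) _.
rewrite -[leLHS]mulrA -[X in _ <= X * _]mulrA -[leRHS]mulrA ler_wpM2l//.
(* Each order contributes a factor at most [rho], and [rho <= 1] lets all orders from [K] on be
   bounded by [rho ^+ K]; lower absolute moments are bounded by the even one. *)
have tl : tailsum (delta_ r t n B) (fun k => Ev mu (fun x => `|totalsum zeta x| ^+ k)) K k <=
    s ^+ k * (k.+1%:R * rho ^+ K * (1 + mom (2 * uphalf k)%N)).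
  rewrite /tailsum; apply: (@le_trans _ _ (\sum_(K <= j < k.+1) s ^+ k * (rho ^+ K * (1 + mom (2 * uphalf k)%N)))).
    rewrite [leLHS]big_nat [leRHS]big_nat; apply: ler_sum => j /andP[Kj jk].
    rewrite [leLHS](_ : _ = s ^+ k * ((delta_ r t n B / s) ^+ j *
        (Ev mu (fun x => `|totalsum zeta x| ^+ (k - j)) / s ^+ (k - j)))); last first.
      have -> : s ^+ k = s ^+ j * s ^+ (k - j) by rewrite -exprD subnKC//; lia.
      rewrite expr_div_n; set X := Ev _ _; set Y := delta_ r t n B ^+ j.
      by move: X Y => X Y; field; rewrite !expf_neq0// gt_eqF.
    have d0 : 0 <= delta_ r t n B / s by rewrite divr_ge0 ?mulr_ge0// ltW.
    rewrite ler_wpM2l ?exprn_ge0 ?(ltW s0)//; apply: ler_pM.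
    - exact: exprn_ge0.
    - rewrite absE; apply: Ev_ge0 => x; exact: exprn_ge0.
    - apply: (@le_trans _ _ (rho ^+ j)); first by apply: lerXn2r; rewrite ?nnegrE.
      by apply: ler_wiXn2l.
    - by apply: absle; lia.
  rewrite sumr_const_nat -[leLHS]mulr_natl -!mulrA mulrCA.
  rewrite ler_wpM2l ?exprn_ge0 ?(ltW s0)// ler_wpM2r ?mulr_ge0 ?exprn_ge0 ?addr_ge0//.
  by rewrite ler_nat; lia.
have sp : n%:R * b * supbound r t n B ^+ k <=
    s ^+ k * (n%:R * b * (supbound r t n B / s) ^+ k * (1 + mom (2 * uphalf k)%N)).
  rewrite [leRHS](_ : _ = n%:R * b * supbound r t n B ^+ k * (1 + mom (2 * uphalf k)%N)).
    by rewrite ler_peMr ?lerDl// !mulr_ge0// exprn_ge0// mulr_ge0.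
  rewrite expr_div_n; set X := supbound r t n B ^+ k; set M := mom _.
  by move: X M => X M; field; rewrite expf_neq0// gt_eqF.
apply: (@le_trans _ _ ((n ^ r)%:R * B * (s ^+ k * (k.+1%:R * rho ^+ K * (1 + mom (2 * uphalf k)%N)) +
  s ^+ k * (n%:R * b * (supbound r t n B / s) ^+ k * (1 + mom (2 * uphalf k)%N))))).
  by rewrite ler_wpM2l ?mulr_ge0// lerD.
rewrite [leLHS](_ : _ = (n ^ r)%:R * B / s * (k.+1%:R * rho ^+ K + n%:R * b * (supbound r t n B / s) ^+ k) *
   (1 + mom (2 * uphalf k)%N) * s ^+ k.+1) ?mulrA//.
rewrite (exprS s k); set X := (supbound r t n B / s) ^+ k; set M := mom _.
by move: X M (n ^ r)%N => X M N; field; rewrite gt_eqF.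
Qed.
End normalized_recursion.

(** Everything is reduced to powers of m: [delta_ / sigma] is of order 1/m and n^r / sigma at most
    of order m^p, so p + 1 orders leave 1/m. The mixing term carries p powers for n^r / sigma, p for
    n and p k for [supbound]; with the wanted 1/m this is the exponent [(p * k.+2).+1] asked of
    [b]. *)
Lemma scaled_error {R : realType} (r p k : nat) (B s : R) :
  (0 < r)%N -> 0 < B -> 0 < s ->
  let c := B * (2 * r)%:R / s in
  exists C : R, forall (n m : nat) (sigma b : R),
    (0 < n)%N -> (0 < m)%N -> (n <= (2 * m) ^ p)%N ->
    s * (n ^ r.-1)%:R * m%:R ^+ 2 <= sigma -> 0 <= b -> b * m%:R ^+ (p * k.+2).+1 <= 1 ->
    delta_ r m n B / sigma <= c / m%:R /\
    (n ^ r)%:R * B / sigma * (k.+1%:R * (c / m%:R) ^+ p.+1 +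
      n%:R * b * (supbound r m n B / sigma) ^+ k) <= C / m%:R.
Proof.
move=> r0 B0 s0 c; exists (B / s * (k.+1%:R * 2 ^+ p * c ^+ p.+1 + 2 ^+ (p * k.+2) * c ^+ k)).
move=> n m sigma b n0 m0 nm hs b0 hb.
have c0 : 0 < c by rewrite divr_gt0// mulr_gt0// ltr0n muln_gt0.
have mR : 0 < m%:R :> R by rewrite ltr0n.
have m1 : 1 <= m%:R :> R by rewrite ler1n.
have nR : 0 < n%:R :> R by rewrite ltr0n.
have N0 : 0 < (n ^ r.-1)%:R :> R by rewrite ltr0n expn_gt0 n0.
have sg0 : 0 < sigma by apply: lt_le_trans hs; rewrite !mulr_gt0// exprn_gt0.
have nrE : (n ^ r)%:R = (n ^ r.-1)%:R * n%:R :> R by rewrite -natrM -expnSr prednK.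
have nQ : n%:R <= (2 * m%:R) ^+ p :> R by rewrite -natrM -natrX ler_nat.
have d1 : delta_ r m n B / sigma <= c / m%:R.
  rewrite ler_pdivrMr//; apply: (@le_trans _ _ (c / m%:R * (s * (n ^ r.-1)%:R * m%:R ^+ 2))).
    rewrite le_eqVlt; apply/orP; left; apply/eqP.
    by rewrite /delta_ /c !natrM; field; rewrite !gt_eqF.
  by rewrite ler_wpM2l// divr_ge0// ltW.
have d2 : supbound r m n B / sigma <= c * (2 * m%:R) ^+ p.
  have -> : supbound r m n B / sigma = delta_ r m n B / sigma * n%:R.
    by rewrite /supbound /delta_ !natrM nrE; field; rewrite gt_eqF.
  apply: ler_pM => //; first by rewrite divr_ge0 ?mulr_ge0// ltW.
  by apply: le_trans d1 _; rewrite ler_pdivrMr// ler_peMr// ltW.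
have d3 : (n ^ r)%:R * B / sigma <= B / s * (2 * m%:R) ^+ p.
  rewrite ler_pdivrMr//; apply: (@le_trans _ _ (B / s * (2 * m%:R) ^+ p * (s * (n ^ r.-1)%:R * m%:R ^+ 2))).
    rewrite nrE [leRHS](_ : _ = (n ^ r.-1)%:R * ((2 * m%:R) ^+ p * m%:R ^+ 2) * B); last first.
      by field; rewrite gt_eqF.
    rewrite ler_wpM2r ?(ltW B0)// ler_wpM2l ?(ltW N0)//; apply: le_trans nQ _.
    by rewrite ler_peMr ?exprn_ege1// exprn_ge0// mulr_ge0// ltW.
  by rewrite ler_wpM2l//; apply: mulr_ge0; [rewrite divr_ge0// ltW|rewrite exprn_ge0// mulr_ge0// ltW].
split => //.
have Q0 : 0 <= (2 * m%:R) ^+ p :> R by rewrite exprn_ge0// mulr_ge0// ltW.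
have S0 : 0 <= supbound r m n B / sigma by rewrite divr_ge0 ?mulr_ge0// ltW.
have cm0 : 0 <= c / m%:R by rewrite divr_ge0// ltW.
apply: (@le_trans _ _ (B / s * (2 * m%:R) ^+ p * (k.+1%:R * (c / m%:R) ^+ p.+1 +
    (2 * m%:R) ^+ p * b * (c * (2 * m%:R) ^+ p) ^+ k))).
  apply: ler_pM => //.
  - by rewrite divr_ge0 ?mulr_ge0// ltW.
  - by rewrite addr_ge0 ?mulr_ge0 ?exprn_ge0.
  rewrite lerD2l; apply: ler_pM.
  - by rewrite mulr_ge0.
  - exact: exprn_ge0.
  - by rewrite ler_wpM2r.
  by apply: lerXn2r; rewrite ?nnegrE// mulr_ge0// ltW.
rewrite -[leLHS]mulrA -[leRHS]mulrA; apply: ler_wpM2l; first by rewrite divr_ge0 // ltW.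
rewrite [leLHS]mulrDr [leRHS]mulrDl; apply: lerD.
  rewrite le_eqVlt; apply/orP; left; apply/eqP.
  by rewrite [(2 * _) ^+ p]exprMn expr_div_n (exprS (m%:R : R) p); field; rewrite expf_neq0 gt_eqF.
rewrite [leLHS](_ : _ = 2 ^+ (p * k.+2) * c ^+ k * (m%:R ^+ (p * k.+2) * b)); last first.
  by rewrite !exprMn -!exprM !mulnS !exprD; ring.
rewrite ler_wpM2l ?mulr_ge0 ?exprn_ge0 ?(ltW c0)//.
by rewrite -[leRHS]mul1r ler_pdivlMr// mulrC mulrA -exprS mulrC.
Qed.

Definition nth_root_floor {R : realType} (p n : nat) := Num.truncn (n%:R `^ (p%:R^-1) : R).

(** The integer part m satisfies m <= n^(1/p) < m + 1 <= 2 m. *)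
Lemma nth_root_floor_bounds {R : realType} (p n : nat) : (0 < p)%N -> (0 < n)%N ->
  let m := @nth_root_floor R p n in
  [/\ (0 < m)%N, (n <= (2 * m) ^ p)%N & m%:R <= n%:R `^ (p%:R^-1) :> R].
Proof.
move=> p0 n0 m; set y : R := n%:R `^ (p%:R^-1).
have y1 : 1 <= y.
  by rewrite -[X in X <= _](powRr0 n%:R); apply: ler_powR; rewrite ?ler1n ?invr_ge0.
have m0 : (0 < m)%N by rewrite truncn_gt0.
split => //; last by rewrite truncn_le (le_trans ler01).
have yp : y ^+ p = n%:R by rewrite /y; case: (p) p0 => // p' _; exact: powR_inv_exp.
rewrite -(ler_nat R) -yp natrX; apply: lerXn2r; rewrite ?nnegrE//; first exact: le_trans y1.
apply: le_trans (ltW (truncnS_gt y)) _; rewrite ler_nat.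
by rewrite (_ : Num.truncn y = m)// mulSn mul1n -addn1 leq_add2l.
Qed.

Lemma nth_root_floor_cvg {R : realType} (p A : nat) : (0 < p)%N ->
  \forall n \near \oo, (A <= @nth_root_floor R p n)%N.
Proof.
move=> p0; exists (A ^ p)%N => // n /= An.
rewrite truncn_ge_nat ?powR_ge0// -(@ler_pXn2r _ p) ?nnegrE ?powR_ge0//.
by case: p p0 An => // p _ An; rewrite powR_inv_exp// -natrX ler_nat.
Qed.

(** * One row of the array, read on the law of its sample *)

Section array_row.
Context {R : realType} {d : measure_display} {T : measurableType d}.
Variables (P : probability T R) (X : nat -> {RV P >-> R}) (r n : nat).
Variables (f : r.-tuple 'I_n -> r.-tuple R -> R) (B : R).
Hypothesis mf : forall j, measurable_fun setT (f j).
Hypothesis fB : forall j x, `|f j x| <= B.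

Lemma measurable_sample : measurable_fun setT (fun w => [tuple X i.+1 w | i < n]).
Proof. by apply: measurable_mktuple => i; exact: measurable_funPT. Qed.

Definition sample_law := law P measurable_sample.

Definition kernel (j : r.-tuple 'I_n) (x : n.-tuple R) :=
  f j [tuple tnth x (tnth j i) | i < r].

Definition centered_kernel j (x : n.-tuple R) := kernel j x - Ev sample_law (kernel j).

Definition row_scale := Num.sqrt (Ev sample_law (fun x => totalsum centered_kernel x ^+ 2)).

Definition normalized (x : n.-tuple R) := totalsum centered_kernel x / row_scale.

Lemma bmf_kernel j : bmf (kernel j).
Proof.
split; last by exists B => x; exact: fB.
apply: measurableT_comp; first exact: mf.
by apply: measurable_mktuple => i; exact: measurable_tnth.
Qed.

Lemma bmf_centered_kernel j : bmf (centered_kernel j).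
Proof. by apply: bmfB; [exact: bmf_kernel|exact: bmf_cst]. Qed.

Lemma centered_kernel_le j x : `|centered_kernel j x| <= 2 * B.
Proof.
apply: le_trans (ler_normB _ _) _; rewrite mulr_natl mulr2n; apply: lerD; first exact: fB.
by apply: norm_Ev_le; [exact: bmf_kernel|move=> y; exact: fB].
Qed.

Lemma centered_kernel_depends j : depends_on (fun i => i \in val j) (centered_kernel j).
Proof.
move=> x y xy; rewrite /centered_kernel /kernel; congr (f j _ - _).
apply: eq_from_tnth => i; rewrite !tnth_mktuple; apply: xy; exact: mem_tnth.
Qed.

Lemma Ev_centered_kernel j : Ev sample_law (centered_kernel j) = 0.
Proof.
rewrite EvB; [|exact: bmf_kernel|exact: bmf_cst].
by rewrite Ev_cst subrr.
Qed.

Lemma bmf_totalsum_centered : bmf (totalsum centered_kernel).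
Proof. by apply: bmf_sum => j _; exact: bmf_centered_kernel. Qed.

Lemma bmf_normalized : bmf normalized.
Proof. by apply: bmfM; [exact: bmf_totalsum_centered|exact: bmf_cst]. Qed.

Lemma Vsum_kernel w : Vsum X f w = \sum_j kernel j [tuple X i.+1 w | i < n].
Proof.
apply: eq_bigr => j _; rewrite /kernel; congr (f j _).
by apply: eq_from_tnth => i; rewrite !tnth_mktuple.
Qed.

Lemma expectation_sample (g : n.-tuple R -> R) : bmf g ->
  ('E_P[fun w => g [tuple X i.+1 w | i < n]] = (Ev sample_law g)%:E)%E.
Proof.
move=> bg; rewrite unlock Ev_law// EFin_Ev//.
by apply: (bmf_comp bg); exact: measurable_sample.
Qed.

Lemma Vsum_centered w :
  Vsum X f w - fine ('E_P[Vsum X f])%E = totalsum centered_kernel [tuple X i.+1 w | i < n].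
Proof.
have -> : Vsum X f = (fun w => \sum_j kernel j [tuple X i.+1 w | i < n]).
  by apply/funext => v; exact: Vsum_kernel.
rewrite (@expectation_sample (fun x => \sum_j kernel j x)); last first.
  by apply: bmf_sum => j _; exact: bmf_kernel.
rewrite /= Ev_sum => [|j _]; last exact: bmf_kernel.
by rewrite /totalsum /centered_kernel sumrB.
Qed.

Lemma variance_sample :
  ('V_P[Vsum X f] = (Ev sample_law (fun x => (totalsum centered_kernel x ^+ 2)%R))%:E)%E.
Proof.
rewrite -expectation_sample; last exact/bmfX/bmf_totalsum_centered.
rewrite /variance unlock; congr expectation; apply/funext => w.
by rewrite -Vsum_centered expr2.
Qed.

Lemma standardize_sample w :
  standardize P (Vsum X f) w = normalized [tuple X i.+1 w | i < n].
Proof. by rewrite /standardize Vsum_centered variance_sample. Qed.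

Lemma expectation_standardize k :
  ('E_P[fun w => (standardize P (Vsum X f) w ^+ k)%R] =
   (Ev sample_law (fun x => (normalized x ^+ k)%R))%:E)%E.
Proof.
rewrite -expectation_sample; last exact/bmfX/bmf_normalized.
by congr expectation; apply/funext => w; rewrite standardize_sample.
Qed.

Lemma measurable_normalized :
  measurable_fun setT (normalized : n.-tuple R -> measurableTypeR R).
Proof. by have [+ _] := bmf_normalized. Qed.

Definition normalized_law : probability (measurableTypeR R) R :=
  law sample_law measurable_normalized.

Lemma normalized_law_cdf x :
  P [set w | standardize P (Vsum X f) w <= x] = normalized_law `]-oo, x]%classic.
Proof.
rewrite /normalized_law /law /= /pushforward; congr (P _).
by apply/seteqP; split => w /=; rewrite in_itv/= standardize_sample.
Qed.

Lemma normalized_law_moment k :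
  normalized_law.-integrable setT (fun x => (x ^+ k)%:E) /\
  \int[normalized_law]_x x ^+ k = Ev sample_law (fun x => normalized x ^+ k).
Proof.
have mpow : measurable_fun [set: measurableTypeR R] (fun x : measurableTypeR R => (x ^+ k)%:E).
  apply/measurable_EFinP; apply: measurable_funX; exact: measurable_id.
have iW : sample_law.-integrable (normalized @^-1` setT) ((fun x => (x ^+ k)%:E) \o normalized).
  by rewrite preimage_setT; apply: bmf_integrable; apply: bmfX; exact: bmf_normalized.
split; first exact: (integrable_pushforward measurable_normalized mpow iW measurableT).
rewrite /Rintegral; congr fine.
rewrite (integral_pushforward measurable_normalized mpow iW measurableT).
by rewrite preimage_setT.
Qed.

End array_row.

(** m^4 <= n^(4/p) <= n^kappa, so the square root of n^kappa dominates m^2. *)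
Lemma variance_scale_lower {R : realType} (r p n : nat) (C kappa : R) :
  (0 < r)%N -> (0 < p)%N -> (0 < n)%N -> 0 <= C -> 4 / p%:R <= kappa ->
  Num.sqrt C * (n ^ r.-1)%:R * (@nth_root_floor R p n)%:R ^+ 2 <=
  Num.sqrt (C * n%:R `^ (2 * (r%:R - 1) + kappa)).
Proof.
move=> r0 p0 n0 C0 pk; have [_ _ mle] := @nth_root_floor_bounds R p n p0 n0.
set m : R := (nth_root_floor p n)%:R in mle *.
have n1 : 1 <= n%:R :> R by rewrite ler1n.
have m0 : 0 <= m by exact: ler0n.
have x0 : 0 <= Num.sqrt C * (n ^ r.-1)%:R * m ^+ 2 by rewrite !mulr_ge0// sqrtr_ge0.
rewrite -[leLHS](ger0_norm x0) -sqrtr_sqr; apply: ler_wsqrtr.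
rewrite !exprMn sqr_sqrtr// -mulrA ler_wpM2l//.
rewrite powRD; last by rewrite (gt_eqF (lt_le_trans ltr01 n1)) implybT.
have -> : 2 * (r%:R - 1) = (2 * r.-1)%:R :> R by rewrite -[in LHS](prednK r0) -natr1 natrM; ring.
rewrite powR_mulrn// natrX -!exprM [(2 * r.-1)%N]mulnC ler_wpM2l ?exprn_ge0//.
apply: (@le_trans _ _ (n%:R `^ (4 / p%:R))); last exact: ler_powR.
rewrite [4 / _]mulrC powRrM powR_mulrn ?powR_ge0// -exprD.
by apply: lerXn2r; rewrite ?nnegrE ?powR_ge0.
Qed.

Lemma rate_le_inv_pow {R : realType} (b h : R) (m D : nat) :
  (0 < m)%N -> b <= m%:R `^ (- h) -> D%:R <= h -> b * m%:R ^+ D <= 1.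
Proof.
move=> m0 bm Dh; have mR : 0 < m%:R :> R by rewrite ltr0n.
rewrite -ler_pdivlMr ?exprn_gt0// div1r; apply: le_trans bm _.
by rewrite -powR_invn ?ler0n//; apply: ler_powR; rewrite ?ler1n// lerN2.
Qed.

Theorem theorem5 (R : realType) (r : nat) (hr : (1 <= r)%N)
  (d : nat -> measure_display) (T : forall n : nat, measurableType (d n))
  (P : forall n : nat, probability (T n) R)
  (X : forall n : nat, nat -> {RV (P n) >-> R})
  (hX : forall n, (1 <= n)%N -> stationary (P n) (X n))
  (beta : nat -> nat -> R)
  (hbeta : forall n, (1 <= n)%N -> is_beta (P n) (X n) (beta n))
  (hreg : forall n, (1 <= n)%N -> decreases_to0 (beta n))
  (f : forall n : nat, r.-tuple 'I_n -> r.-tuple R -> R)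
  (hf : forall n (j : r.-tuple 'I_n), (1 <= n)%N -> measurable_fun setT (f n j))
  (F : nat -> R)
  (hfF : forall n (j : r.-tuple 'I_n) (x : r.-tuple R),
     (1 <= n)%N -> `|f n j x| < F n)
  (hF : exists (n0 : nat) (F0 : R), forall n, (n0 <= n)%N -> F n = F0)
  (C kappa : R) (hC : 0 < C) (hkappa : 0 < kappa)
  (h : nat -> R) (hpos : forall t, (1 <= t)%N -> 0 < h t)
  (hlim : h t @[t --> \oo] --> +oo)
  (hrate : forall n t, (1 <= n)%N -> (1 <= t)%N ->
     beta n t <= t%:R `^ (- h t))
  (hvar : forall n, (1 <= n)%N ->
     ((C * n%:R `^ (2 * (r%:R - 1) + kappa))%:E
        <= 'V_(P n)[Vsum (X n) (f n)])%E) :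
  let Vstar n := standardize (P n) (Vsum (X n) (f n)) in
  (forall k : nat, (1 <= k)%N ->
     ('E_(P n)[fun w => (Vstar n w ^+ k)%R] @[n --> \oo] -->
      'E_(normal_prob 0%R 1%R : probability _ R)[fun y : R => (y ^+ k)%R])%E) /\
  (forall x : R,
     P n [set w | Vstar n w <= x] @[n --> \oo] -->
     normal_prob 0 1 `]-oo, x]).
Proof.
move=> Vstar; have [n0 [F0 hF0]] := hF.
(* The shift skips row 0 and the rows before [n0], where [F] need not have its final value. *)
pose N n := (n + n0.+1)%N.
have N0 n : (0 < N n)%N by rewrite /N addnS.
have fB n j x : `|f (N n) j x| <= `|F0| + 1.
  apply: le_trans (ltW (hfF _ j x (N0 n))) _; rewrite hF0 /N; last by lia.
  by apply: le_trans (ler_norm _) _; rewrite lerDl.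
(* Centring at most doubles the bound; adding 1 makes it positive. *)
pose B : R := 2 * (`|F0| + 1); have B0 : 0 < B by rewrite mulr_gt0// ltr_wpDl.
pose p := (Num.truncn (4 / kappa)).+1; have p0 : (0 < p)%N by [].
have pk : 4 / p%:R <= kappa.
  by rewrite ler_pdivrMr ?ltr0n// mulrC -ler_pdivrMr// ltW// truncnS_gt.
pose m n := @nth_root_floor R p (N n).
have m0 n : (0 < m n)%N by have [] := @nth_root_floor_bounds R p (N n) p0 (N0 n).
have mlarge A : \forall n \near \oo, (A <= m n)%N.
  have [N1 _ hN1] := @nth_root_floor_cvg R p A p0.
  by exists N1 => // n /= Nn; apply: hN1 => /=; rewrite /N; lia.
have mfN n j := hf (N n) j (N0 n).
pose mu n := sample_law (X (N n)) (N n).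
pose zeta n := centered_kernel (X (N n)) (f (N n)).
pose sig n := row_scale (X (N n)) (f (N n)).
pose W n := normalized (X (N n)) (f (N n)).
pose s := Num.sqrt C; have s0 : 0 < s by rewrite sqrtr_gt0.
have sigE n : sig n ^+ 2 = Ev (mu n) (fun x => totalsum (zeta n) x ^+ 2).
  by rewrite sqr_sqrtr//; apply: Ev_ge0 => x; exact: sqr_ge0.
have slow n : s * (N n ^ r.-1)%:R * (m n)%:R ^+ 2 <= sig n.
  apply: le_trans (variance_scale_lower hr p0 (N0 n) (ltW hC) pk) _.
  apply: ler_wsqrtr; have := hvar _ (N0 n).
  by rewrite (variance_sample (X (N n)) (mfN n) (fB n)) lee_fin.
have sig0 n : 0 < sig n.
  by apply: lt_le_trans (slow n); rewrite !mulr_gt0// ?exprn_gt0 ?ltr0n ?expn_gt0 ?N0.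
have mixN n t : (0 < t)%N -> mixes (mu n) t (beta (N n) t).
  by move=> t0; apply: (is_beta_mixes (@measurable_sample _ _ _ _ (X (N n)) (N n)) (N0 n) (hbeta _ (N0 n))).
pose mom n k := Ev (mu n) (fun x => W n x ^+ k).
have bW n : bmf (W n) by exact: (bmf_normalized (X (N n)) (mfN n) (fB n)).
have mom0 n : mom n 0%N = 1.
  by rewrite -[RHS](Ev_cst (mu n) 1); congr Ev; apply/funext => x; rewrite expr0.
have tot0 n : Ev (mu n) (totalsum (zeta n)) = 0.
  rewrite /totalsum Ev_sum => [|J _]; last exact: (bmf_centered_kernel (X (N n)) (mfN n) (fB n)).
  by rewrite big1// => J _; exact: (Ev_centered_kernel (X (N n)) (mfN n) (fB n)).
have mom1 n : mom n 1%N = 0.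
  rewrite /mom (_ : (fun x => W n x ^+ 1) = (fun x => (sig n)^-1 * totalsum (zeta n) x)).
    rewrite EvZ ?tot0 ?mulr0//; exact: (bmf_totalsum_centered (X (N n)) (mfN n) (fB n)).
  by apply/funext => x; rewrite expr1 mulrC.
have mom2 n : mom n 2%N = 1.
  rewrite /mom (_ : (fun x => W n x ^+ 2) = (fun x => (sig n ^+ 2)^-1 * totalsum (zeta n) x ^+ 2)).
    rewrite EvZ ?sigE ?mulVf//; first by rewrite -sigE gt_eqF// exprn_gt0.
    exact/bmfX/(bmf_totalsum_centered (X (N n)) (mfN n) (fB n)).
  by apply/funext => x; rewrite expr_div_n mulrC.
have hankel n M (q : nat -> R) : 0 <= \sum_(i < M) \sum_(j < M) q i * q j * mom n (i + j)%N.
  rewrite (_ : \sum_(i < M) _ = Ev (mu n) (fun x => (\sum_(i < M) q i * W n x ^+ i) ^+ 2)).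
    by apply: Ev_ge0 => x; exact: sqr_ge0.
  have bt i : bmf (fun x => q i * W n x ^+ i) by apply: bmfM; [exact: bmf_cst|exact: bmfX].
  transitivity (Ev (mu n) (fun x => \sum_(i < M) \sum_(j < M) q i * q j * W n x ^+ (i + j))).
    have bt2 i j : bmf (fun x => q i * q j * W n x ^+ (i + j)) by apply: bmfM; [exact: bmf_cst|exact: bmfX].
    rewrite Ev_sum => [|i _]; last by apply: bmf_sum => j _.
    apply: eq_bigr => i _; rewrite Ev_sum => [|j _]; last exact: bt2.
    by apply: eq_bigr => j _; rewrite EvZ//; exact: bmfX.
  congr Ev; apply/funext => x; rewrite expr2 big_distrlr/=.
  by apply: eq_bigr => i _; apply: eq_bigr => j _; rewrite exprD; ring.
have epsc : ((m n)%:R^-1 : R) @[n --> \oo] --> (0 : R).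
  apply/cvgrPdist_le => e e0; apply: filterS (mlarge (Num.truncn e^-1).+1) => n hn.
  rewrite sub0r normrN ger0_norm ?invr_ge0// invf_ple ?posrE ?ltr0n//.
  by apply: le_trans (ltW (truncnS_gt _)) _; rewrite ler_nat.
have mcvg k : mom n k @[n --> \oo] --> (gauss_moment k : R).
  have [C1 [C10 hC1]] := @moment_recursion R r p.+1 hr.
  pose c := B * (2 * r)%:R / s.
  (* The coefficients must be chosen once for all [k]; rows with [c / m n > 1] get the value 0 and
     are excluded later, as [m n] tends to infinity. *)
  have rec n : exists a : nat -> R, c / (m n)%:R <= 1 -> forall k,
      `|mom n k.+1 - \sum_(1 <= j < p.+1) a j * (k ^_ j)%:R * mom n (k - j)%N| <=
      C1 k * ((N n ^ r)%:R * B / sig n * (k.+1%:R * (c / (m n)%:R) ^+ p.+1 +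
        (N n)%:R * beta (N n) (m n) * (supbound r (m n) (N n) B / sig n) ^+ k)) *
      (1 + mom n (2 * uphalf k)%N).
    have [c1|c1] := leP (c / (m n)%:R) 1; last by exists (fun=> 0).
    have [C2 hC2] := scaled_error p 0 hr B0 s0.
    have [_ hQ _] := @nth_root_floor_bounds R p (N n) p0 (N0 n).
    (* Only the bound on [delta_] is wanted at this point, so the rate is taken to be 0. *)
    have [|ds _] := hC2 (N n) (m n) (sig n) 0 (N0 n) (m0 n) hQ (slow n) (lexx 0).
      by rewrite mul0r.
    have [a ha] := hC1 (m n) (N n) (mu n) (beta (N n) (m n)) B (sig n) _ (zeta n) (m0 n) (N0 n)
      (mixN n _ (m0 n)) (bmf_centered_kernel (X (N n)) (mfN n) (fB n)) (ltW B0)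
      (centered_kernel_le (X (N n)) (mfN n) (fB n)) (@centered_kernel_depends _ _ _ _ (X (N n)) _ _ (f (N n)))
      (Ev_centered_kernel (X (N n)) (mfN n) (fB n)) (sig0 n) ds c1.
    by exists a.
  have /choice[a ha] := rec.
  apply: (@moment_cvg _ mom a (fun n => (m n)%:R^-1) p.+1) => //.
  move=> k'.
  have [C2 hC2] := scaled_error p k' hr B0 s0.
  exists (C1 k' * C2).
  (* For each fixed moment order, [h] is eventually at least the exponent required by
     [scaled_error]. *)
  have [T0 _ hT0] : \forall t \near \oo, (p * k'.+2).+1%:R <= h t by move/cvgryPge: hlim; apply.
  move: (mlarge T0) (mlarge (Num.truncn c).+1); apply: filterS2 => n hT hcm.
  have c1 : c / (m n)%:R <= 1.
    rewrite ler_pdivrMr ?ltr0n// mul1r.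
    by apply: le_trans (ltW (truncnS_gt _)) _; rewrite ler_nat.
  have [_ hQ _] := @nth_root_floor_bounds R p (N n) p0 (N0 n).
  have b1 := rate_le_inv_pow (m0 n) (hrate _ _ (N0 n) (m0 n)) (hT0 _ hT).
  have [_ err] := hC2 (N n) (m n) (sig n) _ (N0 n) (m0 n) hQ (slow n) (mixes_ge0 (mixN n _ (m0 n))) b1.
  apply: le_trans (ha n c1 k') _; rewrite ler_wpM2r//.
    by rewrite addr_ge0//; apply: Ev_ge0 => x; rewrite exprM exprn_ge0 ?sqr_ge0.
  by rewrite -[leRHS]mulrA; apply: ler_wpM2l.
split => [k k0|x].
  have -> : ('E_(normal_prob 0%R 1%R : probability _ R)[fun y : R => (y ^+ k)%R] = (gauss_moment k)%:E)%E.
    by rewrite unlock integral_gauss_moment.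
  rewrite -(cvg_shiftn n0.+1).
  under eq_fun do rewrite (expectation_standardize (X _) (mfN _) (fB _)).
  by apply: cvg_EFin; [exact: nearW|exact: mcvg].
rewrite -(cvg_shiftn n0.+1).
under eq_fun do rewrite (normalized_law_cdf (X _) (mfN _) (fB _)).
apply: moments_cvg_cdf => [n j|j].
  exact: (normalized_law_moment (X (N n)) (mfN n) (fB n) j).1.
under eq_fun do rewrite (normalized_law_moment (X _) (mfN _) (fB _) j).2.
exact: mcvg.
Qed.
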